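(* Let $q$ be a prime power with $q\equiv1\pmod4$ and let $m\ge n\ge1$ be integers. Then the restriction map $$\mathrm{res}:H^i(\mathrm{GL}_m(\mathbb{F}_q))\to H^i(\mathrm{GL}_{n-1}(\mathbb{F}_q))$$ is injective for $i<2n-1$.
   Context: $H^i(G)=H^i(G,\mathbb{Z}/2\mathbb{Z})$ is group cohomology with $\mathbb{Z}/2\mathbb{Z}$ coefficients. The group $\mathrm{GL}_{n-1}(\mathbb{F}_q)$ is regarded as a subgroup of $\mathrm{GL}_m(\mathbb{F}_q)$ via $A\mapsto\begin{pmatrix}A&0\\0&I_{m-n+1}\end{pmatrix}$ ($\mathrm{GL}_0$ is the trivial group), and $\mathrm{res}$ is the induced map in cohomology. *)

(* Defs.v *)
From HB Require Import structures.
From mathcomp Require Import all_boot all_order all_fingroup all_algebra zify.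
(* Last, so that repr is the representative map of a quotient type. *)
From mathcomp Require Import generic_quotient.

Set Implicit Arguments.
Unset Strict Implicit.
Unset Printing Implicit Defensive.

Import GRing.Theory.
Local Open Scope ring_scope.
Local Open Scope quotient_scope.

(* Cohomology H^i(G; A) of a finite group G with coefficients in a finite
   abelian group A with trivial G-action, computed from the complex of
   inhomogeneous cochains G^i -> A. *)

Section Cochains.
Variables (gT : finGroupType) (A : finZmodType).

Definition cochain (i : nat) : Type := {ffun i.-tuple gT -> A}.
HB.instance Definition _ i := GRing.Zmodule.on (cochain i).
HB.instance Definition _ i := Finite.on (cochain i).

(* With g = (g_0, ..., g_i): bar_face 0 g = (g_1, ..., g_i),
   bar_face j g = (g_0, ..., g_(j-1) g_j, ..., g_i) for 0 < j <= i, and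
   bar_face (i+1) g = (g_0, ..., g_(i-1)). *)
Definition bar_face i (j : nat) (g : i.+1.-tuple gT) : i.-tuple gT :=
  [tuple if (k.+1 < j)%N then tnth g (widen_ord (leqnSn i) k)
         else if (k.+1 == j)%N
              then (tnth g (widen_ord (leqnSn i) k) * tnth g (lift ord0 k))%g
              else tnth g (lift ord0 k)
   | k < i].

Definition cobound i (f : cochain i) : cochain i.+1 :=
  [ffun g : i.+1.-tuple gT => \sum_(j < i.+2) f (bar_face j g) *~ (-1) ^+ j].

Lemma coboundB i : {morph @cobound i : f h / f - h}.
Proof.
move=> f h; apply/ffunP=> g; rewrite !ffunE -sumrB.
by apply: eq_bigr => j _; rewrite !ffunE mulrzBl.
Qed.

Lemma cobound0 i : @cobound i 0 = 0.
Proof. by rewrite -[in LHS](subrr 0) coboundB subrr. Qed.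

Lemma nth_bar_face i j (g : i.+1.-tuple gT) l : (l < i)%N ->
  nth 1%g (bar_face j g) l =
  if (l.+1 < j)%N then nth 1%g g l
  else if (l.+1 == j)%N then (nth 1%g g l * nth 1%g g l.+1)%g
  else nth 1%g g l.+1.
Proof.
move=> lt_li; rewrite -[l]/(nat_of_ord (Ordinal lt_li)) -tnth_nth tnth_mktuple.
by rewrite !(tnth_nth 1%g).
Qed.

Lemma bar_face_comm i j k (g : i.+2.-tuple gT) : (j <= k)%N ->
  bar_face j (bar_face k.+1 g) = bar_face k (bar_face j g).
Proof.
move=> le_jk; apply: eq_from_tnth => l; rewrite !(tnth_nth 1%g).
have lt_l1 : (l < i.+1)%N := ltnW (ltn_ord l).
rewrite !(nth_bar_face, ltnS, eqSS) ?ltn_ord //.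
by do ![case: ifP => ?]; rewrite ?mulgA //; lia.
Qed.

Lemma cobound_cobound i (f : cochain i) : cobound (cobound f) = 0.
Proof.
apply/ffunP=> g; rewrite !ffunE.
under eq_bigr do rewrite ffunE mulrz_suml.
rewrite pair_bigA /= (bigID (fun p : 'I_i.+3 * 'I_i.+2 => p.1 <= p.2)%N) /=.
rewrite [X in _ + X](reindex_onto
  (fun p : 'I_i.+3 * 'I_i.+2 => (lift ord0 p.2, inord p.1))
  (fun p => (widen_ord (leqnSn _) p.2, inord p.1.-1))) /=; last first.
  move=> [a b] /=; rewrite -ltnNge => lt_ba.
  have lt_a := ltn_ord a.
  by congr pair; apply: val_inj; rewrite /= ?/bump /= ?inordK //; lia.
rewrite [X in _ + X](eq_bigl (fun p : 'I_i.+3 * 'I_i.+2 => p.1 <= p.2)%N).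
  rewrite -big_split big1 //= => -[a b] /= le_ab.
  rewrite inordK; last by have := ltn_ord b; lia.
  rewrite /bump /= add1n bar_face_comm // exprS mulN1r mulrNz mulrzAC.
  by rewrite subrr.
move=> [a b] /=; rewrite -ltnNge /bump /= add1n ltnS.
have [lt_a|le_a] := ltnP a i.+2.
  rewrite inordK // andb_idr // => _.
  apply/eqP; congr pair; apply: val_inj => /=; first by rewrite inordK.
  by rewrite inord_val.
have lt_b := ltn_ord b; rewrite [RHS]leqNgt (leq_trans lt_b le_a) /=.
apply/negP => /andP[_ /eqP[/(congr1 val) /= ea _]].
by have := ltn_ord (inord a : 'I_i.+2); rewrite ea ltnNge le_a.
Qed.

Definition cocycle_pred i : {pred cochain i} := [pred f | cobound f == 0].

Lemma cocycle_zmod_closed i : zmod_closed (@cocycle_pred i).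
Proof.
split=> [|f h]; rewrite !inE; first by rewrite cobound0.
by move=> /eqP df /eqP dh; rewrite coboundB df dh subrr.
Qed.

HB.instance Definition _ i :=
  GRing.isZmodClosed.Build (cochain i) (@cocycle_pred i)
    (@cocycle_zmod_closed i).

Record cocycle (i : nat) : Type :=
  Cocycle { cocycle_val : cochain i; _ : cocycle_val \in @cocycle_pred i }.
HB.instance Definition _ i := [isSub for @cocycle_val i].
HB.instance Definition _ i := [Finite of cocycle i by <:].
HB.instance Definition _ i := [SubChoice_isSubZmodule of cocycle i by <:].

Definition coboundary_pred i : {pred cocycle i} :=
  match i return {pred cocycle i} with
  | 0 => [pred z | z == 0]
  | i'.+1 => [pred z | [exists c : cochain i', val z == cobound c]]
  end.

Lemma coboundary_zmod_closed i : zmod_closed (@coboundary_pred i).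
Proof.
case: i => [|i]; split; rewrite ?inE //.
- by move=> x y; rewrite !inE => /eqP-> /eqP->; rewrite subrr.
- by apply/existsP; exists 0; rewrite cobound0.
move=> x y; rewrite !inE => /existsP[c /eqP xc] /existsP[c' /eqP yc'].
by apply/existsP; exists (c - c'); rewrite raddfB /= xc yc' coboundB.
Qed.

HB.instance Definition _ i :=
  GRing.isZmodClosed.Build (cocycle i) (@coboundary_pred i)
    (@coboundary_zmod_closed i).

Definition cohomology (i : nat) : Type := Quotient.quot (@coboundary_pred i).
HB.instance Definition _ i := GRing.Zmodule.on (cohomology i).
HB.instance Definition _ i := Quotient.on (cohomology i).

End Cochains.

Notation "''H^' i ( gT ; A )" := (cohomology gT A i)
  (at level 8, i at level 2, format "''H^' i ( gT ;  A )") : type_scope.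

Section Restriction.
Variables (hT gT : finGroupType) (A : finZmodType).
Variable phi : {multiplicative hT -> gT}.

Definition cochain_res i (f : cochain gT A i) : cochain hT A i :=
  [ffun h : i.-tuple hT => f (map_tuple phi h)].

Lemma bar_face_map i j (h : i.+1.-tuple hT) :
  bar_face j (map_tuple phi h) = map_tuple phi (bar_face j h).
Proof.
apply: eq_from_tnth => k; rewrite !(tnth_mktuple, tnth_map).
by case: ltnP => // _; case: eqP => // _; rewrite gmulfM.
Qed.

Lemma cochain_resB i : {morph @cochain_res i : f g / f - g}.
Proof. by move=> f g; apply/ffunP=> h; rewrite !ffunE. Qed.

Lemma cobound_res i (f : cochain gT A i) :
  cobound (cochain_res f) = cochain_res (cobound f).
Proof.
apply/ffunP=> h; rewrite !ffunE.
by apply: eq_bigr => j _; rewrite ffunE bar_face_map.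
Qed.

Lemma cocycle_res_subproof i (z : cocycle gT A i) :
  cochain_res (val z) \in @cocycle_pred hT A i.
Proof.
rewrite inE cobound_res; have := valP z; rewrite inE => /eqP->.
by apply/eqP/ffunP=> h; rewrite !ffunE.
Qed.

Definition cocycle_res i (z : cocycle gT A i) : cocycle hT A i :=
  Cocycle (cocycle_res_subproof z).

Definition res i (x : 'H^i(gT; A)) : 'H^i(hT; A) :=
  \pi_('H^i(hT; A)) (cocycle_res (repr x)).

Lemma res_pi i (z : cocycle gT A i) :
  res (\pi_('H^i(gT; A)) z) = \pi_('H^i(hT; A)) (cocycle_res z).
Proof.
have : (repr (\pi_('H^i(gT; A)) z) = z %[mod 'H^i(gT; A)]) by rewrite reprK.
rewrite /res; move: (repr _) => y /eqP yz; apply/eqP.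
rewrite -Quotient.idealrBE; move: yz; rewrite -Quotient.idealrBE.
case: i z y => [|i] z y; rewrite !inE.
  by rewrite subr_eq0 => /eqP->; rewrite subrr.
move=> /existsP[c /eqP yzc]; apply/existsP; exists (cochain_res c).
by rewrite cobound_res -yzc raddfB /= -cochain_resB.
Qed.

End Restriction.

Arguments res {hT gT A} phi {i} x.

(* The library's {'GL_n[R]} is GL_1 when n = 0; here GL_0 is the trivial
   group. *)
Section GeneralLinear.
Variable F : finFieldType.

Record GL (n : nat) : Type := MkGL { GL_mx : 'M[F]_n; _ : GL_mx \in unitmx }.
HB.instance Definition _ n := [isSub for @GL_mx n].
HB.instance Definition _ n := [Finite of GL n by <:].

Section Group.
Variable n : nat.
Implicit Types A B : GL n.

Lemma GL_mul_subproof A B : val A *m val B \in unitmx.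
Proof. by rewrite unitmx_mul (valP A) (valP B). Qed.
Lemma GL_inv_subproof A : invmx (val A) \in unitmx.
Proof. by rewrite unitmx_inv (valP A). Qed.

Definition GL_one : GL n := MkGL (unitmx1 F n).
Definition GL_mul A B : GL n := MkGL (GL_mul_subproof A B).
Definition GL_inv A : GL n := MkGL (GL_inv_subproof A).

Lemma GL_mulA : associative GL_mul.
Proof. by move=> A B C; apply: val_inj; rewrite /= mulmxA. Qed.
Lemma GL_mul1 : left_id GL_one GL_mul.
Proof. by move=> A; apply: val_inj; rewrite /= mul1mx. Qed.
Lemma GL_mulV : left_inverse GL_one GL_inv GL_mul.
Proof. by move=> A; apply: val_inj; rewrite /= mulVmx ?(valP A). Qed.

HB.instance Definition _ :=
  Finite_isGroup.Build (GL n) GL_mulA GL_mul1 GL_mulV.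
End Group.

Lemma castmx_unit a b (eq_ab : a = b) (A : 'M[F]_a) :
  (castmx (eq_ab, eq_ab) A \in unitmx) = (A \in unitmx).
Proof. by case: b / eq_ab; rewrite castmx_id. Qed.

Lemma castmxM a b (eq_ab : a = b) (A B : 'M[F]_a) :
  castmx (eq_ab, eq_ab) (A *m B) =
  castmx (eq_ab, eq_ab) A *m castmx (eq_ab, eq_ab) B.
Proof. by case: b / eq_ab; rewrite !castmx_id. Qed.

(* A |-> [A, 0; 0, I_(m - k)], with k + (m - k) identified with m. *)
Section Stabilization.
Variables (k m : nat) (le_km : (k <= m)%N).

Definition stab_mx (A : 'M[F]_k) : 'M[F]_m :=
  castmx (subnKC le_km, subnKC le_km) (block_mx A 0 0 (1%:M : 'M_(m - k))).

Lemma stab_mx_unit (A : GL k) : stab_mx (val A) \in unitmx.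
Proof.
by rewrite /stab_mx castmx_unit unitmxE det_ublock det1 mulr1 -unitmxE (valP A).
Qed.

Definition GL_stab (A : GL k) : GL m := MkGL (stab_mx_unit A).

Lemma GL_stabM : {morph GL_stab : A B / (A * B)%g}.
Proof.
move=> A B; apply: val_inj; rewrite /= /stab_mx.
rewrite -castmxM mulmx_block.
by rewrite !mulmx0 !mul0mx !addr0 !add0r mulmx1.
Qed.

HB.instance Definition _ := isMultiplicative.Build _ _ GL_stab GL_stabM.
End Stabilization.

End GeneralLinear.

Arguments GL_stab F {k m} le_km A.

(* H^i(G) = H^i(G; Z/2). *)
Notation "''H^' i ( gT )" := (cohomology gT 'F_2 i)
  (at level 8, i at level 2, format "''H^' i ( gT )") : type_scope.

(* Main.v *)
Require Import Defs.
From HB Require Import structures.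
From mathcomp Require Import generic_quotient.
From mathcomp Require Import all_boot all_order all_fingroup all_algebra.
From mathcomp Require Import all_solvable zify.
From Stdlib Require Import ClassicalEpsilon.

(** Both sides vanish on the same classes because the kernel of the restriction
from GL_(k+1) to GL_k is too small to meet degree at most 2k.  Two facts
about GL_n over a field with q = 1 mod 4 elements carry the argument.

Detection ([detects_blk1]): a class on GL_(n+1) that vanishes on
GL_n x GL_1 is zero.  If n+1 is not a power of 2, some proper Levi subgroup
GL_a x GL_b has odd index, hence detects by transfer ([detects_levi]), and
the second factor is split further by induction and the Kuenneth theorem
([detects_prod]).  If n+1 = 2k is a power of 2, the subgroup of odd index is
the wreath product W of K = GL_k by a group of order 2 ([detects_double]).
The cohomology of W is detected by K x K and by C2 x K ([wreath_detect]); in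
GL_2k the exchange of two blocks is conjugate to diag(1, -1), so that C2 x K
is conjugate into K x K.

Exterior relation ([symb_GL2]): the product of two elements of H_1(GL_1)
vanishes in H_2(GL_2).  With z = diag(a, a), s = diag(a, 1) and w the
exchange of the coordinates, the square of sw is z, which gives
0 = <sw, z> = <s, z> + <w, z>; the last symbol vanishes because w is
conjugate to diag(1, -1), the square of a diagonal matrix.

Stability ([stable_step]): let x be a class of degree i <= 2k on GL_(k+1)
that vanishes on GL_k.  By detection it is enough that the slant products of
x with the cycles of degree j on GL_1 vanish.  For j = 0 they are multiples
of the restriction of x.  In general they are classes of degree i - j on
GL_k that vanish on GL_(k-1), because the copies of GL_1 in the diagonal
torus are conjugate; so induction applies if j >= 2.  For j = 1 the degree
exceeds the bound by one; the extra input needed there ([stable_edge]) is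
that a second slant product of degree 1 vanishes, which is the exterior
relation.

The proof of [wreath_detect] follows Steenrod and Nakaoka.  A class on W that
vanishes on K x K is a sum of products of powers of the generator t of
H^1(C2) with squares f (x) f ([squares_form]), because a symmetric class on
K x K is a square plus a norm ([symmetric_class]).  Restricted to C2 x K, the
square of f has leading term t^d f, where d is the degree of f; this is the
statement that the Steenrod operation Sq^0 is the identity, and it can be
read off from the explicit cup-i coproduct ([cup], [dcup_top], [dcup_gt]).

Everything is done with complexes given by a basis, over the field with two
elements: a boundary is a list of cells and no signs occur.  A group acts on
the cells; a cochain is a function on cells, and an invariant cocycle is zero
in cohomology when it is [null], the coboundary of an invariant cochain.  The
comparison of resolutions ([lift_chmap], [chmap_homotopy]) lets each
group be resolved by the complex that suits the argument. *)

Set Implicit Arguments.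
Unset Strict Implicit.
Unset Printing Implicit Defensive.
Import GRing.Theory.
Local Open Scope ring_scope.

(** * Sums over the field with two elements *)

Lemma F2_cases (x : 'F_2) : x = 0 \/ x = 1.
Proof.
by case: x => [[|[|n]] lt_n2] //; [left | right]; apply: val_inj.
Qed.

Lemma addF2 (x : 'F_2) : x + x = 0.
Proof. by case: (F2_cases x) => ->; apply/eqP. Qed.

Lemma eqF2 (x y : 'F_2) : x + y = 0 -> x = y.
Proof. by case: (F2_cases x) => ->; case: (F2_cases y) => -> // /eqP. Qed.

(** Linear identities are decided by reflection: both sides are sums of
    atoms, and only the parity of the number of occurrences of each atom
    matters. *)
Inductive F2expr := F2var of nat | F2add of F2expr & F2expr | F2zero.

Fixpoint F2vars e :=
  match e with
  | F2var i => [:: i]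
  | F2add e1 e2 => F2vars e1 ++ F2vars e2
  | F2zero => [::]
  end.

Fixpoint F2denote (env : seq 'F_2) e : 'F_2 :=
  match e with
  | F2var i => nth 0 env i
  | F2add e1 e2 => F2denote env e1 + F2denote env e2
  | F2zero => 0
  end.

Lemma F2denoteE env e : F2denote env e = \sum_(i <- F2vars e) nth 0 env i.
Proof.
elim: e => [i|e1 IH1 e2 IH2|] /=; first by rewrite big_seq1.
  by rewrite big_cat IH1 IH2.
by rewrite big_nil.
Qed.

Lemma sum_even (f : nat -> 'F_2) (v : seq nat) :
  all (fun i => ~~ odd (count_mem i v)) v -> \sum_(i <- v) f i = 0.
Proof.
move: {2}(size v) (leqnn (size v)) => n.
elim: n v => [|n IH] [|i v] //=; rewrite ?big_nil // eqxx add1n oddS negbK.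
rewrite ltnS => le_vn /andP[ov ev].
have iv : i \in v by rewrite -has_pred1 has_count; case: (count _ v) ov.
rewrite big_cons (perm_big _ (perm_to_rem iv)) big_cons addrA addF2 add0r.
apply: IH; first by rewrite size_rem //; case: (size v) le_vn => // m /ltnW.
apply/allP => k /mem_rem kv; have := allP ev k kv.
rewrite (seq.permP (perm_to_rem iv)) /=.
by case: (i == k); rewrite ?add0n ?add1n ?oddS ?negbK.
Qed.

Lemma F2reflect env e1 e2 : (let v := F2vars e1 ++ F2vars e2 in
    all (fun i => ~~ odd (count_mem i v)) v) ->
  F2denote env e1 = F2denote env e2.
Proof.
by move=> even_v; apply: eqF2; rewrite !F2denoteE -big_cat; apply: sum_even.
Qed.

Ltac F2index t env :=
  lazymatch env with
  | t :: _ => constr:(0%N)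
  | _ :: ?env' => let i := F2index t env' in constr:(S i)
  end.
Ltac F2env t env :=
  lazymatch t with
  | GRing.add ?a ?b => let env' := F2env a env in F2env b env'
  | GRing.zero => env
  | _ => lazymatch env with
         | context [t :: _] => env
         | _ => constr:(t :: env)
         end
  end.
Ltac F2reify t env :=
  lazymatch t with
  | GRing.add ?a ?b =>
    let ea := F2reify a env in let eb := F2reify b env in
    constr:(F2add ea eb)
  | GRing.zero => constr:(F2zero)
  | _ => let i := F2index t env in constr:(F2var i)
  end.
Ltac F2solve :=
  lazymatch goal with
  | |- ?a = ?b =>
    let env0 := F2env a (@nil 'F_2) in let env := F2env b env0 in
    let ea := F2reify a env in let eb := F2reify b env in
    apply: (@F2reflect env ea eb); vm_compute; reflexivity
  end.

Section Chains.
Variables S T : Type.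

(** A list of cells stands for the sum of its entries; two lists are the same
    chain when all cochains agree on them, so that chains are only ever
    compared through [ev]. *)
Definition ev (U : Type) (f : U -> 'F_2) (c : seq U) : 'F_2 := \sum_(t <- c) f t.
Definition lin_ext (A : S -> seq T) (c : seq S) : seq T := flatten (map A c).

Lemma ev_lin_ext f (A : S -> seq T) c : ev f (lin_ext A c) = ev (fun s => ev f (A s)) c.
Proof. by rewrite /ev /lin_ext big_flatten big_map. Qed.

Lemma ev_map f (A : S -> T) c : ev f (map A c) = ev (fun s => f (A s)) c.
Proof. by rewrite /ev big_map. Qed.
End Chains.

Section ChainLemmas.
Variable T : Type.
Implicit Types (f g : T -> 'F_2) (c d : seq T).

Lemma ev_nil f : ev f [::] = 0.
Proof. exact: big_nil. Qed.
Lemma ev_cons f t c : ev f (t :: c) = f t + ev f c.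
Proof. exact: big_cons. Qed.
Lemma ev_seq1 f t : ev f [:: t] = f t.
Proof. exact: big_seq1. Qed.
Lemma ev_cat f c d : ev f (c ++ d) = ev f c + ev f d.
Proof. exact: big_cat. Qed.
Lemma eq_ev f g c : f =1 g -> ev f c = ev g c.
Proof. by move=> fg; apply: eq_bigr => t _. Qed.
Lemma eq_ev_all (p : pred T) f g c :
  all p c -> (forall t, p t -> f t = g t) -> ev f c = ev g c.
Proof.
move=> pc fg; elim: c pc => [|t c IH]; rewrite ?ev_nil ?ev_cons //=.
by move=> /andP[/fg-> /IH->].
Qed.
Lemma evD f g c : ev (fun t => f t + g t) c = ev f c + ev g c.
Proof. exact: big_split. Qed.
Lemma ev0 c : ev (fun=> 0) c = 0.
Proof. exact: big1_eq. Qed.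
Lemma ev0_all (p : pred T) f c :
  all p c -> (forall t, p t -> f t = 0) -> ev f c = 0.
Proof. by move=> pc f0; rewrite (eq_ev_all pc f0) ev0. Qed.
Lemma evMl f a c : ev (fun t => a * f t) c = a * ev f c.
Proof. by rewrite /ev mulr_sumr. Qed.
Lemma evMr f a c : ev (fun t => f t * a) c = ev f c * a.
Proof. by rewrite /ev mulr_suml. Qed.
End ChainLemmas.

Lemma ev_exch S T (f : S -> T -> 'F_2) c d :
  ev (fun s => ev (f s) d) c = ev (fun t => ev (f^~ t) c) d.
Proof. exact: exchange_big. Qed.

Lemma all_lin_ext S T (A : S -> seq T) (p : pred S) (q : pred T) c :
  all p c -> (forall s, p s -> all q (A s)) -> all q (lin_ext A c).
Proof.
move=> + pq; elim: c => //= s c IH /andP[/pq ps /IH pc].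
by rewrite /lin_ext /= all_cat ps.
Qed.

(** * Complexes with a basis and equivariant chain maps *)

(** Augmented complexes with a basis; the augmentation is 1 on each cell of
    degree 0, and [bd_aug] says that it kills boundaries. *)
Record cplx := Cplx {
  cell :> Type;
  dg : cell -> nat;
  bd : cell -> seq cell;
  bd_dg : forall s, all (fun t => (dg t).+1 == dg s) (bd s);
  bd_bd : forall f s, ev (fun t => ev f (bd t)) (bd s) = 0;
  bd_aug : forall s, ev (fun t => (dg t == 0%N)%:R) (bd s) = 0 }.
Arguments dg {c} _.
Arguments bd {c} _.

Section Cochains.
Variable C : cplx.
Implicit Types (f g : C -> 'F_2) (s : C) (c : seq C) (i : nat).

Definition aug s : 'F_2 := (dg s == 0%N)%:R.
Definition cobd f s : 'F_2 := ev f (bd s).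
Definition cocyc f := forall s, cobd f s = 0.
Definition homog i f := forall s, dg s != i -> f s = 0.

Lemma cobd_cobd f s : cobd (cobd f) s = 0.
Proof. exact: bd_bd. Qed.
Lemma cobdD f g s : cobd (fun t => f t + g t) s = cobd f s + cobd g s.
Proof. exact: evD. Qed.
Lemma eq_cobd f g s : f =1 g -> cobd f s = cobd g s.
Proof. exact: eq_ev. Qed.
Lemma cocycD f g : cocyc f -> cocyc g -> cocyc (fun s => f s + g s).
Proof. by move=> zf zg s; rewrite cobdD zf zg addr0. Qed.
Lemma eq_cocyc f g : f =1 g -> cocyc f -> cocyc g.
Proof. by move=> fg zf s; rewrite -(eq_cobd _ fg). Qed.
Lemma homogD i f g : homog i f -> homog i g -> homog i (fun s => f s + g s).
Proof. by move=> hf hg s ds; rewrite hf ?hg ?addr0. Qed.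
Lemma bd0 s : dg s = 0%N -> bd s = [::].
Proof. by move=> s0; have := bd_dg s; rewrite s0; case: (bd s). Qed.

Variable (gT : finGroupType) (a : gT -> C -> C).

Record action_on : Prop := ActionOn {
  act_1 : forall s, a 1%g s = s;
  act_M : forall x y s, a (x * y)%g s = a x (a y s);
  act_dg : forall x s, dg (a x s) = dg s;
  act_bd : forall f x s, ev f (bd (a x s)) = ev (fun t => f (a x t)) (bd s) }.

Definition invar f := forall x s, f (a x s) = f s.
Definition null f := exists2 g, invar g & f =1 cobd g.

(** Freeness of the action, in the form of an equivariant map to the group
    acting by left translations. *)
Definition free_by (nu : C -> gT) := forall x s, nu (a x s) = (x * nu s)%g.

Lemma invarD f g : invar f -> invar g -> invar (fun s => f s + g s).
Proof. by move=> If Ig x s; rewrite If Ig. Qed.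
Lemma eq_null f g : f =1 g -> null f -> null g.
Proof. by move=> fg [h Ih fh]; exists h => // s; rewrite -fg. Qed.
Lemma null0 f : f =1 (fun=> 0) -> null f.
Proof. by move=> f0; exists (fun=> 0) => // s; rewrite f0 /cobd ev0. Qed.
Lemma nullD f g : null f -> null g -> null (fun s => f s + g s).
Proof.
move=> [h Ih fh] [k Ik gk]; exists (fun s => h s + k s); first exact: invarD.
by move=> s; rewrite cobdD fh gk.
Qed.
Lemma null_eqD f g : null (fun s => f s + g s) -> null g -> null f.
Proof.
move=> nfg ng; apply: eq_null (nullD nfg ng) => s.
by rewrite -addrA addF2 addr0.
Qed.
Lemma null_cocyc f : null f -> cocyc f.
Proof. by case=> g _ fg s; rewrite (eq_cobd _ fg) cobd_cobd. Qed.

Hypothesis aP : action_on.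

Lemma act_K x : cancel (a x) (a x^-1%g).
Proof. by move=> s; rewrite -(act_M aP) mulVg (act_1 aP). Qed.
Lemma act_KV x : cancel (a x^-1%g) (a x).
Proof. by move=> s; rewrite -(act_M aP) mulgV (act_1 aP). Qed.
Lemma invar_cobd f : invar f -> invar (cobd f).
Proof. by move=> If x s; rewrite /cobd (act_bd aP); apply: eq_ev. Qed.

(** A homogeneous coboundary is the coboundary of a homogeneous cochain: the
    other components of a primitive can be dropped. *)
Lemma null_homog i f : homog i f -> null f ->
  exists g, [/\ invar g, f =1 cobd g & forall s, (dg s).+1 != i -> g s = 0].
Proof.
move=> hf [g Ig fg].
exists (fun s => if (dg s).+1 == i then g s else 0); split.
- by move=> x s; rewrite (act_dg aP) Ig.
- move=> s; case: (eqVneq (dg s) i) => [<-|ds]; last first.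
    rewrite hf //; apply/esym; apply: ev0_all (bd_dg s) _ => t /eqP->.
    by rewrite (negbTE ds).
  rewrite fg; apply: eq_ev_all (bd_dg s) _ => t /eqP->.
  by rewrite eqxx.
by move=> s /negbTE->.
Qed.

Section Representatives.
Variable nu : C -> gT.
Hypothesis nuP : free_by nu.
Definition rep s := a (nu s)^-1%g s.
Lemma rep_act x s : rep (a x s) = rep s.
Proof. by rewrite /rep nuP invMg (act_M aP) act_K. Qed.
Lemma act_rep s : a (nu s) (rep s) = s.
Proof. exact: act_KV. Qed.
Lemma dg_rep s : dg (rep s) = dg s.
Proof. exact: act_dg. Qed.
End Representatives.
End Cochains.

Arguments aug {C} s.

(** An acyclic complex is given with a contraction onto a point [cpt] of
    degree 0.  No equivariance is asked of it. *)
Record contraction (C : cplx) := Contraction {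
  ch :> C -> seq C;
  cpt : C;
  cpt_dg : dg cpt = 0%N;
  ch_dg : forall s, all (fun t => dg t == (dg s).+1) (ch s);
  chP : forall f s,
    ev (cobd f) (ch s) + ev (fun t => ev f (ch t)) (bd s) = f s + aug s * f cpt }.

Section ChainMaps.
Variables (P Q : cplx) (gT : finGroupType) (a : gT -> P -> P) (b : gT -> Q -> Q).

Definition pull (phi : P -> seq Q) (f : Q -> 'F_2) s := ev f (phi s).

Record chmap (phi : P -> seq Q) : Prop := ChMap {
  chmap_dg : forall s, all (fun t => dg t == dg s) (phi s);
  chmap_bd : forall f s, pull phi (cobd f) s = cobd (pull phi f) s;
  chmap_act : forall f x s, pull phi f (a x s) = pull phi (fun t => f (b x t)) s;
  chmap_aug : forall s, pull phi aug s = aug s }.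

Lemma pull_homog phi i f : chmap phi -> homog i f -> homog i (pull phi f).
Proof.
move=> phiP hf s ds; apply: ev0_all (chmap_dg phiP s) _ => t /eqP dt.
by rewrite hf // dt.
Qed.
Lemma pull_invar phi f : chmap phi -> invar b f -> invar a (pull phi f).
Proof. by move=> phiP If x s; rewrite (chmap_act phiP); apply: eq_ev. Qed.
Lemma pull_cocyc phi f : chmap phi -> cocyc f -> cocyc (pull phi f).
Proof.
move=> phiP zf s; rewrite -(chmap_bd phiP).
by rewrite -[RHS](ev0 (phi s)); apply: eq_ev.
Qed.
Lemma pull_null phi f : chmap phi -> null b f -> null a (pull phi f).
Proof.
move=> phiP [g Ig fg]; exists (pull phi g); first exact: pull_invar.
by move=> s; rewrite -(chmap_bd phiP); apply: eq_ev.
Qed.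

Hypotheses (aP : action_on a) (bP : action_on b).
Variables (nu : P -> gT) (h : contraction Q).
Hypothesis nuP : free_by a nu.
Local Notation nrep := (rep a nu).

(** The comparison map from a free complex to an acyclic one, by recursion
    on the degree: on a representative s of each orbit it is the contraction
    applied to the image of the boundary of s, and elsewhere it is extended by
    equivariance.  It is kept transparent, because its values in low degrees are
    computed later. *)
Fixpoint lift_rec n s : seq Q :=
  if n is n'.+1 then map (b (nu s)) (lin_ext h (lin_ext (lift_rec n') (bd (nrep s))))
  else [:: b (nu s) (cpt h)].
Definition lift s := lift_rec (dg s) s.

Lemma lift_dg s : all (fun t => dg t == dg s) (lift s).
Proof.
rewrite /lift; move ds: (dg s) => n.
elim: n s ds => [|n IH] s ds /=.
  by rewrite (act_dg bP) cpt_dg eqxx.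
rewrite all_map; apply: (@all_lin_ext _ _ _ (fun t => dg t == n)); last first.
  move=> t /eqP dt; apply: sub_all (ch_dg h t) => u /=.
  by rewrite (act_dg bP) dt.
apply: all_lin_ext (bd_dg _) _ => t.
by rewrite (dg_rep aP) ds eqSS => /eqP dt; apply: IH.
Qed.

Lemma pull_lift f s :
  pull lift f s = if dg s == 0%N then f (b (nu s) (cpt h)) else
    ev (fun t => pull lift (fun u => ev (fun v => f (b (nu s) v)) (h u)) t)
      (bd (nrep s)).
Proof.
rewrite /pull {1}/lift; case ds: (dg s) => [|n] /=; first by rewrite ev_seq1.
rewrite ev_map !ev_lin_ext; apply: eq_ev_all (bd_dg _) _ => t.
by rewrite (dg_rep aP) ds eqSS /lift => /eqP->.
Qed.

Lemma lift_act f x s : pull lift f (a x s) = pull lift (fun t => f (b x t)) s.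
Proof.
rewrite !pull_lift (act_dg aP) nuP (rep_act aP nuP) (act_M bP).
case: eqP => // _; apply: eq_ev => t; apply: eq_ev => u; apply: eq_ev => v.
by rewrite (act_M bP).
Qed.

Lemma lift_aug s : pull lift aug s = aug s.
Proof.
rewrite /pull; case: (eqVneq (dg s) 0%N) => [s0|/negPf s0]; rewrite /aug.
  rewrite [LHS](@eq_ev_all _ (fun t => dg t == dg s) _ (fun=> 1)) ?lift_dg //.
    by rewrite /lift s0 ev_seq1.
  by move=> t; rewrite s0 => ->.
rewrite s0; apply: ev0_all (lift_dg s) _ => t /eqP->.
by rewrite s0.
Qed.

Lemma lift_bd f s : pull lift (cobd f) s = cobd (pull lift f) s.
Proof.
move: {2}(dg s) (erefl (dg s)) => n; elim: n s f => [|n IH] s f ds.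
  by rewrite pull_lift ds /cobd (bd0 ds) bd0 ?ev_nil // (act_dg bP) cpt_dg.
rewrite pull_lift ds /=; set f' := fun v => f (b (nu s) v).
have -> : cobd (pull lift f) s = cobd (pull lift f') (nrep s).
  rewrite -{1}(act_rep aP nu s) /cobd (act_bd aP).
  by apply: eq_ev => t; rewrite lift_act.
transitivity (ev (pull lift (fun u => f' u + aug u * f' (cpt h)
    + cobd (fun t => ev f' (h t)) u)) (bd (nrep s))).
  apply: eq_ev => t; apply: eq_ev => u; rewrite -(chP h f' u) /cobd.
  rewrite -addrA addF2 addr0; apply: eq_ev => v; exact: (act_bd bP).
transitivity (ev (fun t => pull lift f' t + aug t * f' (cpt h)
    + cobd (pull lift (fun t => ev f' (h t))) t) (bd (nrep s))).
  apply: eq_ev_all (bd_dg _) _ => t; rewrite (dg_rep aP) ds eqSS => /eqP dt.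
  by rewrite /pull !evD evMr -IH // -lift_aug.
rewrite !evD evMr; have -> : ev aug (bd (nrep s)) = 0 := bd_aug _.
by rewrite mul0r addr0 [X in _ + X]cobd_cobd addr0.
Qed.

Lemma lift_chmap : chmap lift.
Proof. by split; [apply: lift_dg|apply: lift_bd|apply: lift_act|apply: lift_aug]. Qed.

Section Homotopy.
Variables phi psi : P -> seq Q.
Hypotheses (phiP : chmap phi) (psiP : chmap psi).

(** The same recursion, for a homotopy between two chain maps. *)
Fixpoint homotopy_rec n s : seq Q :=
  map (b (nu s)) (lin_ext h (phi (nrep s) ++ psi (nrep s) ++
    if n is n'.+1 then lin_ext (homotopy_rec n') (bd (nrep s)) else [::])).
Definition homotopy s := homotopy_rec (dg s) s.

Lemma pull_homotopy f s : let f' u := ev (fun v => f (b (nu s) v)) (h u) in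
  pull homotopy f s = pull phi f' (nrep s) + pull psi f' (nrep s) + ev (pull homotopy f') (bd (nrep s)).
Proof.
move=> f'; rewrite {1}/pull {1}/homotopy; case ds: (dg s) => [|n] /=.
  rewrite ev_map ev_lin_ext !ev_cat ev_nil bd0 ?(dg_rep aP) // ev_nil addr0.
  by rewrite !addr0.
rewrite ev_map !ev_lin_ext !ev_cat ev_lin_ext addrA; congr (_ + _).
apply: eq_ev_all (bd_dg _) _ => t.
by rewrite (dg_rep aP) ds eqSS /pull /homotopy => /eqP->.
Qed.

Lemma homotopy_dg s : all (fun t => dg t == (dg s).+1) (homotopy s).
Proof.
rewrite /homotopy; move ds: (dg s) => n.
elim: n s ds => [|n IH] s ds /=; rewrite all_map.
  apply: (@all_lin_ext _ _ _ (fun t => dg t == dg s)).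
    by rewrite !all_cat -(dg_rep aP nu) (chmap_dg phiP) (chmap_dg psiP).
  move=> t /eqP dt; apply: sub_all (ch_dg h t) => u /=.
  by rewrite (act_dg bP) dt ds.
apply: (@all_lin_ext _ _ _ (fun t => dg t == dg s)); last first.
  move=> t /eqP dt; apply: sub_all (ch_dg h t) => u /=.
  by rewrite (act_dg bP) dt ds.
rewrite !all_cat -(dg_rep aP nu) (chmap_dg phiP) (chmap_dg psiP) /=.
apply: all_lin_ext (bd_dg _) _ => t.
by rewrite (dg_rep aP) ds eqSS => /eqP dt; apply: IH.
Qed.

Lemma homotopy_act f x s : pull homotopy f (a x s) = pull homotopy (fun t => f (b x t)) s.
Proof.
rewrite !pull_homotopy nuP (rep_act aP nuP).
by congr (_ + _ + _); apply: eq_ev => t; apply: eq_ev => u;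
  rewrite ?(act_M bP) //; apply: eq_ev => v; rewrite (act_M bP).
Qed.

Lemma homotopy_bd f s :
  pull homotopy (cobd f) s + cobd (pull homotopy f) s = pull phi f s + pull psi f s.
Proof.
move: {2}(dg s).+1 (ltnSn (dg s)) => n; elim: n s f => // n IH s f ds.
set f' := fun v => f (b (nu s) v).
pose k u := ev f' (h u).
have -> : cobd (pull homotopy f) s = cobd (pull homotopy f') (nrep s).
  rewrite -{1}(act_rep aP nu s) /cobd (act_bd aP).
  by apply: eq_ev => t; rewrite homotopy_act.
have -> : pull phi f s = pull phi f' (nrep s).
  by rewrite -{1}(act_rep aP nu s) (chmap_act phiP).
have -> : pull psi f s = pull psi f' (nrep s).
  by rewrite -{1}(act_rep aP nu s) (chmap_act psiP).
rewrite pull_homotopy.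
have E u : ev (fun v => cobd f (b (nu s) v)) (h u)
    = f' u + aug u * f' (cpt h) + cobd k u.
  rewrite -(chP h f' u) /cobd -addrA addF2 addr0.
  apply: eq_ev => v; exact: (act_bd bP).
have E' (c : seq Q) : ev (fun u => ev (fun v => cobd f (b (nu s) v)) (h u)) c
    = ev f' c + ev aug c * f' (cpt h) + ev (cobd k) c.
  by rewrite (eq_ev _ E) !evD evMr.
rewrite /pull !E' -!/(pull _ _ _) (chmap_bd phiP) (chmap_bd psiP).
rewrite (chmap_aug phiP) (chmap_aug psiP).
have -> : ev (fun t => ev (fun u => ev (fun v => cobd f (b (nu s) v)) (h u)) (homotopy t))
            (bd (nrep s))
    = cobd (pull homotopy f') (nrep s) + cobd (pull phi k) (nrep s)
      + cobd (pull psi k) (nrep s).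
  transitivity (ev (fun t => pull homotopy f' t + (pull phi k t + pull psi k t
                + cobd (pull homotopy k) t)) (bd (nrep s))).
    apply: eq_ev_all (bd_dg _) _ => t /eqP dt.
    rewrite E' -!/(pull _ _ _) -IH.
      rewrite -addrA; congr (_ + _).
      have -> : pull homotopy aug t = 0.
        by apply: ev0_all (homotopy_dg t) _ => u; rewrite /aug => /eqP->.
      by rewrite mul0r add0r -addrA addF2 addr0.
    by move: dt ds; rewrite (dg_rep aP) => <-.
  rewrite !evD [X in _ + (_ + X)]cobd_cobd addr0 addrA //.
rewrite -/(pull homotopy f'); F2solve.
Qed.

(** Equivariant augmentation preserving maps from a free complex to an
    acyclic one are unique up to homotopy. *)
Lemma chmap_homotopy f : cocyc f -> invar b f ->
  null a (fun s => pull phi f s + pull psi f s).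
Proof.
move=> zf If; exists (pull homotopy f).
  by move=> x s; rewrite homotopy_act; apply: eq_ev => t.
move=> s; rewrite -homotopy_bd [X in X + _](_ : _ = 0) ?add0r //.
by rewrite -[RHS](ev0 (homotopy s)); apply: eq_ev.
Qed.

Lemma null_homotopy f : cocyc f -> invar b f ->
  null a (pull phi f) -> null a (pull psi f).
Proof.
move=> zf If; apply: null_eqD.
by apply: eq_null (chmap_homotopy zf If) => s; rewrite addrC.
Qed.
End Homotopy.
End ChainMaps.

(** * The bar complex, restriction and transfer *)

Section Deletions.
Variable T : Type.
Fixpoint dels (s : seq T) : seq (seq T) :=
  if s is v :: s' then s' :: map (cons v) (dels s') else [::].

Lemma size_dels s : all (fun q => (size q).+1 == size s) (dels s).
Proof.
elim: s => //= v s IH; rewrite eqxx all_map.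
by apply: sub_all IH => q /= /eqP->.
Qed.

Lemma dels_dels f s : ev (fun q => ev f (dels q)) (dels s) = 0.
Proof.
elim: s f => [|v s IH] f /=; first exact: ev_nil.
rewrite ev_cons ev_map /=.
have -> : ev (fun q => ev f (q :: map (cons v) (dels q))) (dels s)
  = ev f (dels s) + ev (fun q => ev (fun p => f (v :: p)) (dels q)) (dels s).
  by rewrite -evD; apply: eq_ev => q; rewrite ev_cons ev_map.
by rewrite IH addr0 addF2.
Qed.
End Deletions.

Lemma dels_map T U (f : T -> U) s : dels (map f s) = map (map f) (dels s).
Proof.
elim: s => //= v s ->; congr (_ :: _).
by rewrite -!map_comp; apply: eq_map.
Qed.

Section Bar.
Variable gT : finGroupType.

Definition bar_cell : Type := (gT * seq gT)%type.
Definition bar_bd (c : bar_cell) : seq bar_cell :=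
  (if c.2 is w :: s then [:: (w, s)] else [::]) ++
  map (fun q => (c.1, q)) (dels c.2).

(** Faces of a simplex are computed on the list of all its vertices; a
    cochain is extended by zero to the empty list, which is not a simplex. *)
Definition on_list (f : bar_cell -> 'F_2) (s : seq gT) : 'F_2 :=
  if s is v :: s' then f (v, s') else 0.

Lemma bar_bdE f v s : ev f (bar_bd (v, s)) = ev (on_list f) (dels (v :: s)).
Proof.
rewrite /bar_bd ev_cat ev_map /= ev_cons ev_map; congr (_ + _).
by case: s => [|w s]; rewrite ?ev_nil ?ev_seq1.
Qed.

Lemma bar_bd_dg (c : bar_cell) :
  all (fun t : bar_cell => (size t.2).+1 == size c.2) (bar_bd c).
Proof.
case: c => v s; rewrite all_cat all_map /=; apply/andP; split.
  by case: s => //= w s; rewrite eqxx.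
exact: size_dels.
Qed.

Lemma bar_bd_bd f c : ev (fun t => ev f (bar_bd t)) (bar_bd c) = 0.
Proof.
case: c => v s; rewrite bar_bdE -[RHS](dels_dels (on_list f) (v :: s)).
by apply: eq_ev => -[|w q] /=; rewrite ?ev_nil ?bar_bdE.
Qed.

Lemma bar_bd_aug c : ev (fun t : bar_cell => (size t.2 == 0%N)%:R) (bar_bd c) = 0.
Proof.
case: c => v [|w [|u s]]; rewrite /bar_bd /= ?ev_cons ?ev_nil ?ev_map //=.
- by rewrite addr0 addF2.
- by rewrite !ev0 ?addr0.
Qed.

(** The homogeneous bar complex: the cell (v, s) is the simplex with
    vertices v :: s. *)
Definition bar : cplx := Cplx bar_bd_dg bar_bd_bd bar_bd_aug.

Definition bar_act (x : gT) (c : bar) : bar := ((x * c.1)%g, map (mulg x) c.2).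

Lemma bar_actP : action_on bar_act.
Proof.
split=> [[v s]|x y [v s]|x [v s]|f x [v s]] /=.
- by rewrite /bar_act /= mul1g; congr pair; rewrite -[RHS]map_id;
    apply: eq_map => g; rewrite mul1g.
- by rewrite /bar_act /= mulgA -map_comp; congr pair;
    apply: eq_map => g; rewrite /= mulgA.
- exact: size_map.
rewrite /bar_act /= !bar_bdE -[_ :: _]/(map (mulg x) (v :: s)) dels_map ev_map.
by apply: eq_ev => -[].
Qed.

Lemma bar_free : free_by bar_act fst.
Proof. by move=> x [v s]. Qed.

Definition bar_cone (c : bar) : seq bar := [:: (1%g, c.1 :: c.2)].

Lemma bar_cone_dg c : all (fun t => dg t == (dg c).+1) (bar_cone c).
Proof. by rewrite /= eqxx. Qed.

Lemma bar_coneP f c :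
  ev (cobd f) (bar_cone c) + ev (fun t => ev f (bar_cone t)) (bd c)
  = f c + aug c * f (1%g, [::]).
Proof.
case: c => v s; rewrite /bar_cone ev_seq1 /cobd [bd _]/= bar_bdE.
rewrite [dels _]/= !ev_cons !ev_map /=.
rewrite bar_bdE /= ev_cons ev_map /=.
rewrite [X in _ + (_ + X)](@eq_ev _ _ (fun q => f (1%g, v :: q))); last first.
  by move=> q; rewrite ev_seq1.
by case: s => [|w s]; rewrite /aug /= ?ev_seq1 ?mul1r ?mul0r; F2solve.
Qed.

Definition bar_contr : contraction bar :=
  @Contraction bar bar_cone (1%g, [::]) (erefl _) bar_cone_dg bar_coneP.
End Bar.
Arguments bar_act {gT} x c.

Section BarMap.
Variables hT gT : finGroupType.
Implicit Type al : hT -> gT.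

Definition bar_map al (c : bar hT) : bar gT := (al c.1, map al c.2).

Lemma bar_map_bd al f c : ev f (bd (bar_map al c)) = ev (fun t => f (bar_map al t)) (bd c).
Proof.
case: c => v s; rewrite /bar_map /= !bar_bdE -[_ :: _]/(map al (v :: s)) dels_map.
by rewrite ev_map; apply: eq_ev => -[].
Qed.

Lemma bar_map_act al x c : {morph al : x y / (x * y)%g} ->
  bar_map al (bar_act x c) = bar_act (al x) (bar_map al c).
Proof.
move=> alM; rewrite /bar_map /bar_act /= alM -!map_comp; congr pair.
by apply: eq_map => y; rewrite /= alM.
Qed.

Definition via al (C : cplx) (a : gT -> C -> C) (x : hT) := a (al x).

Lemma morph1 al : {morph al : x y / (x * y)%g} -> al 1%g = 1%g.
Proof. by move=> alM; apply: (mulgI (al 1%g)); rewrite -alM !mulg1. Qed.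
Lemma morphV al x : {morph al : x y / (x * y)%g} -> al x^-1%g = (al x)^-1%g.
Proof. by move=> alM; apply: (mulgI (al x)); rewrite -alM !mulgV morph1. Qed.

Lemma viaP al (C : cplx) (a : gT -> C -> C) :
  {morph al : x y / (x * y)%g} -> action_on a -> action_on (via al a).
Proof.
move=> alM aP; split; rewrite /via.
- by move=> s; rewrite morph1 // (act_1 aP).
- by move=> x y s; rewrite alM (act_M aP).
- by move=> x s; rewrite (act_dg aP).
- by move=> f x s; rewrite (act_bd aP).
Qed.

Lemma via_invar al (C : cplx) (a : gT -> C -> C) f : invar a f -> invar (via al a) f.
Proof. by move=> If x s; apply: If. Qed.

Lemma via_null al (C : cplx) (a : gT -> C -> C) f : null a f -> null (via al a) f.
Proof. by case=> g Ig fg; exists g => //; apply: via_invar. Qed.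

Lemma via_chmap al (P Q : cplx) (a : gT -> P -> P) (b : gT -> Q -> Q) phi :
  chmap a b phi -> chmap (via al a) (via al b) phi.
Proof. by case=> H1 H2 H3 H4; split=> // f x s; apply: H3. Qed.

Lemma bar_map_chmap al : {morph al : x y / (x * y)%g} ->
  chmap bar_act (via al bar_act) (fun c => [:: bar_map al c]).
Proof.
move=> alM; split=> [c|f c|f x c|c].
- by rewrite /= size_map eqxx.
- by rewrite /pull ev_seq1 /cobd bar_map_bd; apply: eq_ev => t; rewrite ev_seq1.
- by rewrite /pull !ev_seq1 bar_map_act.
- by rewrite /pull ev_seq1 /aug /= size_map.
Qed.
End BarMap.

Lemma id_chmap (P : cplx) (gT : finGroupType) (a : gT -> P -> P) : chmap a a (fun s => [:: s]).
Proof.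
split=> [s|f s|f x s|s]; rewrite /pull /= ?eqxx ?ev_seq1 //.
by apply: eq_ev => t; rewrite ev_seq1.
Qed.

Lemma comp_chmap (P Q R : cplx) (gT : finGroupType) (a : gT -> P -> P) (b : gT -> Q -> Q)
    (c : gT -> R -> R) phi psi : chmap a b phi -> chmap b c psi ->
  chmap a c (fun s => lin_ext psi (phi s)).
Proof.
move=> phiP psiP.
have E f s : pull (fun s => lin_ext psi (phi s)) f s = pull phi (pull psi f) s.
  exact: ev_lin_ext.
split=> [s|f s|f x s|s].
- apply: all_lin_ext (chmap_dg phiP s) _ => t /eqP<-; exact: (chmap_dg psiP).
- rewrite E -[RHS](@eq_cobd _ (pull phi (pull psi f))) // -(chmap_bd phiP).
  by apply: eq_ev => t; apply: (chmap_bd psiP).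
- rewrite !E (chmap_act phiP); apply: eq_ev => t; exact: (chmap_act psiP).
- rewrite E -(chmap_aug phiP); apply: eq_ev => t; exact: (chmap_aug psiP).
Qed.

(** The comparison map backwards gives a homotopy inverse of phi. *)
Lemma pull_null_inj (P Q : cplx) (gT : finGroupType) (a : gT -> P -> P) (b : gT -> Q -> Q)
    phi nu (h : contraction P) (k : contraction Q) f :
  action_on a -> action_on b -> free_by b nu -> chmap a b phi ->
  cocyc f -> invar b f -> null a (pull phi f) -> null b f.
Proof.
move=> aP bP nuP phiP zf If nf.
have liftP := lift_chmap bP aP h nuP.
have nf' := pull_null liftP nf.
have := null_homotopy bP bP k nuP (comp_chmap liftP phiP) (id_chmap b) zf If.
move=> H; apply: eq_null (H _) => [s|]; first by rewrite /pull ev_seq1.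
by apply: eq_null nf' => s; rewrite /pull ev_lin_ext.
Qed.

Section Cocycles.
Variable gT : finGroupType.
Definition class (x : bar gT -> 'F_2) := cocyc x /\ invar bar_act x.

Section Restrict.
Variables (hT : finGroupType) (al : hT -> gT).
Hypothesis alM : {morph al : x y / (x * y)%g}.

Definition resb (x : bar gT -> 'F_2) (c : bar hT) := x (bar_map al c).
Definition null_on x := null bar_act (resb x).

Lemma resb_pull x : resb x =1 pull (fun c => [:: bar_map al c]) x.
Proof. by move=> c; rewrite /pull ev_seq1. Qed.
End Restrict.
End Cocycles.

Lemma resb_class (hT gT : finGroupType) (al : hT -> gT) x : {morph al : x y / (x * y)%g} ->
  class x -> class (resb al x).
Proof.
move=> alM [zx Ix]; have phiP := bar_map_chmap alM; split.
  apply: eq_cocyc (pull_cocyc phiP zx) => c; by rewrite resb_pull.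
by move=> y c; rewrite /resb bar_map_act // Ix.
Qed.

Lemma resb_comp (kT hT gT : finGroupType) (be : kT -> hT) (al : hT -> gT) x :
  resb be (resb al x) =1 resb (al \o be) x.
Proof. by move=> c; rewrite /resb /bar_map /= -map_comp. Qed.

Lemma eq_resb (hT gT : finGroupType) (al be : hT -> gT) x : al =1 be ->
  resb al x =1 resb be x.
Proof. by move=> e c; rewrite /resb /bar_map e (eq_map e). Qed.

Lemma null_resb (hT gT : finGroupType) (al : hT -> gT) x :
  {morph al : x y / (x * y)%g} -> null bar_act x -> null_on al x.
Proof.
move=> alM nx; apply: (@eq_null _ _ _ (pull (fun c => [:: bar_map al c]) x)).
  by move=> c; rewrite resb_pull.
apply: pull_null (bar_map_chmap alM) _; exact: via_null.
Qed.

Lemma null_on_comp (kT hT gT : finGroupType) (be : kT -> hT) (al : hT -> gT) x :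
  {morph be : x y / (x * y)%g} -> null_on al x -> null_on (al \o be) x.
Proof.
by move=> beM /(null_resb beM); apply: eq_null; apply: resb_comp.
Qed.

(** The chain map phi is homotopic to one that factors through the bar
    complex of hT. *)
Lemma null_pull (hT gT : finGroupType) (al : hT -> gT) (P : cplx) (a : hT -> P -> P) nu phi x :
  {morph al : x y / (x * y)%g} -> action_on a -> free_by a nu ->
  chmap a (via al bar_act) phi -> class x -> null_on al x -> null a (pull phi x).
Proof.
move=> alM aP nuP phiP [zx Ix] nx.
have liftP := lift_chmap aP (bar_actP hT) (bar_contr hT) nuP.
have vP := viaP alM (bar_actP gT).
have cP := comp_chmap liftP (bar_map_chmap alM).
apply: (null_homotopy aP vP (bar_contr gT) nuP cP phiP zx).
  exact: via_invar.
apply: eq_null (pull_null liftP nx) => s; rewrite /pull ev_lin_ext.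
by apply: eq_ev => t; rewrite ev_seq1.
Qed.

(** Right translations of the bar complex are equivariant for left
    translations, hence homotopic to the identity. *)
Lemma null_on_conj (hT gT : finGroupType) (al be : hT -> gT) (w : gT) x :
  {morph al : x y / (x * y)%g} -> {morph be : x y / (x * y)%g} ->
  (forall h, al h * w = w * be h)%g -> class x -> null_on al x -> null_on be x.
Proof.
move=> alM beM abw [zx Ix] nx.
have rP : chmap bar_act (via al bar_act)
    (fun c => [:: bar_map (fun h => (al h * w)%g) c]).
  split=> [c|f c|f y c|c].
  - by rewrite /= size_map eqxx.
  - by rewrite /pull ev_seq1 /cobd bar_map_bd; apply: eq_ev => t; rewrite ev_seq1.
  - rewrite /pull !ev_seq1; congr f; rewrite /via /bar_map /bar_act /= alM mulgA.
    rewrite -!map_comp; congr pair; apply: eq_map => z /=.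
    by rewrite alM mulgA.
  - by rewrite /pull ev_seq1 /aug /= size_map.
have := null_pull alM (bar_actP hT) (@bar_free hT) rP (conj zx Ix) nx.
apply: eq_null => c; rewrite /pull ev_seq1 /resb -[in RHS](Ix w).
congr x; rewrite /bar_map /bar_act /= abw -map_comp; congr pair.
by apply: eq_map => z /=; rewrite abw.
Qed.

Section Subgroup.
Variables (hT gT : finGroupType) (al : hT -> gT).
Hypotheses (alM : {morph al : x y / (x * y)%g}) (alI : injective al).

(** Cosets have representatives, so left translation by a subgroup is
    free. *)
Lemma retraction : exists nu : gT -> hT, forall h g, nu (al h * g)%g = (h * nu g)%g.
Proof.
pose A := [set al h | h : hT].
have gA : group_set A.
  apply/group_setP; split=> [|_ _ /imsetP[x _ ->] /imsetP[y _ ->]].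
    by rewrite -(morph1 alM) imset_f.
  by rewrite -alM imset_f.
pose r g := repr (Group gA :* g)%g.
have rP g : (g * (r g)^-1)%g \in A.
  rewrite /r; case: repr_rcosetP => x Ax; rewrite invMg mulgA mulgV mul1g.
  by rewrite (groupV (Group gA)).
have rM h g : r (al h * g)%g = r g.
  by rewrite /r rcosetM (rcoset_id (G := Group gA)) // imset_f.
exists (fun g => iinv (introT imageP (elimT imsetP (rP g)))) => h g.
apply: alI; rewrite alM !f_iinv rM.
by rewrite mulgA.
Qed.

Lemma bar_sub_free nu : (forall h g, nu (al h * g)%g = (h * nu g)%g) ->
  free_by (via al (@bar_act gT)) (fun c => nu c.1).
Proof. by move=> nuP h [v s]; rewrite /= nuP. Qed.

(** If x is the coboundary of g on the subgroup, the sum of the translates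
    of g over the cosets is invariant under the whole group, and its coboundary
    is an odd multiple of x. *)
Lemma transfer x : logn 2 #|gT| = logn 2 #|hT| -> class x -> null_on al x -> null bar_act x.
Proof.
move=> odd_index [zx Ix] nx; have [nu nuP] := retraction.
have vP := viaP alM (bar_actP gT).
have [g Ig xg] : null (via al bar_act) x.
  apply: (pull_null_inj (bar_contr hT) (bar_contr gT) (bar_actP hT) vP
           (bar_sub_free nuP) (bar_map_chmap alM) zx).
    exact: via_invar.
  by apply: eq_null nx; apply: resb_pull.
pose rp u := ((al (nu u))^-1 * u)%g.
pose R := [set u | nu u == 1%g].
have nu_rp u : nu (rp u) = 1%g by rewrite /rp -(morphV _ alM) nuP mulVg.
have rp_id u : u \in R -> rp u = u.
  by rewrite inE /rp => /eqP->; rewrite (morph1 alM) invg1 mul1g.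
have rpM h u : rp (al h * u)%g = rp u.
  by rewrite {1}/rp nuP alM invMg -mulgA mulKg.
have gR u s : g (bar_act (rp u) s) = g (bar_act u s).
  rewrite /rp (act_M (bar_actP gT)) -(morphV _ alM).
  exact: Ig.
have cardR : #|gT| = (#|hT| * #|R|)%N.
  pose F (p : hT * gT) := (al p.1 * p.2)%g.
  have nuF p : p \in setX [set: hT] R -> nu (F p) = p.1.
    by case: p => h u; rewrite !inE /= nuP => /eqP->; rewrite mulg1.
  have injF : {in setX [set: hT] R &, injective F}.
    move=> p q pD qD eF; have e1 : p.1 = q.1 by rewrite -(nuF _ pD) eF nuF.
    case: p q e1 eF {pD qD} => h u [h' u'] /= -> eF; congr pair.
    exact: mulgI eF.
  rewrite -[#|hT|]cardsT -cardsX -(card_in_imset injF) -cardsT.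
  congr #|pred_of_set _|; apply/setP => u; rewrite inE; apply/esym/imsetP.
  exists (nu u, rp u); first by rewrite in_setX in_setT inE nu_rp /=.
  by rewrite /F /rp /= mulKVg.
have oddR : odd #|R|.
  have : (0 < #|gT|)%N by apply/card_gt0P; exists 1%g.
  rewrite cardR muln_gt0 => /andP[h_gt0 R_gt0].
  move: odd_index; rewrite cardR lognM // => /eqP.
  rewrite -[X in _ == X]addn0 eqn_add2l => /eqP v0.
  by move: v0; rewrite lognE R_gt0 dvdn2 /=; case: (odd _).
pose G s := \sum_(u in R) g (bar_act u s).
have IG : invar bar_act G.
  move=> k s; rewrite /G.
  rewrite [RHS](reindex_onto (fun u => rp (u * k)%g) (fun u => rp (u * k^-1)%g)).
    rewrite [LHS](eq_bigl (fun u => (rp (u * k) \in R)%g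
        && (rp (rp (u * k) * k^-1)%g == u))).
      by apply: eq_bigr => u _; rewrite gR (act_M (bar_actP gT)).
    have rpR u : rp u \in R by rewrite inE nu_rp.
    move=> u; rewrite rpR /=.
    have -> : rp (rp (u * k) * k^-1)%g = rp u.
      by rewrite {2}/rp -(morphV _ alM) -mulgA rpM mulgK.
    apply/idP/eqP => [uR|<-]; last exact: rpR.
    exact: rp_id.
  move=> u uR; rewrite -[RHS](rp_id _ uR) {2}/rp -(morphV _ alM) -mulgA rpM.
  by rewrite mulgKV.
exists G => // s; rewrite /cobd /ev /G exchange_big /=.
rewrite (eq_bigr (fun=> x s)).
  rewrite sumr_const -(odd_double_half #|R|) oddR add1n mulrS.
  by rewrite -mul2n mulrnA mulr2n addF2 mul0rn addr0.
move=> u _; rewrite -[RHS](Ix u) xg /cobd (act_bd (bar_actP gT)).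
by [].
Qed.
End Subgroup.

(** * Tensor products *)

Section Tensor.
Variables C D : cplx.

Definition tens_cell : Type := (C * D)%type.
Definition tens_dg (p : tens_cell) := (dg p.1 + dg p.2)%N.
Definition tens_bd (p : tens_cell) : seq tens_cell :=
  map (fun s => (s, p.2)) (bd p.1) ++ map (fun t => (p.1, t)) (bd p.2).

Lemma tens_bdE f s t : ev f (tens_bd (s, t)) =
  ev (fun s' => f (s', t)) (bd s) + ev (fun t' => f (s, t')) (bd t).
Proof. by rewrite ev_cat !ev_map. Qed.

Lemma tens_bd_dg p : all (fun q => (tens_dg q).+1 == tens_dg p) (tens_bd p).
Proof.
case: p => s t; rewrite all_cat !all_map; apply/andP; split.
  by apply: sub_all (bd_dg s) => u /=; rewrite /tens_dg /= => /eqP<-; rewrite addSn.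
by apply: sub_all (bd_dg t) => u /=; rewrite /tens_dg /= => /eqP<-; rewrite addnS.
Qed.

Lemma tens_bd_bd f p : ev (fun q => ev f (tens_bd q)) (tens_bd p) = 0.
Proof.
case: p => s t; rewrite tens_bdE.
rewrite (eq_ev _ (fun s' => tens_bdE f s' t)) (eq_ev _ (tens_bdE f s)) !evD.
rewrite (bd_bd (fun s' => f (s', t))) (bd_bd (fun t' => f (s, t'))) add0r addr0.
by rewrite ev_exch addF2.
Qed.

Lemma tens_augE s t : ((tens_dg (s, t) == 0)%N)%:R = aug s * aug t :> 'F_2.
Proof. by rewrite /tens_dg /aug addn_eq0 /=; do 2!case: eqP; rewrite ?mulr1 ?mulr0. Qed.

Lemma tens_bd_aug p : ev (fun q => (tens_dg q == 0%N)%:R) (tens_bd p) = 0.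
Proof.
case: p => s t; rewrite tens_bdE.
rewrite (eq_ev _ (fun s' => tens_augE s' t)) (eq_ev _ (tens_augE s)).
rewrite evMr evMl; have -> : ev aug (bd s) = 0 := bd_aug s.
by have -> : ev aug (bd t) = 0 := bd_aug t; rewrite mul0r mulr0 addr0.
Qed.

Definition tens : cplx := Cplx tens_bd_dg tens_bd_bd tens_bd_aug.

Lemma cobd_tens (f : tens -> 'F_2) s t :
  cobd f (s, t) = cobd (fun s' => f (s', t)) s + cobd (fun t' => f (s, t')) t.
Proof. exact: tens_bdE. Qed.

Lemma aug_tens (p : tens) : aug p = aug p.1 * aug p.2.
Proof. by case: p => s t; exact: tens_augE. Qed.

Section Contr.
Variables (h : contraction C) (k : contraction D).
Definition tens_cone (p : tens) : seq tens :=
  map (fun s => (s, p.2)) (h p.1) ++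
  (if dg p.1 == 0%N then map (fun t => (cpt h, t)) (k p.2) else [::]).

Lemma tens_coneE f s t : ev f (tens_cone (s, t)) =
  ev (fun s' => f (s', t)) (h s) + aug s * ev (fun t' => f (cpt h, t')) (k t).
Proof.
rewrite /tens_cone ev_cat ev_map /aug /=; case: eqP => _.
  by rewrite ev_map mul1r.
by rewrite ev_nil mul0r.
Qed.

Lemma tens_cone_dg p : all (fun t => dg t == (dg p).+1) (tens_cone p).
Proof.
case: p => s t; rewrite all_cat all_map; apply/andP; split.
  by apply: sub_all (ch_dg h s) => u /=; rewrite /tens_dg /= => /eqP->.
case: eqP => //= s0; rewrite all_map.
apply: sub_all (ch_dg k t) => u /=; rewrite /tens_dg /= => /eqP->.
by rewrite s0 cpt_dg.
Qed.

Lemma tens_coneP f p :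
  ev (cobd f) (tens_cone p) + ev (fun t => ev f (tens_cone t)) (bd p)
  = f p + aug p * f (cpt h, cpt k).
Proof.
case: p => s t; rewrite tens_coneE [ev _ (bd _)]tens_bdE.
rewrite (eq_ev _ (fun s' => cobd_tens f s' t)).
rewrite (eq_ev _ (fun t' => cobd_tens f (cpt h) t')).
rewrite (eq_ev _ (fun s' => tens_coneE f s' t)) (eq_ev _ (tens_coneE f s)).
rewrite !evD evMl evMr.
have -> : ev (fun t' => cobd (fun s' => f (s', t')) (cpt h)) (k t) = 0.
  by rewrite (eq_ev (g := fun=> 0)) ?ev0 // => t'; rewrite /cobd bd0 ?ev_nil ?cpt_dg.
have -> : ev aug (bd s) = 0 := bd_aug s.
rewrite mul0r add0r addr0 [ev (fun t' => ev _ (h s)) _]ev_exch.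
have H1 := chP h (fun s' => f (s', t)) s.
have H2 := chP k (fun t' => f (cpt h, t')) t.
rewrite /cobd in H1 H2 *.
have -> : f (s, t) = ev (fun s0 => ev (fun s' => f (s', t)) (bd s0)) (h s) +
     ev (fun t0 => ev (fun s' => f (s', t)) (h t0)) (bd s) + aug s * f (cpt h, t).
  by rewrite H1; F2solve.
rewrite aug_tens /= -mulrA.
have -> : aug t * f (cpt h, cpt k) = ev (fun s0 => ev (fun t' => f (cpt h, t')) (bd s0)) (k t) +
     ev (fun t0 => ev (fun t' => f (cpt h, t')) (k t0)) (bd t) + f (cpt h, t).
  by rewrite H2; F2solve.
rewrite !mulrDr; F2solve.
Qed.

Lemma tens_contr_dg : dg ((cpt h, cpt k) : tens) = 0%N.
Proof. by rewrite /= /tens_dg /= !cpt_dg. Qed.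

Definition tens_contr := Contraction tens_contr_dg tens_cone_dg tens_coneP.
End Contr.
End Tensor.

Section TensorAction.
Variables (gT hT : finGroupType) (C D : cplx) (a : gT -> C -> C) (b : hT -> D -> D).
Definition tact (x : gT * hT) (p : tens C D) : tens C D := (a x.1 p.1, b x.2 p.2).
Hypotheses (aP : action_on a) (bP : action_on b).

Lemma tactP : action_on tact.
Proof.
split=> [[s t]|x y [s t]|x [s t]|f x [s t]]; rewrite /tact /=.
- by rewrite (act_1 aP) (act_1 bP).
- by rewrite (act_M aP) (act_M bP).
- by rewrite /tens_dg /= (act_dg aP) (act_dg bP).
- by rewrite !tens_bdE (act_bd aP) (act_bd bP).
Qed.

Lemma tact_free nu mu : free_by a nu -> free_by b mu ->
  free_by tact (fun p => (nu p.1, mu p.2)).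
Proof. by move=> nuP muP x [s t]; rewrite /= nuP muP. Qed.
End TensorAction.

Section TensorMap.
Variables (gT hT : finGroupType) (C D C' D' : cplx).
Variables (a : gT -> C -> C) (b : hT -> D -> D) (a' : gT -> C' -> C') (b' : hT -> D' -> D').
Variables (phi : C -> seq C') (psi : D -> seq D').
Definition tmap (p : tens C D) : seq (tens C' D') :=
  lin_ext (fun s => map (fun t => (s, t) : tens C' D') (psi p.2)) (phi p.1).

Lemma pull_tmap F s t : pull tmap F (s, t) =
  pull phi (fun s' => pull psi (fun t' => F (s', t')) t) s.
Proof. by rewrite /pull ev_lin_ext; apply: eq_ev => s'; rewrite ev_map. Qed.

Lemma tmap_chmap : chmap a a' phi -> chmap b b' psi ->
  chmap (tact a b) (tact a' b') tmap.
Proof.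
move=> phiP psiP; split=> [[s t]|F [s t]|F x [s t]|[s t]].
- apply: all_lin_ext (chmap_dg phiP s) _ => s' /eqP ds.
  rewrite all_map; apply: sub_all (chmap_dg psiP t) => t' /= /eqP dt.
  by rewrite /tens_dg /= ds dt.
- rewrite pull_tmap cobd_tens.
  transitivity (pull phi (fun s' => pull psi (fun t' => cobd (fun s' => F (s', t')) s') t
      + pull psi (cobd (fun t' => F (s', t'))) t) s).
    rewrite /pull; apply: eq_ev => s'; rewrite -evD; apply: eq_ev => t'.
    exact: cobd_tens.
  rewrite {1}/pull evD; congr (_ + _).
    rewrite (@eq_cobd _ _ _ s (fun s' => pull_tmap F s' t)) -(chmap_bd phiP).
    by rewrite /pull; apply: eq_ev => s'; rewrite /cobd ev_exch.
  rewrite (@eq_cobd _ _ _ t (pull_tmap F s)) /cobd /pull [RHS]ev_exch.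
  by apply: eq_ev => s'; exact: (chmap_bd psiP).
- rewrite !pull_tmap (chmap_act phiP) /pull; apply: eq_ev => s'.
  exact: (chmap_act psiP).
- rewrite pull_tmap aug_tens -(chmap_aug phiP) -(chmap_aug psiP) /pull -evMr.
  apply: eq_ev => s'; rewrite -evMl; apply: eq_ev => t'; exact: aug_tens.
Qed.
End TensorMap.

(** * The Kuenneth theorem *)

Section GeneralizedInverse.
Variables (I J : finType) (d : I -> seq J).

Definition bd_mx : 'M['F_2]_(#|I|, #|J|) :=
  \matrix_(i, j) ev (fun t => (t == enum_val j)%:R) (d (enum_val i)).
(** The boundary d, as a matrix, has a generalized inverse; [ginvP] is the
    identity d k d = d for the corresponding list valued k. *)
Definition ginv (j : J) : seq I :=
  [seq i <- enum I | pinvmx bd_mx (enum_rank j) (enum_rank i) != 0].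

Let colv (T : finType) (f : T -> 'F_2) : 'cV['F_2]_(#|T|) := \col_i f (enum_val i).

Lemma colvE (T : finType) (f : T -> 'F_2) i k : colv f i k = f (enum_val i).
Proof. by rewrite mxE. Qed.

Lemma bd_mxE f i : ev f (d i) = (bd_mx *m colv f) (enum_rank i) 0.
Proof.
rewrite mxE.
rewrite (eq_bigr (fun j => ev (fun t => (t == enum_val j)%:R * f (enum_val j)) (d i))).
  rewrite -[RHS]/(ev (fun j => ev _ _) (index_enum _)) ev_exch.
  apply: eq_ev => t; rewrite /ev (bigD1 (enum_rank t)) //= enum_rankK eqxx mul1r.
  rewrite big1 ?addr0 // => j jt; rewrite -(inj_eq enum_rank_inj) enum_valK.
  by rewrite eq_sym (negbTE jt) mul0r.
by move=> j _; rewrite colvE mxE enum_rankK evMr.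
Qed.

Lemma ginvE f j : ev f (ginv j) = (pinvmx bd_mx *m colv f) (enum_rank j) 0.
Proof.
rewrite mxE /ev /ginv big_filter big_enum_cond /=.
rewrite [RHS](reindex (@enum_rank I)) /=; last first.
  by apply: onW_bij; apply: enum_rank_bij.
rewrite big_mkcond; apply: eq_bigr => i _; rewrite colvE enum_rankK.
by move: (pinvmx _ _ _) => y; case: (F2_cases y) => ->; rewrite ?eqxx ?mul0r ?mul1r.
Qed.

Lemma ginvP f i :
  ev (fun j => ev (fun i' => ev f (d i')) (ginv j)) (d i) = ev f (d i).
Proof.
have -> : ev f (d i) = (bd_mx *m pinvmx bd_mx *m bd_mx *m colv f) (enum_rank i) 0.
  by rewrite mulmxKpV // bd_mxE.
have E : colv (fun i' => ev f (d i')) = bd_mx *m colv f.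
  by apply (proj1 (matrixP _ _)) => k l; rewrite colvE bd_mxE enum_valK [l]ord1.
have E' : colv (fun j => ev (fun i' => ev f (d i')) (ginv j)) =
    pinvmx bd_mx *m colv (fun i' => ev f (d i')).
  by apply (proj1 (matrixP _ _)) => j l; rewrite colvE ginvE enum_valK [l]ord1.
by rewrite bd_mxE E' E !mulmxA.
Qed.
End GeneralizedInverse.

Section BarHodge.
Variable gT : finGroupType.
Implicit Types (c : bar gT) (f : bar gT -> 'F_2).

(** Coordinates of the orbit of a simplex: the simplex is translated so
    that its first vertex is 1.  There are finitely many orbits in each degree,
    which makes linear algebra available. *)
Definition reduced c : seq gT := map (mulg c.1^-1%g) c.2.

Lemma reducedE f c : invar bar_act f -> f (1%g, reduced c) = f c.
Proof. by case: c => v s If; rewrite -(If v^-1%g (v, s)) /bar_act /= mulVg. Qed.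

Lemma reduced_act x c : reduced (bar_act x c) = reduced c.
Proof.
case: c => v s; rewrite /reduced /= -map_comp; apply: eq_map => y /=.
by rewrite invMg -mulgA mulKg.
Qed.

Lemma size_reduced c : size (reduced c) = dg c.
Proof. by rewrite size_map. Qed.

Definition reduced_bd n (t : n.+1.-tuple gT) : seq (n.-tuple gT) :=
  pmap insub (map reduced (bd ((1%g, tval t) : bar gT))).

Lemma reduced_bdE n f (t : n.+1.-tuple gT) : invar bar_act f ->
  ev (fun u : n.-tuple gT => f (1%g, tval u)) (reduced_bd t) = cobd f (1%g, tval t).
Proof.
move=> If; rewrite /reduced_bd /cobd; move: (bd_dg ((1%g, tval t) : bar gT)).
elim: (bd _) => [|c l IH] /=; first by rewrite !ev_nil.
move=> /andP[/eqP dc /IH {}IH].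
have sc : size (reduced c) == n by rewrite size_reduced /= -eqSS dc size_tuple.
by rewrite insubT /= !ev_cons IH -(reducedE c If).
Qed.

Definition bar_ginv c : seq (bar gT) :=
  map (fun t => (1%g, tval t)) (ginv (@reduced_bd (size (reduced c))) (in_tuple (reduced c))).

Lemma bar_ginv_act x c : bar_ginv (bar_act x c) = bar_ginv c.
Proof. by rewrite /bar_ginv reduced_act. Qed.

Lemma bar_ginv_dg c : all (fun t => dg t == (dg c).+1) (bar_ginv c).
Proof.
rewrite all_map; apply/allP => t _ /=.
by rewrite size_tuple size_reduced.
Qed.

Lemma bar_ginvE n f (u : n.-tuple gT) c : reduced c = u :> seq gT ->
  ev f (bar_ginv c) = ev (fun t => f (1%g, tval t)) (ginv (@reduced_bd n) u).
Proof.
move=> cu; rewrite /bar_ginv ev_map cu.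
case: u {cu} => u su /=; have e := eqP su; subst n.
by congr (ev _ (ginv _ _)); apply: val_inj.
Qed.

Lemma bar_ginvP f c : invar bar_act f ->
  ev (fun t => ev (cobd f) (bar_ginv t)) (bd c) = cobd f c.
Proof.
move=> If; case: c => v s.
have IIf := invar_cobd (bar_actP gT) If.
case ds: (size s) => [|n]; first by rewrite /cobd bd0 ?ev_nil.
have sn : size (reduced (v, s)) == n.+1 by rewrite size_reduced /= ds.
rewrite -[RHS](reducedE _ IIf) -[reduced _]/(tval (Tuple sn)) -(reduced_bdE _ If).
rewrite -ginvP.
transitivity (ev (fun t => ev (cobd f) (bar_ginv t)) (bd ((1%g, reduced (v, s)) : bar gT))).
  rewrite -[in RHS](mulVg v) -[(_, reduced _)]/(bar_act v^-1%g (v, s)).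
  by rewrite (act_bd (bar_actP gT)); apply: eq_ev => t; rewrite bar_ginv_act.
rewrite /reduced_bd; move: (bd_dg ((1%g, reduced (v, s)) : bar gT)) => /=.
elim: (bar_bd _) => [|c l IH] /=; first by rewrite !ev_nil.
move=> /andP[/eqP dc /IH {}IH].
have sc : size (reduced c) == n by rewrite size_reduced /= -eqSS dc.
rewrite insubT /= !ev_cons IH; congr (_ + _).
rewrite (@bar_ginvE _ _ (Tuple sc)) //.
by apply: eq_ev => t; rewrite reduced_bdE.
Qed.

(** With k a generalized inverse of the boundary d, the operator
    1 + dk + kd is homotopic to the identity, it takes values in cycles and it
    kills boundaries.  So it is a projection onto homology up to homotopy, and
    it replaces the choice of a basis of cycles. *)
Definition hodge c : seq (bar gT) := c :: lin_ext bar_ginv (bd c) ++ lin_ext bd (bar_ginv c).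

Lemma hodgeE f c : ev f (hodge c) =
  f c + cobd (fun t => ev f (bar_ginv t)) c + ev (cobd f) (bar_ginv c).
Proof. by rewrite ev_cons ev_cat !ev_lin_ext addrA. Qed.

Lemma hodge_dg c : all (fun t => dg t == dg c) (hodge c).
Proof.
rewrite /hodge -cat1s !all_cat all_seq1 eqxx andTb; apply/andP; split.
  by apply: all_lin_ext (bd_dg c) _ => t /eqP <-; apply: bar_ginv_dg.
apply: all_lin_ext (bar_ginv_dg c) _ => t /eqP dt.
by apply: sub_all (bd_dg t) => u; rewrite dt eqSS.
Qed.

Lemma hodge_invar f : invar bar_act f -> invar bar_act (fun c => ev f (hodge c)).
Proof.
move=> If x c; rewrite !hodgeE If bar_ginv_act; congr (_ + _ + _).
by apply: (invar_cobd (bar_actP gT)) => y t; rewrite bar_ginv_act.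
Qed.

Lemma hodge_cycle f c : invar bar_act f -> ev (cobd f) (hodge c) = 0.
Proof.
move=> If; rewrite hodgeE /cobd bar_ginvP // -/(cobd f c) addF2 add0r.
by rewrite -[RHS](ev0 (bar_ginv c)); apply: eq_ev => t; apply: cobd_cobd.
Qed.

Lemma hodge_bd f : invar bar_act f -> cocyc (fun c => ev f (hodge c)).
Proof.
move=> If c; rewrite (eq_cobd c (hodgeE f)) !cobdD cobd_cobd addr0.
by rewrite {2}/cobd bar_ginvP // addF2.
Qed.

Lemma hodge_homotopy f c : cocyc f ->
  ev f (hodge c) = f c + cobd (fun t => ev f (bar_ginv t)) c.
Proof.
move=> zf; rewrite hodgeE [X in _ + X](_ : _ = 0) ?addr0 //.
by rewrite -[RHS](ev0 (bar_ginv c)); apply: eq_ev.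
Qed.

(** Cycles of degree j of the complex of coinvariants. *)
Definition cyc j (v : seq (bar gT)) :=
  all (fun t => dg t == j) v /\ forall f, invar bar_act f -> ev (cobd f) v = 0.

Lemma hodge_cyc c : cyc (dg c) (hodge c).
Proof. by split; [apply: hodge_dg | move=> f If; apply: hodge_cycle]. Qed.

(** The cocycle f is homologous to its composite with [hodge], which
    evaluates f on cycles. *)
Lemma null_dual f : class f -> (forall j v, cyc j v -> ev f v = 0) -> null bar_act f.
Proof.
move=> [zf If] f0; exists (fun c => ev f (bar_ginv c)).
  by move=> x c; rewrite bar_ginv_act.
move=> c; apply: eqF2; rewrite -hodge_homotopy //; exact: f0 (hodge_cyc c).
Qed.
End BarHodge.

Section Kunneth.
Variables (hT gT : finGroupType) (P : cplx) (a : hT -> P -> P).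
Hypothesis aP : action_on a.
Local Notation PX := (tens P (bar gT)).
Local Notation act := (tact a (@bar_act gT)).
Implicit Types (F : PX -> 'F_2) (v : seq (bar gT)).

(** The slant product of F with a chain in the second factor. *)
Definition slant F v (s : P) := ev (fun t => F (s, t)) v.

Lemma tens_invar1 F t : invar act F -> invar a (fun s => F (s, t)).
Proof.
move=> IF x s; rewrite -[RHS](IF (x, 1%g)) /tact /=.
by rewrite (act_1 (bar_actP gT)).
Qed.
Lemma tens_invar2 F s : invar act F -> invar bar_act (fun t => F (s, t)).
Proof. by move=> IF x t; rewrite -[RHS](IF (1%g, x)) /tact /= (act_1 aP). Qed.

Lemma slant_invar F v : invar act F -> invar a (slant F v).
Proof. by move=> IF x s; apply: eq_ev => t; apply: tens_invar1. Qed.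

Lemma cobd_slant F j v s : invar act F -> cyc j v ->
  slant (cobd F) v s = cobd (slant F v) s.
Proof.
move=> IF [_ vP]; rewrite /slant (eq_ev _ (cobd_tens F s)) evD.
rewrite vP; last exact: tens_invar2.
by rewrite addr0 [LHS]ev_exch.
Qed.

Lemma slant_cocyc F j v : invar act F -> cocyc F -> cyc j v -> cocyc (slant F v).
Proof.
move=> IF zF vP s; rewrite -(cobd_slant s IF vP) -[RHS](ev0 v).
by apply: eq_ev => t; apply: zF.
Qed.

Lemma slant_null F j v : cyc j v -> null act F -> null a (slant F v).
Proof.
move=> vP [G IG FG]; exists (slant G v); first exact: slant_invar.
by move=> s; rewrite -(cobd_slant s IG vP); apply: eq_ev => t; apply: FG.
Qed.

Lemma slant_homog F i j v : homog i F -> cyc j v -> (j <= i)%N ->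
  homog (i - j) (slant F v).
Proof.
move=> hF [dv _] le_ji s ds; apply: ev0_all dv _ => t /eqP dt.
by apply: hF; apply: contraNneq ds => <-; rewrite [X in (X - j)%N]/(dg s + dg t)%N dt addnK.
Qed.

Lemma slant_high F i j v : homog i F -> cyc j v -> (i < j)%N ->
  slant F v =1 (fun=> 0).
Proof.
move=> hF [dv _] lt_ij s; apply: ev0_all dv _ => t /eqP dt.
by apply: hF; rewrite [dg _]/(dg s + dg t)%N dt neq_ltn (leq_trans lt_ij) ?orbT ?leq_addl.
Qed.

Definition hodge_r F : PX -> 'F_2 := fun p => slant F (hodge p.2) p.1.

Lemma hodge_r_null F : cocyc F -> invar act F -> null act (fun p => F p + hodge_r F p).
Proof.
move=> zF IF; exists (fun p => slant F (bar_ginv p.2) p.1).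
  move=> x [s t]; rewrite /tact /= bar_ginv_act.
  exact: slant_invar.
move=> [s t]; rewrite /hodge_r {1}/slant /= hodgeE.
rewrite cobd_tens addrA [X in X + _]addrA addF2 add0r addrC; congr (_ + _).
transitivity (ev (fun t' => cobd (fun s' => F (s', t')) s) (bar_ginv t)).
  2: exact: (ev_exch (fun t' s' => F (s', t'))).
apply: eq_ev => t' /=.
by apply: eqF2; rewrite addrC -(zF (s, t')) cobd_tens.
Qed.

Lemma hodge_r_cocyc F : cocyc F -> invar act F -> cocyc (hodge_r F).
Proof.
move=> zF IF; apply: (eq_cocyc (f := fun p => F p + (F p + hodge_r F p))).
  by move=> p; rewrite addrA addF2 add0r.
by apply: cocycD => //; apply: null_cocyc (hodge_r_null zF IF).
Qed.

Lemma hodge_r_invar F : invar act F -> invar act (hodge_r F).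
Proof.
move=> IF x [s t]; rewrite /hodge_r /tact /=.
rewrite (slant_invar _ IF) /slant; apply: hodge_invar.
exact: tens_invar2.
Qed.

(** F is homologous to its composite with [hodge] in the second variable,
    that is to a family of slant products with cycles.  Primitives of these are
    chosen on representatives of the orbits; composing once more with [hodge],
    which kills boundaries, makes the family a primitive of F. *)
Lemma kunneth F : cocyc F -> invar act F ->
  (forall j v, cyc j v -> null a (slant F v)) -> null act F.
Proof.
move=> zF IF nF.
have zF1 := hodge_r_cocyc zF IF; have IF1 := hodge_r_invar IF.
apply: null_eqD (hodge_r_null zF IF) _ => //.
apply: null_eqD (hodge_r_null zF1 IF1) _ => //.
have H c : exists g, invar a g /\ slant F (hodge c) =1 cobd g.
  by case: (nF _ _ (hodge_cyc c)) => g Ig Fg; exists g.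
pose g c := proj1_sig (constructive_indefinite_description _ (H (rep bar_act fst c))).
have gP c : invar a (g c) /\ slant F (hodge (rep bar_act fst c)) =1 cobd (g c).
  exact: proj2_sig (constructive_indefinite_description _ (H (rep bar_act fst c))).
have Ig s : invar bar_act (fun c => g c s).
  by move=> x c; rewrite /g (rep_act (bar_actP gT) (@bar_free gT)).
exists (fun p => ev (fun c => g c p.1) (hodge p.2)).
  move=> x [s t]; rewrite /tact /= (hodge_invar (Ig _)).
  by apply: eq_ev => c; rewrite (proj1 (gP c)).
move=> [s t]; rewrite cobd_tens /= (hodge_bd (Ig s)) addr0 /cobd [RHS]ev_exch.
apply: eq_ev => c /=; rewrite -[RHS](proj2 (gP c)).
rewrite /hodge_r /= /slant [RHS]/=.
have := hodge_invar (tens_invar2 s IF) ((c.1)^-1)%g c => ->.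
by [].
Qed.
End Kunneth.

Definition detects (hT gT : finGroupType) (al : hT -> gT) :=
  forall x, class x -> null_on al x -> null bar_act x.

Section Products.
Variables hT kT lT : finGroupType.
Local Notation XX kT lT := (tens (bar kT) (bar lT)).
Local Notation xact := (tact bar_act bar_act).

Lemma xactP (k l : finGroupType) : action_on (tact (@bar_act k) (@bar_act l)).
Proof. exact: tactP (bar_actP k) (bar_actP l). Qed.
Lemma xact_free (k l : finGroupType) :
  free_by (tact (@bar_act k) (@bar_act l)) (fun p => (p.1.1, p.2.1)).
Proof. by apply: tact_free; apply: bar_free. Qed.
(** The comparison of the tensor product of two bar complexes with the bar
    complex of the product. *)
Definition ez (k l : finGroupType) : XX k l -> seq (bar (k * l)%type) :=
  lift (tact bar_act bar_act) bar_act (fun p => (p.1.1, p.2.1)) (bar_contr _).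
Lemma ez_chmap (k l : finGroupType) : chmap (tact bar_act bar_act) bar_act (@ez k l).
Proof. exact (lift_chmap (xactP k l) (bar_actP _) (bar_contr _) (@xact_free k l)). Qed.

Lemma ez_null (k l : finGroupType) x : class x ->
  null xact (pull (@ez k l) x) -> null bar_act x.
Proof.
move=> [zx Ix]; exact (pull_null_inj (tens_contr (bar_contr k) (bar_contr l))
  (bar_contr _) (xactP k l) (bar_actP _) (@bar_free _) (ez_chmap k l) zx Ix).
Qed.

(** By the Kuenneth theorem it is enough to detect the slant products of a
    class with the cycles of lT, which are classes on kT. *)
Lemma detects_prod (al : hT -> kT) : {morph al : x y / (x * y)%g} ->
  detects al -> detects (fun p : hT * lT => (al p.1, p.2)).
Proof.
move=> alM det x [zx Ix] nx.
have beM : {morph (fun p : hT * lT => (al p.1, p.2)) : x y / (x * y)%g}.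
  by move=> p q; rewrite alM.
apply: ez_null => //; have ezP := ez_chmap kT lT.
have zF := pull_cocyc ezP zx; have IF := pull_invar ezP Ix.
apply: (kunneth (bar_actP _) zF IF) => j v vP; apply: det.
  split; first exact: (slant_cocyc (bar_actP kT) IF zF vP).
  exact: slant_invar.
have tP := tmap_chmap (bar_map_chmap alM) (id_chmap (@bar_act lT)).
have tP' := comp_chmap tP (via_chmap (fun p => (al p.1, p.2)) ezP).
have := null_pull beM (xactP hT lT) (@xact_free hT lT) tP' (conj zx Ix) nx.
move=> /(slant_null (bar_actP _) vP); apply: eq_null => s.
apply: eq_ev => t.
transitivity (pull (tmap (fun c => [:: bar_map al c]) (fun c => [:: c]))
  (pull (@ez kT lT) x) (s, t)); first exact: ev_lin_ext.
by rewrite pull_tmap /pull !ev_seq1.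
Qed.
End Products.

Lemma detects_prodr (hT kT lT : finGroupType) (al : hT -> kT) :
  {morph al : x y / (x * y)%g} ->
  detects al -> detects (fun p : lT * hT => (p.1, al p.2)).
Proof.
move=> alM det x zx nx.
pose sw (A B : finGroupType) (p : A * B) := (p.2, p.1).
have swM A B : {morph @sw A B : x y / (x * y)%g} by [].
have zy := resb_class (swM kT lT) zx.
have : null bar_act (resb (@sw kT lT) x).
  apply: (detects_prod (lT := lT) alM det zy).
  have := null_on_comp (swM hT lT) nx.
  by apply: eq_null => c; rewrite resb_comp; apply: eq_resb.
move=> /(null_resb (swM lT kT)); apply: eq_null => c.
rewrite resb_comp /resb; congr x; case: c => [[v1 v2] s].
by rewrite /bar_map /=; congr pair; rewrite -[RHS]map_id; apply: eq_map => -[].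
Qed.

(** * The cup-i coproduct *)

Section CupI.
Variable T : Type.
Implicit Types (s : seq T) (Phi : seq T * seq T -> 'F_2).

(** Steenrod's cup-i coproduct on ordered simplices, in a form that is
    recursive on the list of vertices.  The index is shifted by one: [cup r.+1]
    is the cup-r coproduct, and [cup 0] is the simplex tensored with the empty
    one, which makes [cup_bd] hold without exceptions in the complex augmented
    by the empty simplex. *)
Fixpoint cup (r : nat) s : seq (seq T * seq T) :=
  match r, s with
  | 0, _ => [:: (s, [::])]
  | _, [::] => [::]
  | r'.+1, v :: s' =>
    map (fun p => (v :: p.1, p.2)) (cup r s') ++
    map (fun p => (v :: p.2, v :: p.1)) (cup r' s')
  end.

Lemma cup0 s : cup 0 s = [:: (s, [::])].
Proof. by case: s. Qed.

Definition dels2 Phi (p : seq T * seq T) :=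
  ev (fun a => Phi (a, p.2)) (dels p.1) + ev (fun b => Phi (p.1, b)) (dels p.2).

(** The coproduct of index r is a homotopy between that of index r - 1 and
    its flip. *)
Lemma cup_bd Phi r s :
  ev (dels2 Phi) (cup r.+1 s) + ev (fun q => ev Phi (cup r.+1 q)) (dels s)
  = ev (fun p => Phi p + Phi (p.2, p.1)) (cup r s).
Proof.
elim: s r Phi => [|v s IH] r Phi.
  rewrite !ev_nil addr0; case: r => [|r] /=; last by rewrite ev_nil.
  by rewrite ev_seq1 addF2.
have cupS q r' : cup r'.+1 (v :: q) = map (fun p => (v :: p.1, p.2)) (cup r'.+1 q)
    ++ map (fun p => (v :: p.2, v :: p.1)) (cup r' q) by [].
pose P1 p := Phi (v :: p.1, p.2); pose P2 p := Phi (v :: p.2, v :: p.1).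
pose P3 p := Phi (p.2, v :: p.1); pose P4 p := Phi (v :: p.2, p.1).
have E1 c : ev (dels2 Phi) (map (fun p => (v :: p.1, p.2)) c)
    = ev Phi c + ev (dels2 P1) c.
  rewrite ev_map -(evD Phi (dels2 P1)); apply: eq_ev => -[a b].
  by rewrite /dels2 /= ev_cons ev_map addrA.
have E2 c : ev (dels2 Phi) (map (fun p => (v :: p.2, v :: p.1)) c)
    = ev P3 c + ev P4 c + ev (dels2 P2) c.
  rewrite ev_map -(evD P3 P4) -(evD _ (dels2 P2)); apply: eq_ev => -[a b].
  by rewrite /dels2 /= !ev_cons !ev_map /P2 /P3 /P4 /=; F2solve.
have E3 : ev (fun q => ev Phi (cup r.+1 q)) (dels (v :: s)) =
   ev Phi (cup r.+1 s) + ev (fun q => ev P1 (cup r.+1 q)) (dels s)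
   + ev (fun q => ev P2 (cup r q)) (dels s).
  rewrite [dels _]/= ev_cons ev_map -addrA; congr (_ + _); rewrite -evD.
  by apply: eq_ev => q; rewrite cupS ev_cat !ev_map.
rewrite {1}cupS ev_cat E1 E2 E3.
have -> : ev (dels2 P1) (cup r.+1 s) =
   ev (fun q => ev P1 (cup r.+1 q)) (dels s) + (ev P1 (cup r s) + ev P4 (cup r s)).
  by rewrite -(evD P1 P4) -(IH r P1); F2solve.
case: r {E3 cupS} => [|r].
  have -> : ev (fun q => ev P2 (cup 0 q)) (dels s)
    = ev (fun a => Phi ([:: v], v :: a)) (dels s).
    by apply: eq_ev => q; rewrite cup0 ev_seq1.
  rewrite !cup0 !ev_seq1 /dels2 /= ev_nil addr0 /P1 /P2 /P3 /P4 /=.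
  by F2solve.
have -> : ev (dels2 P2) (cup r.+1 s) =
   ev (fun q => ev P2 (cup r.+1 q)) (dels s)
   + (ev P2 (cup r s) + ev (fun p => P2 (p.2, p.1)) (cup r s)).
  by rewrite -(evD P2) -(IH r P2); F2solve.
rewrite evD [cup r.+1 (v :: s)]/= !ev_cat !ev_map -/P1 -/P2.
have -> : ev (fun p => Phi (p.2, v :: p.1)) (cup r.+1 s) = ev P3 (cup r.+1 s) by [].
have -> : ev (fun p => Phi (v :: p.1, v :: p.2)) (cup r s)
   = ev (fun p => P2 (p.2, p.1)) (cup r s) by [].
by F2solve.
Qed.

Lemma cup_size r s :
  all (fun p => size p.1 + size p.2 == size s + r)%N (cup r s).
Proof.
elim: s r => [|v s IH] [|r]; rewrite ?cup0 /= ?addn0 ?eqxx //.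
rewrite all_cat !all_map; apply/andP; split.
  by apply: sub_all (IH r.+1) => p /=; lia.
by apply: sub_all (IH r) => p /=; lia.
Qed.

(** Together with [cup_top]: both factors are faces of s, which bounds the
    degree and leaves a single term in the extreme case.  This is why the
    Steenrod operation Sq^0 is the identity. *)
Lemma cup_gt r s : (size s < r)%N -> cup r s = [::].
Proof. by elim: s r => [|v s IH] [|r] //= lt_sr; rewrite !IH // ltnW. Qed.

Lemma cup_top s : cup (size s) s = [:: (s, s)].
Proof. by elim: s => //= v s IH; rewrite cup_gt // IH. Qed.
End CupI.

Lemma cup_map T U (f : T -> U) r s :
  cup r (map f s) = map (fun p => (map f p.1, map f p.2)) (cup r s).
Proof.
elim: s r => [|v s IH] [|r]; rewrite ?cup0 //= !IH map_cat -!map_comp.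
by [].
Qed.

Definition swap (A : Type) (p : A * A) := (p.2, p.1).
Definition tw (A : Type) (b : bool) (p : A * A) := if b then swap p else p.
Lemma tw_tw A b c (p : A * A) : tw b (tw c p) = tw (b (+) c) p.
Proof. by case: b c p => [] [] []. Qed.

Section CupBar.
Variable gT : finGroupType.
Local Notation X := (bar gT).
Local Notation XX := (tens X X).

Definition two_cells (p : seq gT * seq gT) : seq XX :=
  match p with
  | (v :: a, w :: b) => [:: ((v, a), (w, b))]
  | _ => [::]
  end.
Definition on_list2 (Phi : XX -> 'F_2) p := ev Phi (two_cells p).

Lemma cobd_on_list2 Phi p : on_list2 (cobd Phi) p = dels2 (on_list2 Phi) p.
Proof.
case: p => [[|v a] [|w b]]; rewrite /on_list2 /dels2 /two_cells ?ev_nil ?addr0 //=.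
- by rewrite add0r (eq_ev (g := fun=> 0)) ?ev0 // => q; rewrite ev_nil.
- by rewrite (eq_ev (g := fun=> 0)) ?ev0 // => -[|u q]; rewrite ev_nil.
rewrite ev_seq1 cobd_tens /cobd /= !bar_bdE /=.
by congr (_ + _); apply: eq_ev => -[|x q]; rewrite /= ?ev_nil ?ev_seq1.
Qed.

Definition dcup r (c : X) : seq XX := lin_ext two_cells (cup r.+1 (c.1 :: c.2)).

Lemma dcupE Phi r c : ev Phi (dcup r c) = ev (on_list2 Phi) (cup r.+1 (c.1 :: c.2)).
Proof. exact: ev_lin_ext. Qed.

Lemma dcup_bd Phi r c :
  ev (cobd Phi) (dcup r c) + cobd (fun c' => ev Phi (dcup r c')) c =
  if r is r'.+1 then ev (fun p => Phi p + Phi (swap p)) (dcup r' c) else 0.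
Proof.
have -> : cobd (fun c' => ev Phi (dcup r c')) c =
    ev (fun q => ev (on_list2 Phi) (cup r.+1 q)) (dels (c.1 :: c.2)).
  case: c => v s; rewrite {1}/cobd /= bar_bdE; apply: eq_ev => -[|w q] /=.
    by rewrite ev_nil.
  by rewrite dcupE.
rewrite dcupE (eq_ev _ (cobd_on_list2 Phi)) cup_bd.
case: r => [|r].
  by rewrite /= ev_seq1 /on_list2 /= !ev_nil addr0.
rewrite dcupE; apply: eq_ev => -[a b]; rewrite /on_list2 evD; congr (_ + _).
by case: a => [|v a]; case: b => [|w b]; rewrite /= ?ev_nil ?ev_seq1.
Qed.

Lemma dcup_dg r c : all (fun p => dg p == dg c + r)%N (dcup r c).
Proof.
apply: all_lin_ext (cup_size r.+1 (c.1 :: c.2)) _ => -[[|v a] [|w b]] //= ap.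
by rewrite /tens_dg /= andbT; move: ap; lia.
Qed.

Lemma dcup_gt r c : (dg c < r)%N -> dcup r c = [::].
Proof. by move=> lt_cr; rewrite /dcup cup_gt. Qed.

Lemma dcup_top c : dcup (dg c) c = [:: (c, c)].
Proof.
rewrite /dcup -[(dg c).+1]/(size (c.1 :: c.2)) cup_top.
by case: c.
Qed.

Lemma dcup_act r x c :
  dcup r (bar_act x c) = map (tact bar_act bar_act (x, x)) (dcup r c).
Proof.
rewrite /dcup -[(_ :: _)]/(map (mulg x) (c.1 :: c.2)) cup_map /lin_ext -!map_comp.
rewrite map_flatten -map_comp; congr flatten; apply: eq_map => -[[|v a] [|w b]] //=.
Qed.
End CupBar.

(** * Resolutions of wreath products with a group of order two *)

Definition C2 : Type := bool.
HB.instance Definition _ := Finite.on C2.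
HB.instance Definition _ := Finite_isGroup.Build C2 addbA addFb addbb.

(** The periodic resolution of the group of order two, with two cells in
    each degree, exchanged by the group. *)
Definition C2_bd (x : nat * bool) : seq (nat * bool) :=
  if x.1 is j.+1 then [:: (j, false); (j, true)] else [::].
Lemma C2_bd_dg x : all (fun t => (fst t).+1 == fst x) (C2_bd x).
Proof. by case: x => [[|j] b] //=; rewrite eqxx. Qed.
Lemma C2_bd_bd f x : ev (fun t => ev f (C2_bd t)) (C2_bd x) = 0.
Proof.
case: x => [[|[|j]] b]; rewrite /C2_bd /= ?ev_cons ?ev_nil ?addr0 //.
exact: addF2.
Qed.
Lemma C2_bd_aug x : ev (fun t => (fst t == 0%N)%:R) (C2_bd x) = 0.
Proof. by case: x => [[|j] b]; rewrite /C2_bd /= ?ev_cons ?ev_nil ?addr0 ?addF2. Qed.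
Definition C2_cplx : cplx := Cplx C2_bd_dg C2_bd_bd C2_bd_aug.

Definition C2_act (e : C2) (x : C2_cplx) : C2_cplx := (x.1, e (+) x.2).
Lemma C2_actP : action_on C2_act.
Proof.
split=> [[j b]|x y [j b]|x [j b]|f x [[|j] b]] //; rewrite /C2_act /=.
- by rewrite addbA.
- by rewrite /C2_bd /= !ev_nil.
rewrite /C2_bd /= !ev_cons !ev_nil; by case: x => /=; rewrite !addr0 // addrC.
Qed.
Lemma C2_act_free : free_by C2_act (fun x => x.2 : C2).
Proof. by move=> x [j b]. Qed.

Definition C2_cone (x : C2_cplx) : seq C2_cplx := if x.2 then [:: (x.1.+1, false)] else [::].
Lemma C2_cone_dg x : all (fun t => dg t == (dg x).+1) (C2_cone x).
Proof. by case: x => j [] //=; rewrite eqxx. Qed.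
Lemma cobd_C2 (f : C2_cplx -> 'F_2) j b :
  cobd f (j, b) = if j is j'.+1 then f (j', false) + f (j', true) else 0.
Proof. by case: j => [|j]; rewrite /cobd /ev /= ?big_cons ?big_nil ?addr0. Qed.
Lemma ev_C2_cone (f : C2_cplx -> 'F_2) j b :
  ev f (C2_cone (j, b)) = if b then f (j.+1, false) else 0.
Proof. by case: b; rewrite /ev /C2_cone /= ?big_seq1 ?big_nil. Qed.

Lemma C2_coneP f x : ev (cobd f) (C2_cone x) + ev (fun t => ev f (C2_cone t)) (bd x)
  = f x + aug x * f (0%N, false).
Proof.
case: x => j b; rewrite ev_C2_cone -[X in _ + X]/(cobd (fun t => ev f (C2_cone t)) (j, b)).
rewrite !cobd_C2 /aug /=.
case: j b => [|j] []; rewrite ?ev_C2_cone ?mul1r ?mul0r ?addr0 ?add0r ?addF2 //.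
  by rewrite addrC.
by rewrite addrAC addF2 add0r.
Qed.
Definition C2_contr : contraction C2_cplx :=
  @Contraction C2_cplx C2_cone (0%N, false) (erefl _) C2_cone_dg C2_coneP.

Section WreathGroup.
Variable gT : finGroupType.
Definition wreath : Type := ((gT * gT) * bool)%type.
HB.instance Definition _ := Finite.on wreath.
Definition wr_mul (x y : wreath) : wreath := ((x.1 * tw x.2 y.1)%g, x.2 (+) y.2).
Definition wr_one : wreath := (1%g, false).
Definition wr_inv (x : wreath) : wreath := (tw x.2 (x.1^-1)%g, x.2).
Lemma wr_mulA : associative wr_mul.
Proof.
move=> [[x1 x2] b] [[y1 y2] c] [[z1 z2] d]; rewrite /wr_mul /=.
by rewrite addbA; case: b; case: c; congr (_, _); congr (_, _); rewrite /= mulgA.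
Qed.
Lemma wr_mul1 : left_id wr_one wr_mul.
Proof. by move=> [x b]; rewrite /wr_mul /= mul1g. Qed.
Lemma wr_mulV : left_inverse wr_one wr_inv wr_mul.
Proof.
move=> [[x1 x2] b]; rewrite /wr_mul /wr_inv /= addbb; congr (_, _).
by case: b; congr (_, _); rewrite /= mulVg.
Qed.
HB.instance Definition _ := Finite_isGroup.Build wreath wr_mulA wr_mul1 wr_mulV.

Definition wr_base (x : gT * gT) : wreath := (x, false).
Definition wr_diag (x : C2 * gT) : wreath := ((x.2, x.2), x.1).
Lemma wr_baseM : {morph wr_base : x y / (x * y)%g}.
Proof. by []. Qed.
Lemma wr_diagM : {morph wr_diag : x y / (x * y)%g}.
Proof. by move=> [[] x] [[] y]. Qed.
End WreathGroup.

Section WreathComplex.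
Variable gT : finGroupType.
Local Notation X := (bar gT).
Local Notation XX := (tens X X).
Local Notation W := (wreath gT).
Local Notation nact := (tact (@bar_act gT) (@bar_act gT)).
Definition wreath_cplx := tens C2_cplx XX.

Definition wreath_act (w : W) (p : wreath_cplx) : wreath_cplx :=
  (C2_act w.2 p.1, nact w.1 (tw w.2 p.2)).

Lemma cobd_tw (f : XX -> 'F_2) b (p : XX) : cobd (fun q : XX => f (tw b q)) p = cobd f (tw b p).
Proof.
case: b p => [] [s t] //=; rewrite /swap cobd_tens /=.
by rewrite [RHS]cobd_tens addrC.
Qed.

Lemma nact_tw b x (p : XX) : nact (tw b x) (tw b p) = tw b (nact x p).
Proof. by case: b x p => [] [x1 x2] [s t]. Qed.

Lemma dg_tw b (p : XX) : dg (tw b p : XX) = dg p.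
Proof. by case: b p => [] [s t] //; rewrite /= /tens_dg addnC. Qed.

Lemma wreath_actP : action_on wreath_act.
Proof.
have nP := tactP (bar_actP gT) (bar_actP gT).
split=> [[x p]|v w [x p]|w [x p]|f w [x p]]; rewrite /wreath_act /=.
- by rewrite (act_1 C2_actP) (act_1 nP).
- by rewrite (act_M C2_actP) (act_M nP) -nact_tw tw_tw.
- exact: (congr1 (addn (dg x)) (etrans (act_dg nP _ _) (dg_tw w.2 p))).
- rewrite [LHS]tens_bdE [RHS]tens_bdE (act_bd C2_actP); congr (_ + _).
  transitivity (ev (fun t => f (C2_act w.2 x, nact w.1 t)) (bd (tw w.2 p : XX))).
    exact (act_bd nP (fun t => f (C2_act w.2 x, t)) w.1 (tw w.2 p)).
  exact (esym (cobd_tw (fun t => f (C2_act w.2 x, nact w.1 t)) w.2 p)).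
Qed.

Definition wreath_nu (p : wreath_cplx) : W := ((p.2.1.1, p.2.2.1), p.1.2).
Lemma wreath_act_free : free_by wreath_act wreath_nu.
Proof. by move=> [[x1 x2] []] [[j b] [s t]]. Qed.

Definition wreath_contr : contraction wreath_cplx :=
  tens_contr C2_contr (tens_contr (bar_contr gT) (bar_contr gT)).

Definition base_map (p : XX) : seq wreath_cplx := [:: ((0%N, false), p)].
Lemma base_map_chmap : chmap nact (via (@wr_base gT) wreath_act) base_map.
Proof.
split=> [p|f p|f x p|p]; rewrite /base_map /pull ?ev_seq1 //=.
- by rewrite eqxx.
- rewrite cobd_tens /cobd /C2_bd [X in X + _]ev_nil add0r.
  by apply: eq_ev => q; rewrite ev_seq1.
Qed.

(** Equivariant for the diagonal inclusion of C2 x K in the wreath product;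
    it combines the coproduct of the resolution of C2 with the cup-i coproducts. *)
Definition diag_map (p : tens C2_cplx X) : seq wreath_cplx :=
  lin_ext (fun m => map (fun q : XX => ((m, p.1.2), tw (p.1.2 (+) odd m) q) : wreath_cplx)
    (dcup (p.1.1 - m) p.2)) (index_iota 0 p.1.1.+1).

Lemma pull_diag_map F j b c : pull diag_map F ((j, b), c) =
  \sum_(0 <= m < j.+1)
    ev (fun q : XX => F ((m, b), tw (b (+) odd m) q)) (dcup (j - m) c).
Proof. by rewrite /pull ev_lin_ext; apply: eq_bigr => m _; rewrite ev_map. Qed.

Lemma diag_map_chmap : chmap (tact C2_act (@bar_act gT)) (via (@wr_diag gT) wreath_act) diag_map.
Proof.
have dgP p : all (fun t => dg t == dg p) (diag_map p).
  case: p => [[j b] c]; apply: (@all_lin_ext _ _ _ (fun m => m <= j)%N).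
    by apply/allP => m; rewrite mem_index_iota ltnS.
  move=> m le_mj; rewrite all_map; apply: sub_all (dcup_dg (j - m) c) => q.
  move=> /eqP dq; apply/eqP.
  transitivity (m + dg (tw (b (+) odd m) q : XX))%N => //.
  by rewrite dg_tw dq addnCA subnKC // addnC.
split=> // [F [[j b] c]|F [e k] [[j b] c]|[[j b] c]].
- rewrite pull_diag_map cobd_tens.
  rewrite (eq_cobd c (pull_diag_map F j b)).
  pose G m b' (q : XX) := F ((m, b'), tw (b' (+) odd m) q).
  pose D m b' r := ev (G m b') (dcup r c).
  pose D' m b' r := ev (fun q : XX => G m b' (swap q)) (dcup r c).
  have EL m : ev (fun q : XX => cobd F ((m, b), tw (b (+) odd m) q)) (dcup (j - m) c)
    = (if m is m'.+1 then D' m' b (j - m)%N + D m' (~~ b) (j - m)%N else 0)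
      + ev (cobd (G m b)) (dcup (j - m) c).
    have E (q : XX) : cobd F ((m, b), tw (b (+) odd m) q) =
      (if m is m'.+1 then G m' b (swap q) + G m' (~~ b) q else 0) + cobd (G m b) q.
      rewrite cobd_tens cobd_C2 /G; congr (_ + _);
        last exact (esym (cobd_tw (fun t => F ((m, b), t)) (b (+) odd m) q)).
      case: m => // m; rewrite /swap /=; case: b; case: (odd m) => /=;
      rewrite /swap /= -?surjective_pairing // addrC //.
    rewrite (eq_ev _ E) evD; congr (_ + _).
    by case: m {E} => [|m]; rewrite ?ev0 ?evD.
  rewrite (eq_bigr _ (fun m _ => EL m)) big_split /=.
  have -> : cobd (fun t => \sum_(0 <= m < j.+1) ev (fun q : XX => F (m, b, tw (b (+) odd m) q))
      (dcup (j - m) t)) c = \sum_(0 <= m < j.+1) cobd (fun t => ev (G m b) (dcup (j - m) t)) c.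
    by rewrite /cobd /ev exchange_big.
  have ER : \sum_(0 <= m < j.+1) ev (cobd (G m b)) (dcup (j - m) c) =
    \sum_(0 <= m < j.+1) cobd (fun t => ev (G m b) (dcup (j - m) t)) c
    + \sum_(0 <= m < j) (D m b (j - m.+1)%N + D' m b (j - m.+1)%N).
    rewrite [X in _ + X](_ : _ = \sum_(0 <= m < j.+1)
       if (j - m)%N is r.+1 then D m b r + D' m b r else 0).
      rewrite -big_split; apply: eq_bigr => m _; apply: eqF2.
      have := dcup_bd (G m b) (j - m) c.
      set x := ev _ _; set y := cobd _ _; case: (j - m)%N => [|r] H.
        by rewrite /= addr0 H.
      by rewrite /= addrA H evD -/(D m b r) -/(D' m b r) addF2.
    rewrite big_nat_recr //= subnn addr0; apply: eq_big_nat => m /andP[_ lt_mj].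
    by rewrite -(subnSK lt_mj).
  rewrite ER big_nat_recl //= add0r [RHS]addrC.
  rewrite [X in _ = _ + X](_ : _ = \sum_(0 <= m < j) (D m b (j - m.+1)%N + D m (~~ b) (j - m.+1)%N)).
    rewrite !big_split /=; F2solve.
  rewrite cobd_C2; case: j {EL ER D'} @D => [|j] D; first by rewrite big_nil.
  rewrite !pull_diag_map -big_split /=; apply: eq_big_nat => m /andP[_ lt_mj].
  by rewrite /D /G !subSS; case: (b); rewrite // addrC.
- rewrite !pull_diag_map; apply: eq_bigr => m _; rewrite dcup_act ev_map.
  apply: eq_ev => q; rewrite /via /wreath_act /wr_diag /=; congr (F (_, _)).
  rewrite tw_tw -addbA; rewrite -[in LHS](nact_tw (e (+) (b (+) odd m)) (k, k)).
  by case: (e (+) _).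
- case: (eqVneq (dg (((j, b), c) : tens C2_cplx X)) 0%N) => [d0|/negPf d0].
    have {d0} : (j == 0%N) && (size c.2 == 0%N) by rewrite -addn_eq0; apply/eqP.
    case: c => v s /andP[/eqP-> /nilP/= ->].
    rewrite pull_diag_map big_nat1 subnn /= !aug_tens.
    by case: (b); rewrite /dcup /lin_ext /= ev_seq1 /aug /= mulr1.
  rewrite [RHS]/aug d0; apply: ev0_all (dgP _) _ => q /eqP dq.
  by rewrite /aug dq d0.
Qed.
End WreathComplex.

(** * Detection for wreath products *)

Lemma dg_tens (C D : cplx) (s : C) (t : D) :
  dg ((s, t) : tens C D) = (dg s + dg t)%N.
Proof. by []. Qed.

Lemma dg_C2 j b : dg ((j, b) : C2_cplx) = j.
Proof. by []. Qed.

Lemma cobdMr (C : cplx) (f : C -> 'F_2) a s :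
  cobd (fun t => f t * a) s = cobd f s * a.
Proof. exact: evMr. Qed.
Lemma cobdMl (C : cplx) (f : C -> 'F_2) a s :
  cobd (fun t => a * f t) s = a * cobd f s.
Proof. exact: evMl. Qed.

Section SymmetricClasses.
Variable gT : finGroupType.
Local Notation X := (bar gT).
Local Notation XX := (tens X X).
Local Notation nact := (tact (@bar_act gT) (@bar_act gT)).
Implicit Types (F : XX -> 'F_2) (f : X -> 'F_2).

Definition flip F : XX -> 'F_2 := fun p => F (swap p).
Definition square f : XX -> 'F_2 := fun p => f p.1 * f p.2.
Definition hodge2 F : XX -> 'F_2 :=
  fun p => ev (fun s => ev (fun t => F (s, t)) (hodge p.2)) (hodge p.1).

Lemma flip_invar F : invar nact F -> invar nact (flip F).
Proof. by move=> IF [x y] [s t]; exact: (IF (y, x) (t, s)). Qed.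
Lemma cobd_flip F p : cobd (flip F) p = flip (cobd F) p.
Proof. exact: (cobd_tw F true). Qed.
Lemma flip_cocyc F : cocyc F -> cocyc (flip F).
Proof. by move=> zF p; rewrite cobd_flip; apply: zF. Qed.
Lemma flip_null F : null nact F -> null nact (flip F).
Proof.
move=> [G IG FG]; exists (flip G); first exact: flip_invar.
by move=> p; rewrite cobd_flip; apply: FG.
Qed.
Lemma flip_homog i F : homog i F -> homog i (flip F).
Proof. by move=> hF p dp; apply: hF; rewrite (dg_tw true p). Qed.

Lemma hodge2E F p : hodge2 F p = flip (hodge_r (flip (hodge_r F))) p.
Proof. by []. Qed.

Lemma hodge2_null F : cocyc F -> invar nact F -> null nact (fun p => F p + hodge2 F p).
Proof.
move=> zF IF; have aP := bar_actP gT.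
have zF1 := flip_cocyc (hodge_r_cocyc zF IF).
have IF1 := flip_invar (hodge_r_invar aP IF).
have N1 := hodge_r_null zF IF.
have N2 := flip_null (hodge_r_null zF1 IF1).
apply: eq_null (nullD N1 N2) => -[s t]; rewrite hodge2E /flip /swap /=.
by F2solve.
Qed.

Lemma hodge2_invar F : invar nact F -> invar nact (hodge2 F).
Proof.
move=> IF; have aP := bar_actP gT.
exact (flip_invar (hodge_r_invar aP (flip_invar (hodge_r_invar aP IF)))).
Qed.

Lemma hodge2_cobd F : invar nact F -> hodge2 (cobd F) =1 (fun=> 0).
Proof.
move=> IF [s t]; rewrite /hodge2 /=.
transitivity (ev (fun s' => ev (fun t' => cobd (fun u => F (u, t')) s') (hodge t)) (hodge s)
   + ev (fun s' => ev (fun t' => cobd (fun u => F (s', u)) t') (hodge t)) (hodge s)).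
  rewrite -evD; apply: eq_ev => s'; rewrite -evD; apply: eq_ev => t'.
  exact: cobd_tens.
rewrite [X in X + _]ev_exch.
have -> : ev (fun t' => ev (fun s' => cobd (fun u => F (u, t')) s') (hodge s)) (hodge t) = 0.
  rewrite (eq_ev (g := fun=> 0)) ?ev0 // => t'; apply: hodge_cycle.
  exact: (tens_invar1 (a := @bar_act gT)).
rewrite add0r (eq_ev (g := fun=> 0)) ?ev0 // => s'; apply: hodge_cycle.
exact: (tens_invar2 (bar_actP gT)).
Qed.

Lemma hodge2_cocyc F : invar nact F -> cocyc (hodge2 F).
Proof.
move=> IF [s t]; rewrite cobd_tens /hodge2 /=.
have I1 : invar bar_act (fun s' => ev (fun t' => F (s', t')) (hodge t)).
  by move=> x s'; apply: eq_ev => t'; apply: (tens_invar1 (a := @bar_act gT)).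
rewrite (hodge_bd I1) add0r.
have I2 : invar bar_act (fun t' => ev (fun s' => F (s', t')) (hodge s)).
  by move=> x t'; apply: eq_ev => s'; apply: (tens_invar2 (bar_actP gT)).
rewrite -[RHS](hodge_bd I2 t); apply: eq_cobd => t'.
by rewrite ev_exch.
Qed.

Lemma hodge2D F G p : hodge2 (fun q => F q + G q) p = hodge2 F p + hodge2 G p.
Proof. by rewrite /hodge2 -evD; apply: eq_ev => s; rewrite -evD. Qed.
Lemma eq_hodge2 F G : F =1 G -> hodge2 F =1 hodge2 G.
Proof. by move=> FG p; apply: eq_ev => s; apply: eq_ev => t; apply: FG. Qed.
Lemma hodge2_flip F p : hodge2 (flip F) p = flip (hodge2 F) p.
Proof. by case: p => s t; rewrite /hodge2 /flip /swap /= ev_exch. Qed.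
Lemma hodge2_square f p : hodge2 (square f) p = square (fun s => ev f (hodge s)) p.
Proof.
by rewrite /square -evMr; apply: eq_ev => s; rewrite -evMl.
Qed.

Lemma hodge2_homog i F : homog i F -> homog i (hodge2 F).
Proof.
move=> hF [s t] dp; apply: ev0_all (hodge_dg s) _ => s' /eqP ds.
apply: ev0_all (hodge_dg t) _ => t' /eqP dt; apply: hF.
by rewrite dg_tens ds dt.
Qed.

Lemma square_cocyc f : cocyc f -> cocyc (square f).
Proof.
move=> zf [s t]; rewrite cobd_tens /square /= /cobd evMr evMl.
by rewrite [ev f (bd s)]zf [ev f (bd t)]zf mul0r mulr0 addr0.
Qed.
Lemma square_invar f : invar bar_act f -> invar nact (square f).
Proof. by move=> If [x y] [s t]; rewrite /square /= !If. Qed.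

(** After composition with [hodge] in both variables, Q is
    symmetric on the nose.  Its difference with the square of its diagonal is
    alternating, hence the symmetrization of its upper triangular part for any
    total order on the orbits of cells. *)
Lemma symmetric_class i Q : cocyc Q -> invar nact Q -> homog i Q ->
  null nact (fun p => Q p + flip Q p) ->
  exists f b g, [/\ class f, cocyc b, invar nact b, invar nact g &
    [/\ forall c, (dg c).*2 != i -> f c = 0, homog i b,
        forall p, (dg p).+1 != i -> g p = 0 &
        forall p, Q p = square f p + (b p + flip b p) + cobd g p]].
Proof.
move=> zQ IQ hQ [h Ih Qh].
set Q1 := hodge2 Q.
have IQ1 : invar nact Q1 by exact: hodge2_invar.
have zQ1 : cocyc Q1 by exact: hodge2_cocyc.
have hQ1 : homog i Q1 by exact: hodge2_homog.
have sQ1 p : Q1 p = flip Q1 p.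
  apply: eqF2; rewrite -hodge2_flip -hodge2D (eq_hodge2 Qh); exact: hodge2_cobd.
pose d (s : X) := Q1 (s, s).
have Id : invar bar_act d by move=> x s; exact: (IQ1 (x, x) (s, s)).
pose f (s : X) := ev d (hodge s).
pose R p := Q1 p + square d p.
have IR : invar nact R by apply: invarD => //; apply: square_invar.
have sR p : R p = flip R p.
  by rewrite /R /flip -[Q1 (swap p)]/(flip Q1 p) -sQ1 /square /= mulrC.
have hd c : (dg c).*2 != i -> d c = 0.
  by move=> dc; apply: hQ1; rewrite dg_tens addnn.
have hR : homog i R.
  apply: homogD => // -[s t] dp; rewrite /square /=.
  case: (eqVneq (dg s).*2 i) => [ds|/hd->]; last by rewrite mul0r.
  case: (eqVneq (dg t).*2 i) => [dt|/hd->]; last by rewrite mulr0.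
  by case/eqP: dp; rewrite dg_tens; lia.
(* Any total order on the orbits would do; pickle provides one. *)
pose rk (s : X) := pickle (rep bar_act fst s : gT * seq gT).
have rk_act x s : rk (bar_act x s) = rk s.
  by rewrite /rk (rep_act (bar_actP gT) (@bar_free gT)).
have dR s t : rk s = rk t -> R (s, t) = 0.
  move=> /(pcan_inj pickleK) est.
  have -> : R (s, t) = R (rep bar_act fst s, rep bar_act fst t).
    by rewrite -(IR ((s.1)^-1, (t.1)^-1)%g).
  rewrite est /R /square /d /=; set x := Q1 _.
  by case: (F2_cases x) => ->; apply/eqP.
pose U (p : XX) := if (rk p.1 < rk p.2)%N then R p else 0.
have IU : invar nact U.
  by move=> [x y] [s t]; rewrite /U /= !rk_act; case: ifP => // _; apply: IR.
have RU p : R p = U p + flip U p.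
  case: p => s t; rewrite /U /flip /=; case: ltngtP => [_|_|e].
  - by rewrite addr0.
  - by rewrite add0r; exact: sR.
  - by rewrite addr0 dR.
have hU : homog i U by move=> p dp; rewrite /U hR //; case: ifP.
have Ib := hodge2_invar IU; have zb := hodge2_cocyc IU; have hb := hodge2_homog hU.
have If : invar bar_act f by exact: hodge_invar.
have zf : cocyc f by exact: hodge_bd.
have hf c : (dg c).*2 != i -> f c = 0.
  by move=> dc; apply: ev0_all (hodge_dg c) _ => t /eqP dt; apply: hd; rewrite dt.
have hsf : homog i (square f).
  move=> [s t] dp; rewrite /square /=.
  case: (eqVneq (dg s).*2 i) => [ds|/hf->]; last by rewrite mul0r.
  case: (eqVneq (dg t).*2 i) => [dt|/hf->]; last by rewrite mulr0.
  by case/eqP: dp; rewrite dg_tens; lia.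
have E p : hodge2 Q1 p = square f p + (hodge2 U p + flip (hodge2 U) p).
  rewrite -hodge2_square -hodge2_flip -!hodge2D; apply: eq_hodge2 => q.
  by rewrite -RU /R; F2solve.
have N : null nact (fun p => Q p + (square f p + (hodge2 U p + flip (hodge2 U) p))).
  apply: eq_null (nullD (hodge2_null zQ IQ) (hodge2_null zQ1 IQ1)) => p.
  by rewrite -E -/Q1; F2solve.
have [|g [Ig Ng hg]] := null_homog (i := i) (tactP (bar_actP gT) (bar_actP gT)) _ N.
  by do !apply: homogD => //; apply: flip_homog.
exists f, (hodge2 U), g; split=> //; split=> // p.
by rewrite -Ng; F2solve.
Qed.
End SymmetricClasses.

Section WreathDetection.
Variable gT : finGroupType.
Local Notation X := (bar gT).
Local Notation XX := (tens X X).
Local Notation nact := (tact (@bar_act gT) (@bar_act gT)).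
Local Notation wreath_act := (@wreath_act gT).
Local Notation wreath_cplx := (wreath_cplx gT).
Implicit Types (F : wreath_cplx -> 'F_2) (u v : XX -> 'F_2).

(** The cochain t^k u, where t generates the cohomology of C2; cells of the
    resolution of C2 moved by the exchange see the flip of u. *)
Definition single k u : wreath_cplx -> 'F_2 :=
  fun p => if p.1.1 == k then u (tw p.1.2 p.2) else 0.
Definition slice F k : XX -> 'F_2 := fun p => F ((k, false), p).

Lemma slice_swap F k p : invar wreath_act F -> F ((k, true), p) = slice F k (swap p).
Proof.
move=> IF; rewrite -[RHS](IF ((1%g, 1%g), true)) /wreath_act /=.
rewrite [tact _ _ _ _](act_1 (tactP (bar_actP gT) (bar_actP gT))).
by case: p.
Qed.

Lemma sliceE F k b p : invar wreath_act F -> F ((k, b), p) = slice F k (tw b p).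
Proof. by move=> IF; case: b => //; apply: slice_swap. Qed.

Lemma slice_invar F k : invar wreath_act F -> invar nact (slice F k).
Proof. by move=> IF x p; rewrite /slice -[RHS](IF (x, false)). Qed.

Lemma slice_homog F i k : homog i F -> (k <= i)%N -> homog (i - k) (slice F k).
Proof.
move=> hF le_ki p dp; apply: hF; apply: contraNneq dp => <-.
by rewrite dg_tens addKn.
Qed.

Lemma slice_high F i k : homog i F -> (i < k)%N -> slice F k =1 (fun=> 0).
Proof.
move=> hF lt_ik p; apply: hF; rewrite dg_tens /=.
by rewrite neq_ltn ltn_addr ?orbT.
Qed.

Lemma single_invar k u : invar nact u -> invar wreath_act (single k u).
Proof.
move=> Iu [x b] [[j c] p]; rewrite /single /wreath_act /=; case: ifP => // _.
rewrite -nact_tw Iu tw_tw; congr (u (tw _ _)).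
by case: b; case: c.
Qed.

Lemma cobd_single k u p : cobd (single k u) p =
  single k (cobd u) p + single k.+1 (fun q => u q + flip u q) p.
Proof.
case: p => [[j b] q]; rewrite cobd_tens addrC; congr (_ + _).
  rewrite /single /=; case: eqP => _; last by rewrite /cobd ev0.
  by rewrite cobd_tw.
rewrite cobd_C2 /single /=; case: j => [|j] //; rewrite eqSS.
case: eqP => _; last exact: addr0.
by rewrite /flip; case: b => //=; rewrite addrC; case: q.
Qed.

Lemma single_homog i k d u : (k + d)%N = i -> homog d u -> homog i (single k u).
Proof.
move=> kd hu [[j b] q] dp; rewrite /single /=; case: eqP => // jk.
apply: hu; rewrite dg_tw; apply: contraNneq dp => dq.
by rewrite dg_tens dq -jk in kd *; apply/eqP.
Qed.

Lemma cobd_homog (C : cplx) i (h : C -> 'F_2) :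
  (forall p, (dg p).+1 != i -> h p = 0) -> homog i (cobd h).
Proof.
move=> hh p dp; apply: ev0_all (bd_dg p) _ => t /eqP dt.
by apply: hh; rewrite dt.
Qed.

Lemma cobd_slice F k p : cocyc F -> invar wreath_act F ->
  cobd (slice F k) p =
  if k is k'.+1 then slice F k' p + flip (slice F k') p else 0.
Proof.
move=> zF IF; apply: eqF2; rewrite addrC -[RHS](zF ((k, false), p)) cobd_tens.
congr (_ + _); rewrite cobd_C2; case: k => // k.
by rewrite (slice_swap _ _ IF).
Qed.

(** The cochain that is the sum over k of the t^k (f_k (x) f_k). *)
Definition squares (f : nat -> X -> 'F_2) : wreath_cplx -> 'F_2 :=
  fun p => square (f p.1.1) p.2.

Lemma square_tw (f : X -> 'F_2) b (q : XX) : square f (tw b q) = square f q.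
Proof. by case: b => //; rewrite /square /= mulrC. Qed.

Lemma square_homog i (f : X -> 'F_2) : (forall c, (dg c).*2 != i -> f c = 0) ->
  homog i (square f).
Proof.
move=> hf [s t] dp; rewrite /square /=.
case: (eqVneq (dg s).*2 i) => [ds|/hf->]; last by rewrite mul0r.
case: (eqVneq (dg t).*2 i) => [dt|/hf->]; last by rewrite mulr0.
by case/eqP: dp; rewrite dg_tens; lia.
Qed.

Lemma single_square_cocyc k (f : X -> 'F_2) : cocyc f -> cocyc (single k (square f)).
Proof.
move=> zf p; rewrite cobd_single /single.
have E q : square f q + flip (square f) q = 0.
  by rewrite /flip -[swap q]/(tw true q) square_tw addF2.
by rewrite E (square_cocyc zf); do 2!case: ifP; rewrite ?addr0.
Qed.

Lemma squares_upd (f : nat -> X -> 'F_2) k f0 p : f k =1 (fun=> 0) ->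
  squares (fun J => if J == k then f0 else f J) p
  = squares f p + single k (square f0) p.
Proof.
move=> fk; rewrite /squares /single; case: eqP => [->|_]; last by rewrite addr0.
by rewrite square_tw /square !fk mul0r add0r.
Qed.

(** The coefficient of the lowest power t^k is a symmetric class, and a
    norm times t^k is a coboundary for k > 0; so it can be replaced by a square
    and removed. *)
Lemma squares_form n i k F : (i < k + n)%N -> (0 < k)%N ->
    cocyc F -> invar wreath_act F -> homog i F ->
    (forall j, (j < k)%N -> slice F j =1 (fun=> 0)) ->
  exists f, [/\ forall J, (J < k)%N -> f J =1 (fun=> 0),
    forall J, class (f J), forall J c, ((dg c).*2 + J)%N != i -> f J c = 0 &
    null wreath_act (fun p => F p + squares f p)].
Proof.
elim: n k F => [|n IH] k F lt_ik k_gt0 zF IF hF F0; case: (ltnP i k) => [lt_ik'|le_ki].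
- exists (fun _ _ => 0); split=> //; first by split=> // s; rewrite /cobd ev0.
  apply: null0 => -[[j b] q]; rewrite /squares /square mul0r addr0 sliceE //.
  by case: (ltnP j k) => [/F0->//|le_kj]; apply: (slice_high hF); apply: leq_trans le_kj.
- by move: lt_ik; rewrite addn0 ltnNge le_ki.
- exists (fun _ _ => 0); split=> //; first by split=> // s; rewrite /cobd ev0.
  apply: null0 => -[[j b] q]; rewrite /squares /square mul0r addr0 sliceE //.
  by case: (ltnP j k) => [/F0->//|le_kj]; apply: (slice_high hF); apply: leq_trans le_kj.
have zQ : cocyc (slice F k).
  move=> p; rewrite cobd_slice //; case: k k_gt0 F0 {lt_ik le_ki} => // k _ F0.
  by rewrite /flip !F0 // addr0.
have NQ : null nact (fun p => slice F k p + flip (slice F k) p).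
  exists (slice F k.+1); first exact: slice_invar.
  by move=> p; rewrite cobd_slice.
have [f0 [b [g [zf0 zb Ib Ig [hf0 hb hg EQ]]]]] :=
  symmetric_class zQ (slice_invar k IF) (slice_homog hF le_ki) NQ.
(* The coboundary of t^(k-1) b is t^k times the norm of b. *)
pose G p := single k g p + single k.-1 b p.
have IG : invar wreath_act G by apply: invarD; apply: single_invar.
pose F' p := F p + (single k (square f0) p + cobd G p).
have EG p : cobd G p = single k (cobd g) p
    + single k.+1 (fun q => g q + flip g q) p + single k (fun q => b q + flip b q) p.
  rewrite /G cobdD !cobd_single prednK //; congr (_ + _).
  by rewrite {1}/single zb; case: ifP => _; rewrite add0r.
have zF' : cocyc F'.
  apply: cocycD => //; apply: cocycD; last by move=> p; apply: cobd_cobd.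
  exact: single_square_cocyc (proj1 zf0).
have IF' : invar wreath_act F'.
  apply: invarD => //; apply: invarD; last exact: (invar_cobd (@wreath_actP gT) IG).
  by apply: single_invar; apply: square_invar; case: zf0.
have hF' : homog i F'.
  apply: homogD => //; apply: homogD.
    by apply: single_homog (square_homog hf0); rewrite subnKC.
  apply: cobd_homog => -[[j c] q]; rewrite dg_tens dg_C2 => dp; rewrite /G /single /=.
  rewrite [X in X + _](_ : _ = 0).
    rewrite add0r; case: eqP => // jk; apply: hb; rewrite dg_tw.
    by apply: contraNneq dp => ->; apply/eqP; lia.
  case: eqP => // jk; apply: hg; rewrite dg_tw.
  by apply: contraNneq dp => dq; apply/eqP; lia.
have F'0 j : (j < k.+1)%N -> slice F' j =1 (fun=> 0).
  rewrite ltnS leq_eqVlt => /orP[/eqP->|lt_jk] p; rewrite /slice /F' EG /single /=.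
    rewrite eqxx (_ : (k == k.+1) = false); last by apply/eqP; lia.
    by rewrite -[F _]/(slice F k p) EQ; F2solve.
  rewrite -[F _]/(slice F j p) F0 // (_ : (j == k) = false); last by apply/eqP; lia.
  by rewrite (_ : (j == k.+1) = false) ?addr0 //; apply/eqP; lia.
have lt_ik1 : (i < k.+1 + n)%N by rewrite addSnnS.
have [f [f_lt zf hf Nf]] := IH k.+1 F' lt_ik1 (ltn0Sn k) zF' IF' hF' F'0.
exists (fun J => if J == k then f0 else f J); split.
- move=> J lt_Jk; rewrite (_ : (J == k) = false); last by apply/eqP; lia.
  by apply: f_lt; apply: ltnW.
- by move=> J; case: eqP.
- move=> J c dc; case: eqP => [Jk|_]; last exact: hf.
  by apply: hf0; apply: contraNneq dc => ->; rewrite Jk subnK.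
have NG : null wreath_act (cobd G) by exists G.
apply: eq_null (nullD Nf NG) => p.
rewrite (squares_upd _ _ (f_lt k (ltnSn k))) /F'.
by F2solve.
Qed.

Local Notation vact := (tact C2_act (@bar_act gT)).
Local Notation diag_map := (@diag_map gT).

Lemma vactP : action_on vact.
Proof. exact: tactP C2_actP (bar_actP gT). Qed.

Lemma diag_null F : null wreath_act F -> null vact (pull diag_map F).
Proof. move=> nF; exact: pull_null (diag_map_chmap gT) (via_null _ nF). Qed.

(** Let t^m f (x) f be the term with the highest power of t, and d the
    degree of f.  On C2 x K the coefficient of t^(m+d) is f, because the
    coproducts of larger index needed by the other terms vanish in degree d.
    So f is the coboundary of some g, and then t^m f (x) f is the coboundary of
    t^m (g (x) f) + t^(m+1) (g (x) g). *)
Lemma squares_null i m (f : nat -> X -> 'F_2) : f 0%N =1 (fun=> 0) ->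
    (forall J, (m < J)%N -> f J =1 (fun=> 0)) -> (forall J, class (f J)) ->
    (forall J c, ((dg c).*2 + J)%N != i -> f J c = 0) ->
  null vact (pull diag_map (squares f)) -> null wreath_act (squares f).
Proof.
elim: m f => [|m IH] f f0 f_gt zf hf N.
  apply: null0 => -[[j b] q]; rewrite /squares /square /=.
  by case: j => [|j]; rewrite ?f0 ?f_gt // mul0r.
pose f' J := if J == m.+1 then (fun=> 0) else f J.
have f'm : f' m.+1 =1 (fun=> 0) by move=> c; rewrite /f' eqxx.
have E p : squares f p = squares f' p + single m.+1 (square (f m.+1)) p.
  rewrite -(squares_upd _ _ f'm) /squares /f'; congr (square _ _).
  by case: eqP => // ->.
suff N1 : null wreath_act (single m.+1 (square (f m.+1))).
  apply: eq_null (nullD _ N1) => [p|]; first by rewrite E.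
  apply: IH.
  - by move=> c; rewrite /f' /= f0.
  - by move=> J lt_mJ c; rewrite /f'; case: eqP => // JSm; apply: f_gt; lia.
  - by move=> J; rewrite /f'; case: eqP => // _; split=> // s; rewrite /cobd ev0.
  - by move=> J c dc; rewrite /f'; case: eqP => // _; apply: hf.
  apply: eq_null (nullD N (diag_null N1)) => p.
  by rewrite /pull -evD; apply: eq_ev => q; rewrite E; F2solve.
have [G IG NG] := N.
pose d := ((i - m.+1)./2)%N.
(* The power of t at which the square of f contributes f itself. *)
pose j := (m.+1 + d)%N.
pose ga c := if (dg c).+1 == d then G ((j, false), c) else 0.
have Iga : invar bar_act ga.
  by move=> x c; rewrite /ga (act_dg (bar_actP gT)) -[in RHS](IG (1%g, x) ((j, false), c)).
have fga : f m.+1 =1 cobd ga.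
  move=> c; case: (eqVneq (dg c) d) => [dc|dc]; last first.
    rewrite hf; last by apply: contraNneq dc => e; apply/eqP; rewrite /d; lia.
    apply/esym; apply: ev0_all (bd_dg c) _ => t /eqP dt.
    by rewrite /ga dt (negbTE dc).
  transitivity (cobd (fun t => G ((j, false), t)) c).
    2: by apply: eq_ev_all (bd_dg c) _ => t /eqP dt; rewrite /ga dt dc eqxx.
  transitivity (cobd G ((j, false), c)); last first.
    rewrite cobd_tens cobd_C2; case: (j) => [|j']; first by rewrite add0r.
    have := IG (true, 1%g) ((j', false), c).
    rewrite /tact /= (act_1 (bar_actP gT)) /C2_act /= => ->.
    by rewrite addF2 add0r.
  rewrite -NG pull_diag_map.
  rewrite (big_cat_nat (n := m.+1)) //=; last by rewrite /j; lia.
  rewrite big1_seq ?add0r; last first.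
    move=> k /andP[_]; rewrite mem_index_iota => /andP[_ lt_km].
    rewrite dcup_gt ?ev_nil // dc /j; lia.
  rewrite big_ltn; last by rewrite /j; lia.
  rewrite big1_seq ?addr0; last first.
    move=> k /andP[_]; rewrite mem_index_iota => /andP[lt_mk _].
    rewrite -[RHS](ev0 (dcup (j - k) c)); apply: eq_ev => q.
    by rewrite /squares /= /square f_gt // mul0r.
  rewrite /j addKn -dc dcup_top ev_seq1 /squares /= square_tw /square /=.
  by case: (F2_cases (f m.+1 c)) => ->; rewrite ?mul0r ?mul1r.
pose u (q : XX) := ga q.1 * cobd ga q.2.
have Iu : invar nact u.
  by move=> [x y] [s t]; rewrite /u /= Iga (invar_cobd (bar_actP gT) Iga).
exists (fun p => single m.+1 u p + single m.+2 (square ga) p).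
  by apply: invarD; apply: single_invar => //; apply: square_invar.
move=> p; rewrite cobdD !cobd_single.
have E1 q : cobd u q = square (f m.+1) q.
  case: q => s t; rewrite cobd_tens /u /= cobdMr cobdMl.
  by rewrite cobd_cobd mulr0 addr0 /square /= !fga.
have E2 q : u q + flip u q = cobd (square ga) q.
  case: q => s t; rewrite cobd_tens /u /flip /square /= cobdMr cobdMl.
  by rewrite addrC mulrC.
have E3 q : square ga q + flip (square ga) q = 0.
  by rewrite /flip -[swap q]/(tw true q) square_tw addF2.
by rewrite /single E1 E2 E3; do 3!case: ifP => _; F2solve.
Qed.
End WreathDetection.

(** After subtracting a coboundary the class is a sum of squares times positive
    powers of t, by the vanishing on the base; the vanishing on C2 x K then
    removes the squares. *)
Lemma wreath_detect (gT : finGroupType) i (x : bar (wreath gT) -> 'F_2) :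
  class x -> homog i x -> null_on (@wr_base gT) x -> null_on (@wr_diag gT) x ->
  null bar_act x.
Proof.
move=> [zx Ix] hx nb nd; have aP := @wreath_actP gT.
pose th := lift (@wreath_act gT) bar_act (@wreath_nu gT) (bar_contr (wreath gT)).
have thP : chmap (@wreath_act gT) bar_act th.
  exact (lift_chmap aP (bar_actP _) (bar_contr _) (@wreath_act_free gT)).
apply: (pull_null_inj (wreath_contr gT) (bar_contr _) aP (bar_actP _) (@bar_free _) thP zx Ix).
set F := pull th x.
have zF : cocyc F := pull_cocyc thP zx.
have IF : invar (@wreath_act gT) F := pull_invar thP Ix.
have hF : homog i F := pull_homog thP hx.
have nP := tactP (bar_actP gT) (bar_actP gT).
have N0 : null (tact bar_act bar_act) (slice F 0).
  have := null_pull (@wr_baseM gT) nP (@xact_free gT gT)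
    (comp_chmap (base_map_chmap gT) (via_chmap _ thP)) (conj zx Ix) nb.
  by apply: eq_null => p; rewrite /pull ev_lin_ext /base_map ev_seq1.
have [g [Ig Fg hg]] := null_homog nP (slice_homog hF (leq0n i)) N0.
have ISg := single_invar 0 Ig.
pose F' p := F p + cobd (single 0 g) p.
have NF' : null (@wreath_act gT) F' -> null (@wreath_act gT) F.
  by move=> /null_eqD; apply; exists (single 0 g).
have [||||||f [f0 zf hf Nf]] := @squares_form gT i.+1 i 1 F'.
- by rewrite addSn ltnS leqW // leq_addl.
- by [].
- by apply: cocycD => // p; apply: cobd_cobd.
- by apply: invarD => //; apply: invar_cobd.
- apply: homogD => //; apply: cobd_homog => -[[j b] q] dp; rewrite /single /=.
  case: eqP => // j0; apply: hg; rewrite dg_tw subn0.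
  by rewrite dg_tens j0 in dp.
- case=> // _ p; rewrite /slice /F' cobd_single /single /= addr0.
  by rewrite -[F _]/(slice F 0 p) Fg addF2.
apply: NF'; apply: (null_eqD Nf).
apply: (@squares_null gT i i f) => //; first exact: (f0 0%N).
  by move=> J lt_iJ c; apply: hf; rewrite neq_ltn ltn_addl ?orbT.
have ND : null (tact C2_act (@bar_act gT)) (pull (@diag_map gT) F).
  have fP : free_by (tact C2_act (@bar_act gT)) (fun p => (p.1.2 : C2, p.2.1)).
    exact: tact_free C2_act_free (@bar_free gT).
  have := null_pull (@wr_diagM gT) (vactP gT) fP
    (comp_chmap (diag_map_chmap gT) (via_chmap _ thP)) (conj zx Ix) nd.
  by apply: eq_null => p; rewrite /pull ev_lin_ext.
have NG : null (tact C2_act (@bar_act gT)) (pull (@diag_map gT) (cobd (single 0 g))).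
  by apply: diag_null; exists (single 0 g).
apply: eq_null (nullD (diag_null Nf) (nullD ND NG)) => p.
by rewrite /pull -!evD; apply: eq_ev => q; rewrite /F'; F2solve.
Qed.

(** * Symbols of commuting elements in degree two *)

(** The right translation by w is homotopic to the identity. *)
Lemma class_conj (gT : finGroupType) (w : gT) x : class x ->
  null bar_act (fun c => x c + resb (fun g => (w^-1 * g * w)%g) x c).
Proof.
move=> [zx Ix].
have rP : chmap bar_act bar_act (fun c => [:: bar_map (fun g : gT => (g * w)%g) c]).
  split=> [c|f c|f y c|c].
  - by rewrite /= size_map eqxx.
  - by rewrite /pull ev_seq1 /cobd bar_map_bd; apply: eq_ev => t; rewrite ev_seq1.
  - rewrite /pull !ev_seq1; congr f; rewrite /bar_map /bar_act /= mulgA.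
    by rewrite -!map_comp; congr pair; apply: eq_map => z /=; rewrite mulgA.
  - by rewrite /pull ev_seq1 /aug /= size_map.
have := chmap_homotopy (bar_actP gT) (bar_actP gT) (bar_contr gT) (@bar_free gT)
  (id_chmap bar_act) rP zx Ix.
apply: eq_null => c; rewrite /pull !ev_seq1; congr (_ + _).
rewrite -(Ix w^-1%g) /resb; congr x; rewrite /bar_map /bar_act /= mulgA.
by rewrite -map_comp; congr pair; apply: eq_map => z /=; rewrite mulgA.
Qed.

Section Symbol.
Variable gT : finGroupType.
Implicit Types (y : bar gT -> 'F_2) (g h k : gT).

(** The inhomogeneous cocycle of a class of degree two. *)
Definition inhom y g h := y (1%g, [:: g; (g * h)%g]).
(** The value of y on the product of the classes of g and h in H_1, when g
    and h commute. *)
Definition symb y g h := inhom y g h + inhom y h g.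

Lemma inhom_cocycle y g h k : class y ->
  inhom y h k + inhom y (g * h)%g k + inhom y g (h * k)%g + inhom y g h = 0.
Proof.
move=> [zy Iy]; rewrite -[RHS](zy (1%g, [:: g; g * h; g * h * k]%g)) /cobd /=.
rewrite bar_bdE /= !ev_cons ev_nil addr0 /inhom !addrA mulgA /=; congr (_ + _ + _ + _).
by rewrite -(Iy g) /bar_act /= !mulgA mulg1.
Qed.

Lemma inhom1 y g : class y -> inhom y g 1%g = inhom y 1%g 1%g.
Proof.
move=> zy; have := inhom_cocycle g 1%g 1%g zy; rewrite !mulg1 => H.
by apply: eqF2; rewrite -[RHS]H; F2solve.
Qed.
Lemma inhom_1 y g : class y -> inhom y 1%g g = inhom y 1%g 1%g.
Proof.
move=> zy; have := inhom_cocycle 1%g 1%g g zy; rewrite !mul1g => H.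
by apply: eqF2; rewrite -[RHS]H; F2solve.
Qed.

Lemma symbC y g h : symb y g h = symb y h g.
Proof. exact: addrC. Qed.
Lemma symb_diag y g : symb y g g = 0.
Proof. exact: addF2. Qed.
(** The three cocycle identities for (g, h, z), (z, g, h) and (g, z, h). *)
Lemma symbM y g h z : class y -> commute g z -> commute h z ->
  symb y (g * h)%g z = symb y g z + symb y h z.
Proof.
move=> zy gz hz; apply: eqF2; rewrite /symb.
have := congr2 +%R (congr2 +%R (inhom_cocycle g h z zy) (inhom_cocycle z g h zy))
  (inhom_cocycle g z h zy).
rewrite !addr0 gz hz => H; rewrite -[RHS]H; F2solve.
Qed.
Lemma symb_conj y g h w : class y -> commute g h ->
  symb y (w^-1 * g * w)%g (w^-1 * h * w)%g = symb y g h.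
Proof.
move=> zy gh; have [c Ic yc] := class_conj w zy.
have E u v : inhom y u v + inhom y (w^-1 * u * w)%g (w^-1 * v * w)%g =
    c (1%g, [:: v]) + c (1%g, [:: u * v]%g) + c (1%g, [:: u]).
  have := yc (1%g, [:: u; (u * v)%g]).
  rewrite /cobd bar_bdE /= !ev_cons ev_nil addr0 addrA -(Ic u (1%g, [:: v])) /bar_act.
  rewrite /= mulg1 => <-; congr (_ + y (_, [:: _ ; _])); rewrite ?mulg1 ?mulVg //.
  by rewrite !mulgA mulgK.
apply: eqF2; have := congr2 +%R (E g h) (E h g); rewrite gh /symb => H.
transitivity (c (1%g, [:: h]) + c (1%g, [:: (h * g)%g]) + c (1%g, [:: g]) +
    (c (1%g, [:: g]) + c (1%g, [:: (h * g)%g]) + c (1%g, [:: h]))); last by F2solve.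
rewrite -H; F2solve.
Qed.

Lemma symb1 y z : class y -> symb y 1%g z = 0.
Proof.
move=> zy; have := symbM zy (commute_sym (commute1 z)) (commute_sym (commute1 z)).
by rewrite mulg1 addF2.
Qed.
Lemma symbX0 y g z n : class y -> commute g z -> symb y g z = 0 ->
  symb y (g ^+ n)%g z = 0.
Proof.
move=> zy gz s0; elim: n => [|n IH]; first exact: symb1.
rewrite expgS symbM // ?s0 ?IH ?addr0 //.
by apply: commute_sym; apply: commuteX; apply: commute_sym.
Qed.
End Symbol.

Section LowDegrees.
Variables kT lT : finGroupType.
Local Notation XX := (tens (bar kT) (bar lT)).
Implicit Type f : bar (kT * lT)%type -> 'F_2.

(** One step of the recursion that defines the comparison map; it suffices
    to compute it on products of two edges, in [ez_11]. *)
Lemma ez_step f (s : XX) : dg s != 0%N -> pull (@ez kT lT) f s =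
  cobd (pull (@ez kT lT) (fun u => f (bar_act (s.1.1, s.2.1) (1%g, u.1 :: u.2))))
    (bar_act s.1.1^-1%g s.1, bar_act s.2.1^-1%g s.2).
Proof.
move=> /negPf ds; rewrite {1}/ez (pull_lift _ (xactP kT lT)) ds.
apply: eq_ev => t; rewrite /pull -/(@ez _ _); apply: eq_ev => u.
exact: ev_seq1.
Qed.

Lemma ez_00 f g h : pull (@ez kT lT) f ((g, [::]), (h, [::])) = f ((g, h), [::]).
Proof.
rewrite /ez (pull_lift _ (xactP kT lT)) /=.
congr f; rewrite /bar_act /=; congr (_, _).
by congr (_, _); rewrite /= mulg1.
Qed.

Lemma cobd_bar0 (gT : finGroupType) (f : bar gT -> 'F_2) g : cobd f (g, [::]) = 0.
Proof. exact: ev_nil. Qed.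
Lemma cobd_bar1 (gT : finGroupType) (f : bar gT -> 'F_2) g h :
  cobd f (g, [:: h]) = f (h, [::]) + f (g, [::]).
Proof. by rewrite /cobd bar_bdE /= !ev_cons ev_nil addr0. Qed.

Lemma pairM (g g' : kT) (h h' : lT) : ((g, h) * (g', h'))%g = (g * g', h * h')%g.
Proof. by []. Qed.

Lemma ez_01 f g h b : pull (@ez kT lT) f ((g, [::]), (h, [:: b])) =
  f ((g, h), [:: (g, b)]) + f ((g, h), [:: (g, h)]).
Proof.
rewrite ez_step // cobd_tens.
rewrite [bar_act _ _ in X in X + _]/bar_act cobd_bar0 add0r.
rewrite /bar_act /= cobd_bar1 !ez_00 /=.
by rewrite !pairM !mulg1 !mulVg mulg1 mulKVg !mulg1.
Qed.

Lemma ez_10 f g h a : pull (@ez kT lT) f ((g, [:: a]), (h, [::])) =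
  f ((g, h), [:: (a, h)]) + f ((g, h), [:: (g, h)]).
Proof.
rewrite ez_step // cobd_tens /bar_act /= cobd_bar0 addr0 cobd_bar1 !ez_00 /=.
by rewrite !pairM !mulg1 !mulVg mulg1 mulKVg !mulg1.
Qed.

Lemma ez_11 (y : bar (kT * lT)%type -> 'F_2) a b : class y ->
  pull (@ez kT lT) y ((1%g, [:: a]), (1%g, [:: b])) = symb y (a, 1%g) (1%g, b).
Proof.
move=> zy; rewrite ez_step // cobd_tens /bar_act /= !invg1 !mul1g.
rewrite !cobd_bar1 !ez_01 !ez_10 /= !mulg1 !mul1g.
have i1 g : inhom y g 1%g = y (1%g, [:: g; g]) by rewrite /inhom mulg1.
have i2 g : inhom y 1%g g = y (1%g, [:: 1%g; g]) by rewrite /inhom mul1g.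
have := inhom1 (a, 1%g) zy; have := inhom1 (1%g, b) zy.
have := inhom_1 (a, 1%g) zy; have := inhom_1 (1%g, b) zy.
rewrite !i1 !i2 /symb /inhom.
have e1 : (1%g, 1%g) = 1%g :> kT * lT by [].
have H (A B Y : 'F_2) : A + Y + (Y + Y) + (B + Y + (Y + Y)) = A + B by F2solve.
move=> E1 E2 E3 E4; rewrite !pairM !mulg1 !mul1g !e1 E1 E2 E3 E4; exact: H.
Qed.

Lemma ez_symb0 (y : bar (kT * lT)%type -> 'F_2) u v : class y ->
  (forall a b, symb y (a, 1%g) (1%g, b) = 0) -> cyc 1 u -> cyc 1 v ->
  ev (fun s => ev (fun t => pull (@ez kT lT) y (s, t)) v) u = 0.
Proof.
move=> zy y0 [du _] [dv _].
have IF := pull_invar (ez_chmap kT lT) (proj2 zy).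
apply: ev0_all du _ => -[g [|g' [|? ?]]] // _.
apply: ev0_all dv _ => -[h [|h' [|? ?]]] // _.
rewrite -(IF (g^-1, h^-1)%g) /tact /bar_act /= !mulVg ez_11 //.
Qed.
End LowDegrees.

(** * Slant products *)

Lemma null_cycle (gT : finGroupType) (f : bar gT -> 'F_2) j v :
  null bar_act f -> cyc j v -> ev f v = 0.
Proof. by move=> [g Ig fg] [_ vP]; rewrite (eq_ev v fg) vP. Qed.

Lemma via_homotopy (hT gT : finGroupType) (al : hT -> gT) (P : cplx)
    (a : hT -> P -> P) nu phi psi x :
  {morph al : x y / (x * y)%g} -> action_on a -> free_by a nu ->
  chmap a (via al bar_act) phi -> chmap a (via al bar_act) psi -> class x ->
  null a (fun s => pull phi x s + pull psi x s).
Proof.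
move=> alM aP nuP phiP psiP [zx Ix].
have vP := viaP alM (bar_actP gT).
exact (chmap_homotopy aP vP (bar_contr gT) nuP phiP psiP zx (via_invar al Ix)).
Qed.

Lemma eq_chmap (P Q : cplx) (hT : finGroupType) (a : hT -> P -> P) (b c : hT -> Q -> Q) phi :
  (forall y s, b y s = c y s) -> chmap a b phi -> chmap a c phi.
Proof.
move=> bc [H1 H2 H3 H4]; split=> // f y s; rewrite H3.
by apply: eq_ev => t; rewrite bc.
Qed.

Section Slants.
Variables mT aT gT : finGroupType.
Variable be : mT * aT -> gT.
Hypothesis beM : {morph be : x y / (x * y)%g}.
Local Notation act := (tact (@bar_act mT) (@bar_act aT)).
Implicit Types (x : bar gT -> 'F_2).

Definition slant_along x v : bar mT -> 'F_2 := slant (pull (@ez mT aT) (resb be x)) v.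

Definition ez_along p := map (bar_map be) (@ez mT aT p).
Lemma ez_along_chmap : chmap act (via be bar_act) ez_along.
Proof.
have := comp_chmap (ez_chmap mT aT) (bar_map_chmap beM).
case=> H1 H2 H3 H4.
have E p : lin_ext (fun c => [:: bar_map be c]) (@ez mT aT p) = ez_along p.
  by rewrite /ez_along /lin_ext; elim: (ez p) => //= c l ->.
split=> [p|f p|f x p|p]; rewrite /pull -?E //.
- by rewrite -/(pull _ _ _) [LHS]H2; apply: eq_cobd => q; rewrite -E.
- exact: H3.
- exact: H4.
Qed.

Lemma pull_ez_along x p : pull ez_along x p = pull (@ez mT aT) (resb be x) p.
Proof. by rewrite /pull ev_map. Qed.

Lemma slant_alongE x v : slant_along x v =1 slant (pull ez_along x) v.
Proof. by move=> s; apply: eq_ev => t; rewrite pull_ez_along. Qed.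

Lemma slant_along_class x j v : class x -> cyc j v -> class (slant_along x v).
Proof.
move=> zx vP; have [zy Iy] := resb_class beM zx; have ezP := ez_chmap mT aT.
have zF := pull_cocyc ezP zy; have IF := pull_invar ezP Iy.
split; first exact: (slant_cocyc (bar_actP mT) IF zF vP).
exact: slant_invar.
Qed.

Lemma ez_along_homog x i : homog i x -> homog i (pull ez_along x).
Proof. exact: pull_homog ez_along_chmap. Qed.

Lemma slant_along_homog x i j v : homog i x -> cyc j v -> (j <= i)%N -> homog (i - j) (slant_along x v).
Proof.
move=> hx vP le_ji s ds; rewrite slant_alongE.
exact: (slant_homog (ez_along_homog hx) vP le_ji ds).
Qed.

Lemma slant_along_high x i j v : homog i x -> cyc j v -> (i < j)%N -> slant_along x v =1 (fun=> 0).
Proof.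
by move=> hx vP lt_ij s; rewrite slant_alongE (slant_high (ez_along_homog hx) vP lt_ij).
Qed.

Lemma slant_along_null x j v : cyc j v -> null_on be x -> null bar_act (slant_along x v).
Proof.
move=> vP nx; apply: (slant_null (bar_actP mT) vP).
exact: (pull_null (ez_chmap mT aT) nx).
Qed.

Lemma slant_along_detects x : class x -> (forall j v, cyc j v -> null bar_act (slant_along x v)) ->
  null_on be x.
Proof.
move=> zx nx; have zy := resb_class beM zx.
apply: ez_null => //; have ezP := ez_chmap mT aT.
apply: (kunneth (bar_actP mT)); first exact: pull_cocyc ezP (proj1 zy).
  exact: pull_invar ezP (proj2 zy).
exact: nx.
Qed.

(** Each cell of degree 0 is a translate of the base point, so the slant product
    is a multiple of the restriction to the first factor. *)
Lemma slant_along_deg0 x v : class x -> cyc 0 v ->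
  null_on (fun m => be (m, 1%g)) x -> null bar_act (slant_along x v).
Proof.
move=> zx [dv _] nx.
have iM : {morph (fun m : mT => (m, 1%g : aT)) : x y / (x * y)%g}.
  by move=> m m'; rewrite -[RHS]/(_, (1 * 1)%g) mulg1.
pose phi (s : bar mT) : seq (tens (bar mT) (bar aT)) := [:: (s, (1%g, [::]))].
have bM : {morph (fun m : mT => be (m, 1%g)) : x y / (x * y)%g}.
  by move=> m m'; rewrite iM beM.
have phiP : chmap bar_act (via (fun m : mT => (m, 1%g : aT)) act) phi.
  split=> [s|f s|f y s|s]; rewrite /phi /pull ?ev_seq1 /=.
  - by rewrite /tens_dg /= addn0 eqxx.
  - rewrite cobd_tens [X in _ + X]ev_nil addr0.
    by apply: eq_ev => t; rewrite ev_seq1.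
  - congr f; rewrite /via /tact /=; congr (_, _).
    by rewrite /bar_act /= mulg1.
  - by rewrite aug_tens /= mulr1.
have N := null_pull bM (bar_actP mT) (@bar_free mT)
  (comp_chmap phiP (via_chmap (fun m => (m, 1%g)) ez_along_chmap)) zx nx.
have IF := pull_invar ez_along_chmap (via_invar be (proj2 zx)).
have E c : all (fun t => dg t == 0%N) v ->
    slant (pull ez_along x) v c = pull phi (pull ez_along x) c *+ size v.
  rewrite /slant; elim: (v) => [|t l IH] /=; first by rewrite ev_nil.
  move=> /andP[t0 /IH {}IH]; rewrite ev_cons IH mulrS; congr (_ + _).
  rewrite /pull ev_seq1 -[RHS](IF (1%g, t.1)) /tact /= (act_1 (bar_actP mT)).
  by case: t t0 => g [] // _; rewrite /bar_act /= mulg1.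
have N' : null bar_act (pull phi (pull ez_along x)).
  by apply: eq_null N => s; rewrite /pull ev_lin_ext.
apply: (@eq_null _ _ _ (fun c => pull phi (pull ez_along x) c *+ size v)).
  by move=> c; rewrite slant_alongE E.
elim: (size v) => [|n IH]; first by apply: null0 => c; rewrite mulr0n.
by apply: eq_null (nullD N' IH) => c; rewrite mulrS.
Qed.
End Slants.

Section SlantNaturality.
Variables mT aT gT : finGroupType.

Lemma tmap_barm_chmap (m' : finGroupType) (ga : m' -> mT) :
  {morph ga : x y / (x * y)%g} ->
  chmap (tact (@bar_act m') (@bar_act aT))
    (via (fun p : m' * aT => (ga p.1, p.2)) (tact bar_act bar_act))
    (tmap (fun c => [:: bar_map ga c]) (fun c => [:: c])).
Proof. by move=> gaM; exact (tmap_chmap (bar_map_chmap gaM) (id_chmap bar_act)). Qed.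

Lemma slant_along_res (m' : finGroupType) (be : mT * aT -> gT) (ga : m' -> mT) x j v :
  {morph be : x y / (x * y)%g} -> {morph ga : x y / (x * y)%g} ->
  class x -> cyc j v ->
  null bar_act (fun c => resb ga (slant_along be x v) c + slant_along (fun p => be (ga p.1, p.2)) x v c).
Proof.
move=> beM gaM zx vP.
have bgM : {morph (fun p : m' * aT => be (ga p.1, p.2)) : x y / (x * y)%g}.
  by move=> p q; rewrite -beM; congr be; congr (_, _); exact: gaM.
have c1 := comp_chmap (tmap_barm_chmap gaM)
  (via_chmap (fun p : m' * aT => (ga p.1, p.2)) (ez_along_chmap beM)).
have N := via_homotopy bgM (xactP _ _) (@xact_free _ _) c1 (ez_along_chmap bgM) zx.
apply: eq_null (slant_null (bar_actP _) vP N) => s.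
rewrite /slant evD /resb !slant_alongE; congr (_ + _); apply: eq_ev => t.
transitivity (pull (tmap (fun c => [:: bar_map ga c]) (fun c => [:: c]))
  (pull (ez_along be) x) (s, t)); first exact: ev_lin_ext.
by rewrite pull_tmap /pull !ev_seq1.
Qed.

Lemma slant_along_conj (be be' : mT * aT -> gT) (w : gT) x j v :
  {morph be : x y / (x * y)%g} -> {morph be' : x y / (x * y)%g} ->
  (forall p, be' p = w^-1 * be p * w)%g ->
  class x -> cyc j v -> null bar_act (slant_along be x v) -> null bar_act (slant_along be' x v).
Proof.
move=> beM be'M be'E zx vP.
apply: null_eqD.
have N := class_conj w zx.
have := slant_along_null vP (null_resb beM N).
apply: eq_null => s; rewrite addrC /slant_along /slant -evD; apply: eq_ev => t.
rewrite /pull -evD; apply: eq_ev => q; rewrite /resb /=; congr (_ + x _).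
by rewrite /bar_map -map_comp /= be'E; congr (_, _); apply: eq_map => p /=; rewrite be'E.
Qed.
End SlantNaturality.

Section DoubleSlants.
Variables mT nT aT gT : finGroupType.
Variables (be : mT * aT -> gT) (ga : nT * aT -> mT) (w : gT).
Hypotheses (beM : {morph be : x y / (x * y)%g}) (gaM : {morph ga : x y / (x * y)%g}).
Local Notation X2 := (tens (bar nT) (bar aT)).
Local Notation X3 := (tens X2 (bar aT)).
Local Notation act3 := (tact (tact (@bar_act nT) (@bar_act aT)) (@bar_act aT)).

Definition stack (p : (nT * aT) * aT) : gT := be (ga p.1, p.2).
Lemma stackM : {morph stack : x y / (x * y)%g}.
Proof. by move=> p q; rewrite /stack -beM; congr be; congr (_, _); exact: gaM. Qed.

Definition ez_stack (p : X3) : seq (bar gT) :=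
  lin_ext (ez_along be) (tmap (ez_along ga) (fun c => [:: c]) p).
Lemma ez_stack_chmap : chmap act3 (via stack bar_act) ez_stack.
Proof.
have c1 : chmap act3 (via (fun p : (nT * aT) * aT => (ga p.1, p.2))
    (tact (@bar_act mT) (@bar_act aT))) (tmap (ez_along ga) (fun c => [:: c])).
  exact (tmap_chmap (ez_along_chmap gaM) (id_chmap bar_act)).
exact (comp_chmap c1 (via_chmap _ (ez_along_chmap beM))).
Qed.

Lemma act3P : action_on act3.
Proof. exact: tactP (xactP nT aT) (bar_actP aT). Qed.
Lemma act3_free : free_by act3 (fun p => ((p.1.1.1, p.1.2.1), p.2.1)).
Proof. exact: tact_free (@xact_free nT aT) (@bar_free aT). Qed.

Lemma slant_along_twice x u v : slant_along ga (slant_along be x u) v =1 slant (slant (pull ez_stack x) u) v.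
Proof.
move=> s; rewrite slant_alongE; apply: eq_ev => t.
transitivity (ev (fun t' => pull (ez_along ga) (fun r => pull (ez_along be) x (r, t')) (s, t)) u).
  rewrite /pull ev_exch; apply: eq_ev => r; exact: slant_alongE.
apply: eq_ev => t'.
transitivity (pull (tmap (ez_along ga) (fun c => [:: c])) (pull (ez_along be) x) ((s, t), t')).
  by rewrite pull_tmap /pull; apply: eq_ev => r; rewrite ev_seq1.
by symmetry; exact: ev_lin_ext.
Qed.

Lemma slant2_null (F : X3 -> 'F_2) i j u v : cyc i u -> cyc j v -> null act3 F ->
  null bar_act (slant (slant F u) v).
Proof.
move=> uP vP nF; apply: (slant_null (bar_actP nT) vP).
exact: (slant_null (xactP nT aT) uP).
Qed.

(** Slant products commute, because the flip of the two factors
    aT followed by conjugation by w is a chain map over the same embedding. *)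
Lemma slant_along_swap x i j u v : class x -> cyc i u -> cyc j v ->
  (forall n a b, stack ((n, b), a) = w^-1 * stack ((n, a), b) * w)%g ->
  null bar_act (slant_along ga (slant_along be x v) u) -> null bar_act (slant_along ga (slant_along be x u) v).
Proof.
move=> zx uP vP stackE; apply: null_eqD.
pose sg (p : X3) : X3 := ((p.1.1, p.2), p.1.2).
pose cw g := (w^-1 * g * w)%g.
have cwM : {morph cw : g h / (g * h)%g}.
  by move=> g h; rewrite /cw !mulgA mulgK.
have sgP : chmap act3 (via (fun p : (nT * aT) * aT => ((p.1.1, p.2), p.1.2)) act3)
    (fun p => [:: sg p]).
  split=> [[[s t] t']|f [[s t] t']|f y [[s t] t']|[[s t] t']]; rewrite /pull ?ev_seq1 //=.
  - by rewrite andbT /tens_dg /= addnAC.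
  - rewrite !cobd_tens /= addrAC.
    by congr (_ + _ + _); apply: eq_ev => q; rewrite ev_seq1.
  - by rewrite !aug_tens /= mulrAC.
have c0 := comp_chmap sgP (via_chmap _ ez_stack_chmap).
have c1 := comp_chmap c0 (via_chmap _ (via_chmap stack (bar_map_chmap cwM))).
have c2 := eq_chmap (c := via stack bar_act) _ c1.
have /c2 {c1 c2} c1 : forall (y : (nT * aT) * aT) s,
    via (fun p : (nT * aT) * aT => ((p.1.1, p.2), p.1.2)) (via stack (via cw bar_act)) y s
    = via stack bar_act y s.
  by case=> [[n a] b] s; rewrite /via /=; congr (bar_act _ s); exact: esym (stackE _ _ _).
have N1 := via_homotopy stackM act3P act3_free ez_stack_chmap c1 zx.
have N2 : null act3 (fun p => pull ez_stack x (sg p) + pull ez_stack (resb cw x) (sg p)).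
  have Nx := class_conj w zx.
  have := pull_null c0 (via_null _ (via_null stack Nx)).
  apply: eq_null => p; rewrite {1}/pull ev_lin_ext ev_seq1 -/(pull _ _ _).
  by rewrite /pull -evD.
have N : null act3 (fun p => pull ez_stack x p + pull ez_stack x (sg p)).
  apply: eq_null (nullD N1 N2) => p.
  have -> : pull (fun s => lin_ext (fun c => [:: bar_map cw c]) (lin_ext ez_stack [:: sg s])) x p
      = pull ez_stack (resb cw x) (sg p).
    transitivity (ev (fun c => ev x [:: bar_map cw c]) (lin_ext ez_stack [:: sg p])); first exact: ev_lin_ext.
    by rewrite [LHS]ev_lin_ext ev_seq1; apply: eq_ev => q; rewrite ev_seq1.
  by F2solve.
apply: eq_null (slant2_null uP vP N) => s; rewrite !slant_along_twice.
have E : slant (slant (pull ez_stack x) v) u s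
    = ev (fun t => ev (fun t' => pull ez_stack x ((s, t'), t)) u) v.
  exact: ev_exch.
rewrite E {1 2}/slant -evD; apply: eq_ev => t.
by rewrite /slant -evD.
Qed.
End DoubleSlants.

Section SymbolSlants.
Variables mT nT aT kT gT : finGroupType.
Variables (be : mT * aT -> gT) (ga : nT * aT -> mT).
Variables (ta : nT * kT -> gT) (de : aT * aT -> kT).
Hypotheses (beM : {morph be : x y / (x * y)%g}) (gaM : {morph ga : x y / (x * y)%g}).
Hypotheses (taM : {morph ta : x y / (x * y)%g}) (deM : {morph de : x y / (x * y)%g}).
Hypothesis stackE : forall n a b, stack be ga ((n, a), b) = ta (n, de (a, b)).
Local Notation X2 := (tens (bar nT) (bar aT)).
Local Notation X3 := (tens X2 (bar aT)).
Local Notation act3 := (tact (tact (@bar_act nT) (@bar_act aT)) (@bar_act aT)).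
Implicit Type x : bar gT -> 'F_2.

Definition slantl x (w : seq (bar nT)) (r : bar kT) :=
  ev (fun s => pull (ez_along ta) x (s, r)) w.

Lemma slantl_class x j w : class x -> cyc j w -> class (slantl x w).
Proof.
move=> [zx Ix] [_ wP].
have zG := pull_cocyc (ez_along_chmap taM) zx.
have IG := pull_invar (ez_along_chmap taM) (via_invar ta Ix).
split=> [r|y r]; last first.
  by apply: eq_ev => s; apply: (tens_invar2 (bar_actP nT) s IG).
rewrite /cobd ev_exch -(wP _ (tens_invar1 r IG)); apply: eq_ev => s.
by apply: eqF2; rewrite addrC -(zG (s, r)) cobd_tens.
Qed.

Lemma symb_resb (y : bar kT -> 'F_2) g h :
  symb (resb de y) g h = symb y (de g) (de h).
Proof. by rewrite /symb /inhom /resb /bar_map /= (morph1 deM) !deM. Qed.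

(** The comparison map for the same embedding, with the two factors aT
    combined first; homotopic to [ez_stack]. *)
Definition ez_split (p : X3) : seq (bar gT) :=
  lin_ext (ez_along ta) (tmap (fun c => [:: c]) (ez_along de) (p.1.1, (p.1.2, p.2))).

Lemma ez_split_chmap : chmap act3 (via (stack be ga) bar_act) ez_split.
Proof.
pose asc (p : X3) : seq (tens (bar nT) (tens (bar aT) (bar aT))) :=
  [:: (p.1.1, (p.1.2, p.2))].
have ascP : chmap act3 (via (fun p : (nT * aT) * aT => (p.1.1, (p.1.2, p.2)))
    (tact bar_act (tact bar_act bar_act))) asc.
  split=> [[[s t] t']|f [[s t] t']|f y [[s t] t']|[[s t] t']];
    rewrite /asc /pull ?ev_seq1 //=.
  - by rewrite andbT /tens_dg /= addnA.
  - rewrite !cobd_tens /= addrA.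
    by congr (_ + _ + _); apply: eq_ev => q; rewrite ev_seq1.
  - by rewrite !aug_tens /= mulrA.
have c1 := tmap_chmap (id_chmap (@bar_act nT)) (ez_along_chmap deM).
have c2 : chmap (tact bar_act (tact bar_act bar_act))
    (via (fun q : nT * (aT * aT) => (q.1, de q.2)) (tact bar_act bar_act))
    (tmap (fun c : bar nT => [:: c]) (ez_along de)) := c1.
have c3 := comp_chmap c2 (via_chmap _ (ez_along_chmap taM)).
have c4 := comp_chmap ascP (via_chmap _ c3).
have c5 := eq_chmap (c := via (stack be ga) bar_act) _ c4.
have /c5 [H1 H2 H3 H4] : forall (y : (nT * aT) * aT) s,
    via (fun p : (nT * aT) * aT => (p.1.1, (p.1.2, p.2)))
     (via (fun q : nT * (aT * aT) => (q.1, de q.2)) (via ta bar_act)) y s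
    = via (stack be ga) bar_act y s.
  by case=> [[n a] b] s; rewrite /via /=; congr (bar_act _ s); exact: esym (stackE _ _ _).
have E p : lin_ext (fun s => lin_ext (ez_along ta) (tmap (fun c => [:: c]) (ez_along de) s)) (asc p) = ez_split p.
  exact: cats0.
split=> [p|f p|f x p|p]; rewrite /pull -?E //.
- by rewrite -/(pull _ _ _) [LHS]H2; apply: eq_cobd => q; rewrite -E.
- exact: H3.
- exact: H4.
Qed.

(** The double slant product is evaluated on a cycle w of nT.  If
    the two factors aT are combined first, this value is that of the class
    obtained by slanting x with w, on a product of two classes of degree 1. *)
Lemma slant_along_symbol x u v : class x -> cyc 1 u -> cyc 1 v ->
  (forall y, class y -> forall a b, symb y (de (a, 1%g)) (de (1%g, b)) = 0) ->
  null bar_act (slant_along ga (slant_along be x u) v).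
Proof.
move=> zx uP vP y0; apply: null_dual.
  exact: (slant_along_class gaM (slant_along_class beM zx uP) vP).
move=> j w wP; have stackM' := stackM beM gaM.
have N := via_homotopy stackM' (@act3P nT aT) (@act3_free nT aT) (ez_stack_chmap beM gaM)
  ez_split_chmap zx.
have := null_cycle (slant2_null uP vP N) wP.
have -> : ev (slant (slant (fun p => pull (ez_stack be ga) x p + pull ez_split x p) u) v) w
   = ev (slant_along ga (slant_along be x u) v) w + ev (slant (slant (pull ez_split x) u) v) w.
  rewrite -evD; apply: eq_ev => s; rewrite slant_along_twice {1 2}/slant -evD.
  by apply: eq_ev => t; rewrite /slant -evD.
move=> /eqF2->.
have zy := slantl_class zx wP; set y := slantl x w in zy.
have zyr := resb_class deM zy.
rewrite -[RHS](ez_symb0 zyr _ vP uP); last by move=> a b; rewrite symb_resb y0.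
rewrite /slant ev_exch; apply: eq_ev => t; rewrite ev_exch; apply: eq_ev => t'.
transitivity (ev (fun s => ev (fun q => pull (ez_along ta) x (s, bar_map de q)) (ez (t, t'))) w).
  apply: eq_ev => s.
  transitivity (pull (tmap (fun c => [:: c]) (ez_along de)) (pull (ez_along ta) x) (s, (t, t'))).
    exact: ev_lin_ext.
  by rewrite pull_tmap {1}/pull ev_seq1 /pull ev_map.
by rewrite ev_exch.
Qed.
End SymbolSlants.

(** * Two-adic valuations of the orders of general linear groups *)

Section Valuations.
Local Open Scope nat_scope.

Lemma logn2_odd n : odd n -> logn 2 n = 0.
Proof. by move=> on; rewrite lognE dvdn2 on andbF. Qed.

Lemma logn2_double n : 0 < n -> logn 2 n.*2 = (logn 2 n).+1.
Proof. by move=> n_gt0; rewrite -mul2n lognM // lognE. Qed.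

Lemma logn2_fact_double n : logn 2 (n.*2)`! = n + logn 2 n`!.
Proof.
elim: n => // n IH; rewrite doubleS !factS !lognM ?fact_gt0 ?muln_gt0 ?fact_gt0 //.
rewrite IH -doubleS logn2_double // (logn2_odd (n := n.*2.+1)) /= ?odd_double //.
by lia.
Qed.

Lemma logn2_fact_doubleS n : logn 2 (n.*2.+1)`! = logn 2 (n.*2)`!.
Proof.
by rewrite factS lognM ?fact_gt0 // logn2_odd //= odd_double.
Qed.

(** Adding 2^s and an even multiple of 2^s involves no carry in base 2. *)
Lemma logn2_fact_split s t :
  logn 2 (2 ^ s * t.*2.+1)`! = logn 2 (2 ^ s)`! + logn 2 (2 ^ s * t.*2)`!.
Proof.
elim: s => [|s IH]; first by rewrite expn0 !mul1n logn2_fact_doubleS.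
by rewrite expnS -!mulnA !mul2n !logn2_fact_double IH; lia.
Qed.

Lemma logn2_fact_expn s : (logn 2 (2 ^ s)`!).+1 = 2 ^ s.
Proof.
elim: s => [|s IH]; first by rewrite expn0 logn1.
by rewrite expnS mul2n logn2_fact_double -addnS IH addnn.
Qed.

Section Order.
Variable q : nat.
Hypotheses (q_gt1 : 1 < q) (q4 : q %% 4 = 1).

Lemma q_odd : odd q.
Proof. by rewrite (divn_eq q 4) q4 oddD oddM /= andbF. Qed.

(** Doubling i multiplies q^i - 1 by q^i + 1, which is 2 mod 4; odd
    exponents contribute an odd factor. *)
Lemma logn2_pred_expn i : 0 < i -> logn 2 (q ^ i - 1) = logn 2 (q - 1) + logn 2 i.
Proof.
have [k] := ubnP i; elim: k i => // k IH i; rewrite ltnS => le_ik i_gt0.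
have q_gt0 : 0 < q by apply: ltnW.
have qX_gt1 j : 0 < j -> 0 < q ^ j - 1.
  by move=> j_gt0; rewrite subn_gt0 -[1](expn0 q) ltn_exp2l.
rewrite -(odd_double_half i) in le_ik i_gt0 *; case oi: (odd i) le_ik i_gt0 => /=.
  rewrite add1n => _ _; rewrite (logn2_odd (n := _.+1)) /= ?odd_double // addn0.
  have -> : q ^ (i./2).*2.+1 - 1 = (q - 1) * \sum_(j < (i./2).*2.+1) q ^ j.
    by rewrite !subn1 predn_exp.
  rewrite lognM ?subn_gt0 //; last by rewrite big_ord_recl expn0.
  rewrite (logn2_odd (n := \sum_(_ < _) _)) ?addn0 //.
  have H n : odd (\sum_(j < n) q ^ j) = odd n.
    elim: n => [|n IHn]; first by rewrite big_ord0.
    by rewrite big_ord_recr oddD IHn oddX q_odd orbT addbT.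
  by rewrite H /= odd_double.
rewrite add0n double_gt0 => le_ik h_gt0.
have -> : q ^ (i./2).*2 - 1 = (q ^ i./2 - 1) * (q ^ i./2 + 1).
  by rewrite -muln2 expnM -(subn_sqr _ 1) exp1n.
rewrite lognM ?qX_gt1 ?addn1 // IH ?logn2_double //; last by lia.
suff -> : logn 2 (q ^ i./2).+1 = 1 by rewrite addn1 addnS.
have : (q ^ i./2) %% 4 = 1 by rewrite -modnXm q4 exp1n.
move: (q ^ i./2) => r r4; rewrite (divn_eq r 4) r4.
have -> : (r %/ 4 * 4 + 1).+1 = (r %/ 4 * 2).+1.*2 by lia.
by rewrite logn2_double // logn2_odd //= oddM andbF.
Qed.
End Order.
End Valuations.

Section GLOrder.
Variable F : finFieldType.

Lemma GL0_eq (A B : GL F 0) : A = B.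
Proof. by apply: val_inj; apply/matrixP => -[]. Qed.

Lemma card_GLn n :
  #|{: GL F n}| = (#|F| ^ 'C(n, 2) * \prod_(1 <= i < n.+1) (#|F| ^ i - 1))%N.
Proof.
case: n => [|n].
  rewrite big_geq // muln1 bin0n /= expn0.
  by apply: (@eq_card1 _ (1%g : GL F 0)) => A; rewrite !inE (GL0_eq A 1%g) eqxx.
rewrite -card_GL // cardsT !card_sub.
by apply: eq_card => A; rewrite !inE.
Qed.

Hypothesis q4 : (#|F| %% 4 = 1)%N.

Lemma logn2_card_GL n :
  (logn 2 #|{: GL F n}| = n * logn 2 (#|F| - 1) + logn 2 n`!)%N.
Proof.
have q_gt1 := card_finNzRing_gt1 F.
have q_gt0 : (0 < #|F|)%N by apply: ltnW.
have qX_gt0 i : (0 < i)%N -> (0 < #|F| ^ i - 1)%N.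
  by move=> i_gt0; rewrite subn_gt0 -[1%N](expn0 #|F|) ltn_exp2l.
have P_gt0 k : (0 < \prod_(1 <= i < k.+1) (#|F| ^ i - 1))%N.
  by rewrite big_nat; apply: prodn_cond_gt0 => i /andP[i_gt0 _]; apply: qX_gt0.
rewrite card_GLn lognM ?expn_gt0 ?q_gt0 // lognX logn2_odd ?q_odd // muln0 add0n.
elim: n => [|n IH]; first by rewrite big_geq // logn1.
rewrite big_nat_recr //= lognM ?qX_gt0 // IH logn2_pred_expn // factS.
rewrite lognM ?fact_gt0 // mulSn.
rewrite addnACA [(n * _ + _)%N]addnC; congr (_ + _)%N.
exact: addnC.
Qed.
End GLOrder.

(** * Block embeddings of general linear groups *)

Section Entries.
Variable F : finFieldType.

(** Entries indexed by natural numbers, zero outside of the matrix: equalities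
    between block matrices become arithmetic on indices, without casts. *)
Definition ent n (M : 'M[F]_n) (i j : nat) : F :=
  if (insub i, insub j) is (Some i', Some j') then M i' j' else 0.

Lemma entE n (M : 'M[F]_n) (i j : 'I_n) : ent M i j = M i j.
Proof. by rewrite /ent !valK. Qed.

Lemma ent_out n (M : 'M[F]_n) i j : ~~ ((i < n) && (j < n))%N -> ent M i j = 0.
Proof.
by rewrite /ent; case: insubP => [i' -> _|_ //]; case: insubP => [j' -> _|].
Qed.

Lemma ent_inj n (M N : 'M[F]_n) : ent M =2 ent N -> M = N.
Proof. by move=> MN; apply/matrixP => i j; rewrite -!entE MN. Qed.

Lemma ent_castmx m n (e : m = n) (M : 'M[F]_m) : ent (castmx (e, e) M) = ent M.
Proof. by case: n / e; rewrite castmx_id. Qed.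

Lemma ent_block a b (A : 'M[F]_a) (B : 'M[F]_b) i j :
  ent (block_mx A 0 0 B) i j =
  if ((i < a) && (j < a))%N then ent A i j else
  if ((a <= i) && (a <= j))%N then ent B (i - a) (j - a) else 0.
Proof.
case: (boolP ((i < a + b) && (j < a + b))%N) => [/andP[lt_i lt_j]|out]; last first.
  rewrite ent_out //; case: ifP => [/andP[? ?]|_].
    by case/negP: out; rewrite !ltn_addr.
  case: ifP => // /andP[le_ai le_aj]; rewrite ent_out //; apply: contra out.
  by rewrite !ltn_subLR.
rewrite -[i]/(val (Ordinal lt_i)) -[j]/(val (Ordinal lt_j)) entE.
move: (Ordinal lt_i) (Ordinal lt_j) => {lt_i lt_j} i' j'.
rewrite -(splitK i') -(splitK j').
case: (split i') => i1; case: (split j') => j1; rewrite /unsplit.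
- by rewrite block_mxEul /= !ltn_ord entE.
- by rewrite block_mxEur mxE /= ltn_ord ltnNge leq_addr /= leqNgt ltn_ord.
- by rewrite block_mxEdl mxE /= ltn_ord ltnNge leq_addr /= (leqNgt _ j1) ltn_ord.
- by rewrite block_mxEdr /= !ltnNge !leq_addr /= !addKn entE.
Qed.

Lemma ent_one n i j : ent (1%:M : 'M[F]_n) i j = ((i == j) && (i < n)%N)%:R.
Proof.
case: (boolP ((i < n) && (j < n))%N) => [/andP[lt_i lt_j]|out].
  by rewrite -{1}[i]/(val (Ordinal lt_i)) -{1}[j]/(val (Ordinal lt_j)) entE mxE lt_i andbT.
rewrite ent_out //; case: eqP => //= ij; move: out; rewrite -ij andbb.
by move=> /negbTE->.
Qed.
End Entries.

Section Blocks.
Variable F : finFieldType.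

Section OneBlock.
Variables (a b n : nat) (e : (a + b)%N = n).

Definition blk_mx (A : 'M[F]_a) (B : 'M[F]_b) : 'M[F]_n :=
  castmx (e, e) (block_mx A 0 0 B).

Lemma blk_unit (p : GL F a * GL F b) : blk_mx (val p.1) (val p.2) \in unitmx.
Proof.
by rewrite castmx_unit unitmxE det_ublock unitrM -!unitmxE (valP p.1) (valP p.2).
Qed.
Definition blk (p : GL F a * GL F b) : GL F n := MkGL (blk_unit p).

Arguments blk : simpl never.

Lemma blkM : {morph blk : x y / (x * y)%g}.
Proof.
move=> [A B] [A' B']; apply: val_inj; rewrite /= /blk_mx -castmxM mulmx_block.
by rewrite !mulmx0 !mul0mx !addr0 !add0r.
Qed.

Lemma GL_ent_inj (A B : GL F n) : ent (GL_mx A) =2 ent (GL_mx B) -> A = B.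
Proof. by move=> /ent_inj AB; apply: val_inj. Qed.

Lemma ent_blk A B i j : ent (GL_mx (blk (A, B))) i j =
  if ((i < a) && (j < a))%N then ent (GL_mx A) i j else
  if ((a <= i) && (a <= j))%N then ent (GL_mx B) (i - a) (j - a) else 0.
Proof. by rewrite [GL_mx _]/(blk_mx _ _) ent_castmx ent_block. Qed.

Lemma blk_inj : injective blk.
Proof.
move=> [A B] [A' B'] E; have := ent_blk A' B'; have := ent_blk A B.
rewrite E => H1 H2; congr (_, _); apply: val_inj; apply: ent_inj => i j.
  have := H1 i j; rewrite H2; case: ifP => [_ //|ij _].
  by rewrite !ent_out // ij.
have := H1 (a + i)%N (a + j)%N; rewrite H2.
by rewrite !ltnNge !leq_addr /= !addKn.
Qed.
End OneBlock.
Arguments blk : simpl never.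

Lemma blkA a b c m1 m2 n (e1 : (a + b)%N = m1) (e2 : (m1 + c)%N = n)
    (e3 : (b + c)%N = m2) (e4 : (a + m2)%N = n) A B C :
  blk e2 (blk e1 (A, B), C) = blk e4 (A, blk e3 (B, C)).
Proof.
apply: GL_ent_inj => i j; rewrite !ent_blk -!subnDA -e1.
by do ![case: ifP => ?]; rewrite // ?ent_out //; lia.
Qed.

Lemma stab_blk k m (le_km : (k <= m)%N) (A : GL F k) :
  GL_stab F le_km A = blk (subnKC le_km) (A, 1%g).
Proof. exact: val_inj. Qed.

Lemma ent_stab k m (le_km : (k <= m)%N) (A : GL F k) i j :
  ent (GL_mx (GL_stab F le_km A)) i j =
  if ((i < k) && (j < k))%N then ent (GL_mx A) i j else
  ((i == j) && ((k <= i) && (i < m))%N)%:R.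
Proof.
rewrite stab_blk ent_blk; case: ifP => // ij.
rewrite [GL_mx _]/(1%:M) ent_one; case: ifP => [/andP[ki kj]|nk].
  by rewrite ki /= -(eqn_add2r k) !subnK // ltn_subLR // subnKC.
by case: eqP => //= ij'; move: nk; rewrite -ij' andbb => ->.
Qed.

Lemma stab_trans k l m (le_kl : (k <= l)%N) (le_lm : (l <= m)%N) (le_km : (k <= m)%N) A :
  GL_stab F le_lm (GL_stab F le_kl A) = GL_stab F le_km A.
Proof.
apply: GL_ent_inj => i j; rewrite !ent_stab.
by do ![case: ifP => ?] => //; try (congr (_ %:R)); lia.
Qed.

Lemma stabS k (le_k : (k <= k.+1)%N) (A : GL F k) :
  GL_stab F le_k A = blk (addn1 k) (A, 1%g).
Proof.
apply: GL_ent_inj => i j; rewrite ent_stab ent_blk; case: ifP => // ij.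
rewrite [GL_mx _]/(1%:M) ent_one; case: ifP => [/andP[ki kj]|nk].
  by congr (_ %:R); lia.
by case: eqP => //= ij'; move: nk; rewrite -ij' andbb => ->.
Qed.
End Blocks.
Arguments blk : simpl never.

Lemma GL_mulE (F : finFieldType) n (A B : GL F n) : val (A * B)%g = val A *m val B.
Proof. by []. Qed.

Section TwoBlocks.
Variable F : finFieldType.
Variable k : nat.
Local Notation G2 := (GL F (k + k)).
Local Notation blk2 := (@blk F k k (k + k) (erefl _)).

Lemma blk2E p : val (blk2 p) = block_mx (val p.1) 0 0 (val p.2).
Proof. by rewrite /= /blk_mx castmx_id. Qed.

Definition sw_mx : 'M[F]_(k + k) := block_mx 0 1%:M 1%:M 0.
Lemma sw_sw : sw_mx *m sw_mx = 1%:M.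
Proof.
by rewrite /sw_mx mulmx_block !mulmx0 !mul0mx !mulmx1 !addr0 !add0r -scalar_mx_block.
Qed.
Definition sw : G2 := MkGL (proj1 (mulmx1_unit sw_sw)).

Lemma swE : val sw = sw_mx.
Proof. by []. Qed.

Lemma swM p : (sw * blk2 p)%g = (blk2 (swap p) * sw)%g.
Proof.
apply: val_inj; rewrite !GL_mulE !blk2E swE /sw_mx.
by rewrite !mulmx_block !mulmx0 !mul0mx !mulmx1 !mul1mx !addr0 !add0r.
Qed.
Lemma sw2 : (sw * sw)%g = 1%g.
Proof. by apply: val_inj; apply: sw_sw. Qed.

Definition wr_emb (w : wreath (GL F k)) : G2 :=
  (blk2 w.1 * (if w.2 then sw else 1))%g.
Lemma wr_embM : {morph wr_emb : x y / (x * y)%g}.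
Proof.
move=> [p b] [r c]; rewrite /wr_emb /= blkM; case: b; case: c => /=;
  rewrite ?mulg1 -?mulgA //; congr (_ * _)%g; rewrite ?swM //.
- by rewrite mulgA swM -mulgA sw2 mulg1.
Qed.
Lemma wr_emb_inj : (0 < k)%N -> injective wr_emb.
Proof.
move=> k_gt0.
have nE p r : (blk2 p * sw)%g <> blk2 r.
  move/(congr1 val); rewrite GL_mulE !blk2E swE /sw_mx mulmx_block.
  rewrite !mulmx0 !mul0mx !mulmx1 !addr0 !add0r => /eq_block_mx[_ p1 _ _].
  have := valP p.1; rewrite p1 unitmxE -(prednK k_gt0) det0 unitr0 //.
move=> [p b] [r c]; rewrite /wr_emb /=; case: b; case: c => // E.
- by congr (_, _); apply: (blk_inj (e := erefl)); apply: (mulIg sw).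
- by case: (nE p r); rewrite E mulg1.
- by case: (nE r p); rewrite -E mulg1.
- by congr (_, _); apply: (blk_inj (e := erefl)); apply: (mulIg 1%g).
Qed.
End TwoBlocks.

(** * Detection for general linear groups *)

Section Truncation.
Variable gT : finGroupType.
Implicit Type x : bar gT -> 'F_2.
(** A class is the sum of its homogeneous components, each of which is a
    class; so detection may be tested on homogeneous classes. *)
Definition trunc i x : bar gT -> 'F_2 := fun c => if dg c == i then x c else 0.

Lemma cobd_trunc i x c : cobd (trunc i x) c = if dg c == i.+1 then cobd x c else 0.
Proof.
case: eqP => [dc|dc].
  by apply: eq_ev_all (bd_dg c) _ => t; rewrite dc eqSS /trunc => ->.
apply: ev0_all (bd_dg c) _ => t /eqP dt; rewrite /trunc; case: eqP => // ti.
by case: dc; rewrite -dt ti.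
Qed.

Lemma trunc_class i x : class x -> class (trunc i x).
Proof.
move=> [zx Ix]; split=> [c|y c]; first by rewrite cobd_trunc zx; case: ifP.
by rewrite /trunc Ix (act_dg (bar_actP gT)).
Qed.

Lemma trunc_homog i x : homog i (trunc i x).
Proof. by move=> c /negbTE dc; rewrite /trunc dc. Qed.

Lemma trunc_null i x : null bar_act x -> null bar_act (trunc i x).
Proof.
move=> [g Ig xg]; exists (fun c => if (dg c).+1 == i then g c else 0).
  by move=> y c; rewrite (act_dg (bar_actP gT)) Ig.
move=> c; rewrite /trunc; case: eqP => [<-|dc].
  by rewrite xg; apply: eq_ev_all (bd_dg c) _ => t ->.
apply/esym; apply: ev0_all (bd_dg c) _ => t /eqP ->.
by case: eqP.
Qed.

Lemma null_trunc x : (forall i, null bar_act (trunc i x)) -> null bar_act x.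
Proof.
move=> nx; have H i : exists g, invar (@bar_act gT) g /\ trunc i x =1 cobd g.
  by case: (nx i) => g; exists g.
pose g i := proj1_sig (constructive_indefinite_description _ (H i)).
have gP i : invar (@bar_act gT) (g i) /\ trunc i x =1 cobd (g i).
  exact: proj2_sig (constructive_indefinite_description _ (H i)).
exists (fun c => g (dg c).+1 c).
  by move=> y c; rewrite (act_dg (bar_actP gT)) (proj1 (gP _)).
move=> c; transitivity (trunc (dg c) x c); first by rewrite /trunc eqxx.
by rewrite (proj2 (gP _)); apply: eq_ev_all (bd_dg c) _ => t /eqP ->.
Qed.
End Truncation.

Lemma detects_homog (hT gT : finGroupType) (al : hT -> gT) :
  (forall i x, class x -> homog i x -> null_on al x -> null bar_act x) ->
  detects al.
Proof.
move=> det x zx nx; apply: null_trunc => i.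
apply: det (trunc_class i zx) (@trunc_homog _ i x) _.
apply: eq_null (trunc_null i nx) => c.
by rewrite /trunc /resb /= size_map.
Qed.

Section GLDetection.
Variable F : finFieldType.
Hypothesis q4 : (#|F| %% 4 = 1)%N.
Local Notation q := #|F|.

Lemma two_neq0 : 1 + 1 != 0 :> F.
Proof.
apply/eqP => F2; have : (1 : F) *+ q = 0.
  by rewrite -[in LHS]cardsT -FinRing.zmodXgE expg_cardG ?inE.
have oq := q_odd q4; rewrite -(odd_double_half q) oq mulrS -mul2n mulrnA mulr2n F2.
by rewrite mul0rn addr0 => /eqP; rewrite oner_eq0.
Qed.

Definition GL1_entry (A : GL F 1) : F := val A 0 0.
Lemma GL1_entryM : {morph GL1_entry : x y / (x * y)%g >-> x * y}.
Proof. by move=> x y; rewrite /GL1_entry GL_mulE mxE big_ord1. Qed.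
Lemma GL1_entry_inj : injective GL1_entry.
Proof.
by move=> x y e; apply: val_inj; apply/matrixP => i j; rewrite !ord1.
Qed.
Lemma GL1_entry1 : GL1_entry 1%g = 1.
Proof. by rewrite /GL1_entry /= mxE eqxx. Qed.

Lemma GL1_comm (x y : GL F 1) : commute x y.
Proof. by apply: GL1_entry_inj; rewrite !GL1_entryM mulrC. Qed.

Lemma GL1_cyclic : exists g : GL F 1, forall x, exists n, x = (g ^+ n)%g.
Proof.
have : cyclic [set: GL F 1].
  apply: (field_mul_group_cyclic (f := GL1_entry)) => [x y _ _|x _]; first exact: GL1_entryM.
  by split=> [|->]; [rewrite -GL1_entry1 => /GL1_entry_inj | exact: GL1_entry1].
move=> /cyclicP[g gP]; exists g => x.
have /cycleP[n ->] : x \in <[g]>%g by rewrite -gP inE.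
by exists n.
Qed.

(** A power of a generator, with exponent (q - 1)/4. *)
Lemma GL1_sqrtm1 : exists u : GL F 1, GL1_entry (u * u)%g = -1.
Proof.
have : cyclic [set: GL F 1].
  apply: (field_mul_group_cyclic (f := GL1_entry)) => [x y _ _|x _]; first exact: GL1_entryM.
  by split=> [|->]; [rewrite -GL1_entry1 => /GL1_entry_inj | exact: GL1_entry1].
move=> /cyclicP[g gP].
have q_gt1 := card_finNzRing_gt1 F.
have og : #[g]%g = (q - 1)%N.
  by rewrite orderE -gP cardsT card_GLn big_nat1 expn0 mul1n expn1.
pose m := (q %/ 4)%N; have mq : (q - 1 = m + m + (m + m))%N.
  by rewrite {1}(divn_eq q 4) q4 /m; move: (q %/ 4)%N => r; lia.
have m_gt0 : (0 < m)%N.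
  by have : (0 < q - 1)%N; [rewrite subn_gt0 | rewrite mq; lia].
exists (g ^+ m)%g; rewrite -expgD; set v := (g ^+ (m + m))%g.
have v2 : GL1_entry v ^+ 2 = 1.
  by rewrite expr2 -GL1_entryM -expgD -mq -og expg_order GL1_entry1.
have v1 : GL1_entry v != 1.
  apply/eqP; rewrite -GL1_entry1 => /GL1_entry_inj/eqP.
  rewrite -order_dvdn og => /dvdn_leq; rewrite mq addn_gt0 m_gt0 => /(_ isT); lia.
by move/eqP: v2; rewrite -subr_eq0 subr_sqr_1 mulf_eq0 subr_eq0 (negbTE v1) addr_eq0 => /eqP.
Qed.

Section Hadamard.
Variable k : nat.
Local Notation blk2 := (@blk F k k (k + k) erefl).
Definition hadamard_mx : 'M[F]_(k + k) := block_mx 1%:M 1%:M 1%:M (- 1%:M).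
Lemma hadamard_unit : hadamard_mx \in unitmx.
Proof.
have E : hadamard_mx *m hadamard_mx = (1 + 1)%:M.
  rewrite /hadamard_mx mulmx_block !mulmx1 !mulmxN !mulmx1 opprK subrr.
  by rewrite -raddfD -scalar_mx_block.
have : hadamard_mx *m ((1 + 1)^-1 *: hadamard_mx) = 1%:M.
  by rewrite -scalemxAr E scale_scalar_mx mulVf ?two_neq0.
by case/mulmx1_unit.
Qed.
Definition hadamard : GL F (k + k) := MkGL hadamard_unit.
Lemma hadamardE : val hadamard = hadamard_mx.
Proof. by []. Qed.

(** The matrix with rows (1, 1) and (1, -1) conjugates diag(1, -1) to the
    exchange of the coordinates. *)
Lemma sw_hadamard (A B : GL F k) : val B = - val A ->
  (blk2 (A, B) * hadamard = hadamard * (blk2 (A, A) * sw F k))%g.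
Proof.
move=> BA; apply: val_inj; rewrite !GL_mulE !blk2E swE hadamardE /hadamard_mx /sw_mx /= BA.
rewrite !mulmx_block !mulmx0 !mul0mx !mulmx1 !addr0 !add0r !mul1mx.
by rewrite !mulmxN !mulNmx !mulmx1 !mul1mx ?mulmx0 opprK !add0r subr0 addr0.
Qed.
End Hadamard.

(** Elements a and b are first taken equal; as GL_1 is cyclic and the symbol is
    bilinear, this gives the general case. *)
Lemma symb_GL2 (y : bar (GL F (1 + 1)) -> 'F_2) a b : class y ->
  let de := @blk F 1 1 (1 + 1) erefl in
  symb y (de (a, 1%g)) (de (1%g, b)) = 0.
Proof.
move=> zy de; have deM : {morph de : x y / (x * y)%g} := @blkM F 1 1 _ erefl.
have diag c : symb y (de (c, 1%g)) (de (1%g, c)) = 0.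
  have [u uu] := GL1_sqrtm1.
  set s := de (c, 1%g); set s' := de (1%g, c); pose z := de (c, c).
  have deC p r : commute (de p) (de r).
    by rewrite /commute -!deM; congr de; case: p r => [p1 p2] [r1 r2];
      congr (_, _); apply: GL1_comm.
  have swz : commute (sw F 1) z by rewrite /commute swM.
  have zE : z = (s * s')%g by rewrite /z /s /s' -deM; congr de; congr (_, _); rewrite /= ?mulg1 ?mul1g.
  (* The symbol of an element with its own square vanishes. *)
  have c2 : (s * sw F 1 * (s * sw F 1))%g = z.
    by rewrite -mulgA (mulgA (sw F 1)) swM -(mulgA _ (sw F 1)) sw2 mulg1.
  have cc : commute (s * sw F 1)%g (s * sw F 1)%g by [].
  have sz : commute s z by apply: deC.
  have e1 : symb y (s * sw F 1)%g z = 0.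
    by rewrite symbC -c2 symbM // symb_diag addr0.
  (* D is diag(1, -1), a conjugate of the exchange w and a square. *)
  pose D := de (1%g, (u * u)%g).
  have Dz : commute D z by apply: deC.
  have swD : sw F 1 = ((hadamard 1)^-1 * D * hadamard 1)%g.
    rewrite -mulgA; apply: (mulgI (hadamard 1)); rewrite mulKVg.
    rewrite [RHS](sw_hadamard (A := 1%g) (B := (u * u)%g)) ?[blk _ _](morph1 deM) ?mul1g //.
    by apply/matrixP => i j; rewrite !ord1 [LHS]uu !mxE.
  have zhad : z = ((hadamard 1)^-1 * z * hadamard 1)%g.
    rewrite -mulgA; apply: (mulgI (hadamard 1)); rewrite mulKVg; apply: val_inj.
    rewrite !GL_mulE blk2E hadamardE /hadamard_mx /= !mulmx_block.
    by rewrite !mulmx0 !mul0mx !mulmx1 !mul1mx !addr0 !add0r mulmxN mulNmx mulmx1 mul1mx.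
  have e2 : symb y (sw F 1) z = 0.
    rewrite swD {1}zhad symb_conj // /D.
    have -> : (1%g, (u * u)%g) = ((1%g, u) * (1%g, u))%g :> GL F 1 * GL F 1.
      by congr (_, _); rewrite /= mulg1.
    by rewrite deM symbM ?addF2 //; apply: deC.
  have e3 : symb y s z = 0 by move: e1; rewrite symbM // e2 addr0.
  move: e3; rewrite zE symbC symbM //; first by rewrite symb_diag add0r symbC.
  exact: deC.
have [g gP] := GL1_cyclic; have [n ->] := gP a; have [m ->] := gP b.
have E1 j : de ((g ^+ j)%g, 1%g) = (de (g, 1%g) ^+ j)%g.
  elim: j => [|j IH]; first exact: (morph1 deM).
  by rewrite !expgS -IH -deM; congr de; congr (_, _); rewrite /= mulg1.
have E2 j : de (1%g, (g ^+ j)%g) = (de (1%g, g) ^+ j)%g.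
  elim: j => [|j IH]; first exact: (morph1 deM).
  by rewrite !expgS -IH -deM; congr de; congr (_, _); rewrite /= mulg1.
have comm : commute (de (g, 1%g)) (de (1%g, g)).
  by rewrite /commute -!deM; congr de; congr (_, _); rewrite /= ?mulg1 ?mul1g.
rewrite E1 E2; apply: symbX0 => //; first exact: commuteX.
by rewrite symbC; apply: symbX0 => //; rewrite symbC.
Qed.

Lemma detects_levi a b n (e : (a + b)%N = n) :
  logn 2 n`! = (logn 2 a`! + logn 2 b`!)%N -> detects (@blk F a b n e).
Proof.
move=> v x zx; apply: (transfer (@blkM F a b n e) (@blk_inj F a b n e) _ zx).
rewrite card_prod lognM; try by apply/card_gt0P; exists 1%g.
by rewrite !logn2_card_GL // v -e mulnDl addnACA.
Qed.

(** The Levi subgroup has even index when k is a power of 2, but its extension by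
    the exchange of the two blocks has odd index: the 2-adic valuation of the
    middle binomial coefficient is 1. *)
Lemma detects_double k s : k = (2 ^ s)%N ->
  detects (@blk F k k (k + k) erefl).
Proof.
move=> ks; apply: detects_homog => i x zx hx nx.
have k_gt0 : (0 < k)%N by rewrite ks expn_gt0.
apply: (transfer (@wr_embM F k) (wr_emb_inj k_gt0) _ zx).
  rewrite !card_prod card_bool !lognM ?muln_gt0; try by apply/card_gt0P; exists 1%g.
    rewrite !logn2_card_GL // addnn logn2_fact_double.
    have := logn2_fact_expn s; rewrite -ks; set f := logn 2 k`!; set c := logn 2 _.
    have -> : logn 2 2 = 1%N by rewrite lognE.
    by rewrite -mul2n -mulnA; lia.
    by apply/andP; split; apply/card_gt0P; exists 1%g.
  by [].
have zy := resb_class (@wr_embM F k) zx.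
apply: (wreath_detect (i := i) zy).
- by move=> c dc; apply: hx; rewrite /= size_map.
- apply: eq_null nx => c; rewrite resb_comp; apply: eq_resb => p.
  by rewrite /wr_emb /= mulg1.
have m1_unit : - 1%:M \in @unitmx F k.
  have E : - 1%:M *m - 1%:M = 1%:M :> 'M[F]_k by rewrite mulNmx mulmxN mulmx1 opprK.
  exact (proj1 (mulmx1_unit E)).
pose m1 : GL F k := MkGL m1_unit.
have m1C g : commute m1 g.
  by apply: val_inj; rewrite !GL_mulE /= mulNmx mulmxN mul1mx mulmx1.
have m1m1 : (m1 * m1 = 1)%g.
  by apply: val_inj; rewrite GL_mulE /= mulNmx mulmxN mulmx1 opprK.
(* C2 x GL_k is conjugated into the Levi subgroup: the exchange becomes
   diag(1, -1). *)
pose sg (p : C2 * GL F k) : GL F k * GL F k := (p.2, if p.1 then (m1 * p.2)%g else p.2).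
have sgM : {morph sg : x y / (x * y)%g}.
  case=> [[] g] [[] h]; rewrite /sg /=; congr (_, _) => /=.
  - by rewrite -mulgA (mulgA g) -(m1C g) !mulgA m1m1 mul1g.
  - by rewrite mulgA.
  - by rewrite !mulgA (m1C g).
have bsM : {morph (@blk F k k (k + k) erefl) \o sg : x y / (x * y)%g}.
  by move=> p r; rewrite /= sgM blkM.
have dM : {morph (@wr_emb F k) \o (@wr_diag (GL F k)) : x y / (x * y)%g}.
  by move=> p r; rewrite /= wr_diagM wr_embM.
apply: (@eq_null _ _ _ (resb ((@wr_emb F k) \o (@wr_diag (GL F k))) x)).
  by move=> c; rewrite resb_comp.
apply: (null_on_conj (w := hadamard k) bsM dM _ zx).
  case=> [[] g]; rewrite /sg /wr_emb /wr_diag /=.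
    by apply: sw_hadamard; rewrite GL_mulE /= mulNmx mul1mx.
  apply: val_inj; rewrite mulg1 !GL_mulE !blk2E hadamardE /hadamard_mx /= !mulmx_block.
  by rewrite !mulmx0 !mul0mx !mulmx1 !mul1mx !addr0 !add0r mulmxN mulNmx mulmx1 mul1mx.
exact: null_on_comp sgM nx.
Qed.
End GLDetection.

(** * Stability *)

Section Stability.
Variable F : finFieldType.
Hypothesis q4 : (#|F| %% 4 = 1)%N.

Lemma odd_part n : (0 < n)%N -> exists s t, n = (2 ^ s * t.*2.+1)%N.
Proof.
have [k] := ubnP n; elim: k n => // k IH n; rewrite ltnS => le_nk n_gt0.
case on: (odd n).
  by exists 0%N, n./2; rewrite mul1n -[LHS](odd_double_half n) on add1n.
have [||s [t e]] := IH n./2; first by lia.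
  by move: (odd_double_half n); rewrite on; lia.
by exists s.+1, t; rewrite expnS -mulnA -e mul2n -[LHS](odd_double_half n) on.
Qed.

(** For n = 2^s (2t + 1) with t > 0, the Levi subgroup with a block of
    size 2^s has odd index; for t = 0 the two blocks are equal. *)
Lemma levi_exists n : (1 < n)%N -> exists a b (e : (a.+1 + b.+1)%N = n),
  detects (@blk F a.+1 b.+1 n e).
Proof.
move=> n_gt1; have [s [t nE]] := odd_part (ltnW n_gt1).
have P_gt0 : (0 < 2 ^ s)%N by rewrite expn_gt0.
case: t nE => [|t] nE.
  case: s nE {P_gt0} => [|s] nE; first by rewrite nE in n_gt1.
  have P_gt0 : (0 < 2 ^ s)%N by rewrite expn_gt0.
  have e : ((2 ^ s).-1.+1 + (2 ^ s).-1.+1 = n)%N.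
    by rewrite prednK // nE expnS muln1 addnn mul2n.
  exists (2 ^ s).-1, (2 ^ s).-1, e; case: n / e {n_gt1 nE}.
  by apply: (@detects_double F q4 _ s); rewrite prednK.
have Q_gt0 : (0 < 2 ^ s * t.+1.*2)%N by rewrite muln_gt0 P_gt0.
have e : ((2 ^ s).-1.+1 + (2 ^ s * t.+1.*2).-1.+1 = n)%N.
  by rewrite !prednK // nE mulnS.
exists (2 ^ s).-1, (2 ^ s * t.+1.*2).-1, e.
by apply: detects_levi; rewrite // !prednK // nE logn2_fact_split.
Qed.

Local Notation bs n := (@blk F n 1 n.+1 (addn1 n)).

(** A Levi subgroup GL_(a+1) x GL_(b+1) detects; by induction its second block is
    detected by GL_b x GL_1, and GL_(a+1) x GL_b x GL_1 is contained in
    GL_n x GL_1. *)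
Lemma detects_blk1 n : detects (bs n).
Proof.
have [k] := ubnP n; elim: k n => // k IH n; rewrite ltnS => le_nk x zx nx.
case: (posnP n) => [n0|n_gt0].
  move: x zx nx; rewrite n0 => x zx nx.
  pose r (A : GL F 1) : GL F 0 * GL F 1 := (1%g, A).
  have rM : {morph r : x y / (x * y)%g}.
    by move=> A B; rewrite /r; congr (_, _); rewrite /= mulg1.
  apply: eq_null (null_on_comp rM nx) => c; rewrite /resb.
  have rE A : (bs 0 \o r) A = A.
    by apply: GL_ent_inj => i j; rewrite [_ A]/(bs 0 (1%g, A)) ent_blk /= !subn0.
  congr x; case: c => v s; rewrite /bar_map rE; congr (_, _).
  by rewrite -[RHS]map_id; apply: eq_map.
have [a [b [e det]]] := levi_exists (n := n.+1) n_gt0.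
apply: det => //.
have e' : (a.+1 + b)%N = n by move: e; rewrite addnS => -[].
apply: (detects_prodr (@blkM F b 1 b.+1 (addn1 b)) (IH b _)).
- by move: e'; lia.
- exact: resb_class (@blkM F _ _ _ e) zx.
pose be (p : GL F a.+1 * (GL F b * GL F 1)) : GL F n * GL F 1 :=
  (blk e' (p.1, p.2.1), p.2.2).
have beM : {morph be : x y / (x * y)%g}.
  by move=> p p'; rewrite /be; congr (_, _); exact: (blkM e' (p.1, p.2.1) (p'.1, p'.2.1)).
apply: eq_null (null_on_comp beM nx) => c; rewrite resb_comp.
by apply: eq_resb => -[A [B C]]; rewrite /be /=; exact: blkA.
Qed.

Section Step.
Variable k : nat.
Let st (A : GL F k) : GL F k.+1 := bs k (A, 1%g).
Let st2 (A : GL F k.+1) : GL F k.+2 := bs k.+1 (A, 1%g).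

Let e2 : (k + (1 + 1))%N = k.+2. Proof. by rewrite !addn1 addn2. Qed.
Let ta := @blk F k (1 + 1) k.+2 e2.
Let de := @blk F 1 1 (1 + 1) erefl.
Let w : GL F k.+2 := ta (1%g, sw F 1).

Lemma stack_blk n a b : stack (bs k.+1) (bs k) ((n, a), b) = ta (n, de (a, b)).
Proof. exact: blkA. Qed.

Lemma de_swap a b : (sw F 1 * de (a, b) = de (b, a) * sw F 1)%g.
Proof. exact: swM. Qed.

Lemma stack_swap n a b :
  (stack (bs k.+1) (bs k) ((n, b), a) = w^-1 * stack (bs k.+1) (bs k) ((n, a), b) * w)%g.
Proof.
rewrite !stack_blk -mulgA; apply: (mulgI w); rewrite mulKVg /w.
rewrite -!(blkM e2); congr ta; congr (_, _); rewrite /= ?mulg1 ?mul1g //.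
exact: de_swap.
Qed.

(** The copy of GL_1 used for the slant product can be exchanged, by
    conjugation, with the last coordinate of GL_(k+1). *)
Lemma slant_res_null x j u : class x -> cyc j u -> null_on st2 x ->
  null_on st (slant_along (bs k.+1) x u).
Proof.
move=> zx uP nx.
have stM : {morph st : x y / (x * y)%g}.
  by move=> A B; rewrite /st -blkM; congr (bs k); congr (_, _); rewrite /= mulg1.
have st2M : {morph st2 : x y / (x * y)%g}.
  by move=> A B; rewrite /st2 -blkM; congr (bs k.+1); congr (_, _); rewrite /= mulg1.
have bM := @blkM F k.+1 1 k.+2 (addn1 k.+1).
apply: (null_eqD (slant_along_res bM stM zx uP)).
apply: (slant_along_conj (be := fun p => st2 (bs k p)) (w := w) _ _ _ zx uP).
- by move=> p r; rewrite blkM st2M.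
- by move=> p r; rewrite -bM; congr (bs k.+1); congr (_, _); rewrite /= stM.
- by case=> A c; apply: (stack_swap A c 1%g).
apply: (slant_along_null uP).
exact: (null_on_comp (@blkM F k 1 k.+1 (addn1 k)) nx).
Qed.

Lemma slant_slant_GL2 x u v : class x -> cyc 1 u -> cyc 1 v ->
  null bar_act (slant_along (bs k) (slant_along (bs k.+1) x u) v).
Proof.
move=> zx uP vP.
apply: (slant_along_symbol (ta := ta) (de := de)) zx uP vP _;
  try exact: blkM; first exact: stack_blk.
by move=> y zy a b; apply: symb_GL2.
Qed.
End Step.

Lemma slant_deg0_null k x j u : class x -> cyc j u -> j = 0%N ->
  null_on (fun A => bs k (A, 1%g)) x -> null bar_act (slant_along (bs k) x u).
Proof.
move=> zx uP j0 nx; rewrite j0 in uP.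
exact: (slant_along_deg0 (@blkM F k 1 k.+1 (addn1 k)) zx uP nx).
Qed.

(** In degree 2k + 1 a slant product of degree 1 need not vanish, so its vanishing
    is a hypothesis; the slant products of degree at least 2 inherit it because
    slant products commute. *)
Lemma stable_edge k i x : (i <= k.*2.+1)%N -> class x -> homog i x ->
  null_on (fun A => bs k (A, 1%g)) x ->
  (forall u, cyc 1 u -> null bar_act (slant_along (bs k) x u)) -> null bar_act x.
Proof.
elim: k i x => [|k IH] i x le_ik zx hx nx n1; apply: detects_blk1 => //;
  apply: (slant_along_detects (@blkM F _ _ _ (addn1 _)) zx) => -[|[|j]] u uP.
- exact: slant_deg0_null zx uP _ nx.
- exact: n1.
- by apply: null0; apply: (slant_along_high (@blkM F _ _ _ (addn1 _)) hx uP); lia.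
- exact: slant_deg0_null zx uP _ nx.
- exact: n1.
case: (ltnP i j.+2) => [lt_ij|le_ji].
  by apply: null0; apply: (slant_along_high (@blkM F _ _ _ (addn1 _)) hx uP).
apply: (IH (i - j.+2)%N).
- by move: le_ik; rewrite doubleS; lia.
- exact: (slant_along_class (@blkM F _ _ _ (addn1 _)) zx uP).
- exact: (slant_along_homog (@blkM F _ _ _ (addn1 _)) hx uP).
- exact: slant_res_null zx uP nx.
move=> v vP.
apply: (slant_along_swap (@blkM F _ _ _ (addn1 _)) (@blkM F _ _ _ (addn1 _)) zx uP vP (@stack_swap k)).
by apply: (slant_along_null uP); apply: null_resb (n1 v vP); apply: blkM.
Qed.

Lemma stable_step k i x : (i <= k.*2)%N -> class x -> homog i x ->
  null_on (fun A => bs k (A, 1%g)) x -> null bar_act x.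
Proof.
elim: k i x => [|k IH] i x le_ik zx hx nx; apply: detects_blk1 => //;
  apply: (slant_along_detects (@blkM F _ _ _ (addn1 _)) zx) => -[|j] u uP.
- exact: slant_deg0_null zx uP _ nx.
- by apply: null0; apply: (slant_along_high (@blkM F _ _ _ (addn1 _)) hx uP); lia.
- exact: slant_deg0_null zx uP _ nx.
case: (ltnP i j.+1) => [lt_ij|le_ji].
  by apply: null0; apply: (slant_along_high (@blkM F _ _ _ (addn1 _)) hx uP).
have zz := slant_along_class (@blkM F _ _ _ (addn1 _)) zx uP.
have hz := slant_along_homog (@blkM F _ _ _ (addn1 _)) hx uP le_ji.
have nz := slant_res_null zx uP nx.
case: j uP le_ji zz hz nz => [|j] uP le_ji zz hz nz; last first.
  by apply: IH hz nz => //; move: le_ik; rewrite doubleS; lia.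
apply: stable_edge hz nz _ => //; first by move: le_ik; rewrite doubleS; lia.
by move=> v vP; apply: slant_slant_GL2.
Qed.

Lemma stable m k (le_km : (k <= m)%N) i x : (i <= k.*2)%N -> class x -> homog i x ->
  null_on (GL_stab F le_km) x -> null bar_act x.
Proof.
elim: m le_km x => [|m IH] le_km x le_ik zx hx nx.
  have k0 : k = 0%N by apply/eqP; rewrite -leqn0.
  move: le_km nx le_ik; rewrite k0 => le_km nx _.
  apply: eq_null nx => c; rewrite /resb; congr x; case: c => v s.
  by congr (_, _); [exact: GL0_eq | rewrite -[RHS]map_id; apply: eq_map => A; exact: GL0_eq].
case: (eqVneq k m.+1) => [km|km].
  move: le_km nx; rewrite km => le_km nx.
  have sE A : GL_stab F le_km A = A.
    apply: GL_ent_inj => i1 j1; rewrite ent_stab; case: ifP => // out.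
    by rewrite ent_out ?out // (_ : _ && _ = false) //; lia.
  apply: eq_null nx => c; rewrite /resb; congr x; case: c => v s.
  by rewrite /bar_map sE; congr (_, _); rewrite -[RHS]map_id; apply: eq_map.
have le_km' : (k <= m)%N by rewrite -ltnS ltn_neqAle km.
pose st A := bs m (A, 1%g).
have stM : {morph st : x y / (x * y)%g}.
  by move=> A B; rewrite /st -blkM; congr (bs m); congr (_, _); rewrite /= mulg1.
apply: (stable_step _ zx hx).
  by apply: leq_trans le_ik _; rewrite leq_double.
apply: (IH le_km') => //; first exact: resb_class.
  by move=> c dc; apply: hx; rewrite /= size_map.
apply: eq_null nx => c; rewrite resb_comp; apply: eq_resb => A /=.
by rewrite /st -(stabS (leqnSn m)) stab_trans.
Qed.
End Stability.

(** * Homogeneous and inhomogeneous cochains *)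

Section Translation.
Variable gT : finGroupType.
Implicit Types (u s : seq gT) (c : bar gT).

(** Inhomogeneous coordinates of a simplex. *)
Definition incr u : seq gT :=
  mkseq (fun l => ((nth 1 u l)^-1 * nth 1 u l.+1)%g) (size u).-1.
Definition incr_cell c := incr (c.1 :: c.2).

Lemma size_incr_cell c : size (incr_cell c) = dg c.
Proof. exact: size_mkseq. Qed.

Lemma incr_cell_act x c : incr_cell (bar_act x c) = incr_cell c.
Proof.
rewrite /incr_cell -[_ :: _]/(map (mulg x) (c.1 :: c.2)) /incr size_map.
apply/eq_in_map => l; rewrite mem_iota => /andP[_ lt_l].
rewrite !(nth_map 1%g) ?invMg -?mulgA ?mulKg //; move: lt_l; rewrite /= add0n ltnS //.
exact: ltnW.
Qed.

Definition hom_cochain i (f : cochain gT 'F_2 i) c : 'F_2 :=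
  oapp f 0 (insub (incr_cell c)).

Lemma hom_cochainE i (f : cochain gT 'F_2 i) c (t : i.-tuple gT) :
  incr_cell c = t -> hom_cochain f c = f t.
Proof. by move=> e; rewrite /hom_cochain e valK. Qed.

Lemma hom_cochain_homog i (f : cochain gT 'F_2 i) : homog i (hom_cochain f).
Proof.
by move=> c dc; rewrite /hom_cochain insubN // size_incr_cell.
Qed.

Lemma hom_cochain_invar i (f : cochain gT 'F_2 i) : invar bar_act (hom_cochain f).
Proof. by move=> x c; rewrite /hom_cochain incr_cell_act. Qed.

Lemma dels_mkseq u : dels u = mkseq (fun j => take j u ++ drop j.+1 u) (size u).
Proof.
elim: u => //= v u ->; rewrite /mkseq /= drop0; congr (_ :: _).
by rewrite (iotaDl 1 0) -!map_comp.
Qed.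

Lemma nth_del u j l : (j < size u)%N ->
  nth 1%g (take j u ++ drop j.+1 u) l = nth 1%g u (if (l < j)%N then l else l.+1).
Proof.
move=> lt_ju; rewrite nth_cat size_take lt_ju; case: ifP => lt_lj.
  by rewrite nth_take.
by rewrite nth_drop addSn subnKC // leqNgt lt_lj.
Qed.

Lemma incr_del i c (t : i.+1.-tuple gT) (j : 'I_i.+2) : incr_cell c = t ->
  incr (take j (c.1 :: c.2) ++ drop j.+1 (c.1 :: c.2)) = bar_face j t.
Proof.
move=> ct; have sc : size c.2 = i.+1 by rewrite -[RHS](size_tuple t) -ct size_incr_cell.
have lt_j : (j < size (c.1 :: c.2))%N by rewrite /= sc.
have sd : size (take j (c.1 :: c.2) ++ drop j.+1 (c.1 :: c.2)) = i.+1.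
  by rewrite size_cat size_take size_drop lt_j /= sc; have := ltn_ord j; lia.
apply: (@eq_from_nth _ 1%g); first by rewrite size_mkseq sd size_tuple.
move=> l; rewrite size_mkseq sd /= => lt_l.
rewrite nth_mkseq ?sd // !nth_del // nth_bar_face // -ct.
have E l' : (l' < i.+1)%N -> nth 1%g (incr_cell c) l' =
    ((nth 1 (c.1 :: c.2) l')^-1 * nth 1 (c.1 :: c.2) l'.+1)%g.
  by move=> lt_l'; rewrite nth_mkseq //= sc.
rewrite !E //; last by apply: ltnW.
case: (ltngtP l.+1 j) => // _.
by rewrite mulgA mulgK.
Qed.

Lemma signF2 (a : 'F_2) j : a *~ (-1) ^+ j = a.
Proof.
rewrite -signr_odd; case: (odd j); rewrite ?expr0 ?expr1 ?mulr1z // mulrN1z.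
by case: (F2_cases a) => ->; apply/eqP.
Qed.

Lemma hom_cochain_cobound i (f : cochain gT 'F_2 i) c :
  hom_cochain (cobound f) c = cobd (hom_cochain f) c.
Proof.
case: (eqVneq (dg c) i.+1) => [dc|dc]; last first.
  rewrite hom_cochain_homog //; apply/esym; apply: ev0_all (bd_dg c) _ => t /eqP dt.
  by apply: hom_cochain_homog; apply: contraNneq dc => ti; rewrite -dt ti.
have st : size (incr_cell c) == i.+1 by rewrite size_incr_cell dc.
pose t := Tuple st; have ct : incr_cell c = t by [].
rewrite (hom_cochainE _ ct) ffunE.
have E : cobd (hom_cochain f) c = \sum_(0 <= j < i.+2)
    on_list (hom_cochain f) (take j (c.1 :: c.2) ++ drop j.+1 (c.1 :: c.2)).
  case: c dc {st t ct} => v s dc; rewrite /cobd /= bar_bdE dels_mkseq.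
  by rewrite /mkseq ev_map /= [size s]dc /ev /index_iota subn0.
rewrite E big_mkord; apply: eq_bigr => j _; rewrite signF2.
have sd : size (take j (c.1 :: c.2) ++ drop j.+1 (c.1 :: c.2)) = i.+1.
  rewrite size_cat size_take size_drop /= [size c.2]dc ltn_ord.
  by have := ltn_ord j; lia.
move: sd (incr_del j ct); case: (take _ _ ++ _) => [|v s] // _ dE.
by rewrite /= -(hom_cochainE f (c := (v, s)) (t := bar_face j t)).
Qed.

Definition sums s : seq gT := scanl mulg 1%g s.

Lemma incr_sums s : incr (1%g :: sums s) = s.
Proof.
apply: (@eq_from_nth _ 1%g); first by rewrite size_mkseq /= size_scanl.
move=> l; rewrite size_mkseq /= size_scanl => lt_ls.
rewrite nth_mkseq //= ?size_scanl //.
have E v j (r : seq gT) : (j < size r)%N ->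
    nth 1%g (v :: scanl mulg v r) j.+1 = (nth 1%g (v :: scanl mulg v r) j * nth 1%g r j)%g.
  by elim: r v j => //= x r IH v [|j] //= lt_j; apply: IH.
by rewrite -[nth _ (sums s) l]/(nth 1%g (1%g :: sums s) l.+1) E // mulKg.
Qed.

Lemma sums_incr_cell c : (1%g, sums (incr_cell c)) = bar_act c.1^-1%g c.
Proof.
case: c => v s; rewrite /bar_act /= mulVg; congr (_, _); rewrite /incr_cell /=.
have incrS x y r : incr (x :: y :: r) = (x^-1 * y)%g :: incr (y :: r).
  rewrite /incr /mkseq /= -[1%N]addn0 iotaDl -map_comp; congr (_ :: _).
have E x : scanl mulg (x * v)%g (incr (v :: s)) = map (mulg x) s.
  elim: s v x => [//|w s IH] v x; rewrite incrS [scanl _ _ _]/= -mulgA mulKVg.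
  by rewrite IH.
by rewrite -E mulVg.
Qed.

Lemma coboundaryP i (z : cocycle gT 'F_2 i) :
  (z \in @coboundary_pred gT 'F_2 i) <-> null bar_act (hom_cochain (val z)).
Proof.
case: i z => [|i] z; rewrite inE.
  split=> [/eqP->|[g _ zg]].
    by apply: null0 => c; rewrite /hom_cochain; case: insub => //= t; rewrite ffunE.
  apply/eqP; apply: val_inj; apply/ffunP => t; rewrite ffunE.
  rewrite (tuple0 t) -(hom_cochainE _ (c := (1%g, [::])) (t := [tuple])) //.
  by rewrite zg /cobd ev_nil.
split=> [/existsP[c /eqP zc]|nz].
  exists (hom_cochain c); first exact: hom_cochain_invar.
  by move=> d; rewrite zc hom_cochain_cobound.
have [g [Ig zg _]] := null_homog (bar_actP gT) (@hom_cochain_homog _ (val z)) nz.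
pose c : cochain gT 'F_2 i := [ffun t : i.-tuple gT => g (1%g, sums t)].
apply/existsP; exists c; apply/eqP; apply/ffunP => t.
have tE : incr_cell (1%g, sums t) = t by exact: incr_sums.
rewrite -(hom_cochainE _ tE) -(hom_cochainE _ tE) hom_cochain_cobound zg.
apply: eq_ev_all (bd_dg _) _ => d; rewrite /= size_scanl size_tuple eqSS => /eqP sd.
have sd' : size (incr_cell d) == i by rewrite size_incr_cell /= sd.
rewrite (hom_cochainE c (t := Tuple sd')) // ffunE /=.
by rewrite sums_incr_cell Ig.
Qed.

Lemma hom_cocycle_class i (z : cocycle gT 'F_2 i) : class (hom_cochain (val z)).
Proof.
split; last exact: hom_cochain_invar.
move=> c; rewrite -hom_cochain_cobound; have := valP z; rewrite inE => /eqP->.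
by rewrite /hom_cochain; case: insub => //= t; rewrite ffunE.
Qed.
End Translation.

Lemma hom_cochain_res (hT gT : finGroupType) (phi : {multiplicative hT -> gT}) i
    (f : cochain gT 'F_2 i) c :
  hom_cochain (cochain_res phi f) c = resb phi (hom_cochain f) c.
Proof.
have E : incr_cell (bar_map phi c) = map phi (incr_cell c).
  rewrite /incr_cell /incr /= size_map /mkseq -map_comp; apply/eq_in_map => l.
  rewrite mem_iota => /andP[_]; rewrite add0n => lt_l /=.
  have phiM : {morph phi : x y / (x * y)%g} by move=> x y; exact: gmulfM.
  rewrite phiM (morphV _ phiM).
  congr (_^-1 * _)%g; last by rewrite (nth_map 1%g).
  rewrite -[_ :: map _ _]/(map phi (c.1 :: c.2)) (nth_map 1%g) //=.
  exact: ltnW.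
rewrite /resb; case: (eqVneq (dg c) i) => [dc|dc]; last first.
  by rewrite !hom_cochain_homog //= size_map.
have st : size (incr_cell c) == i by rewrite size_incr_cell dc.
rewrite (hom_cochainE (cochain_res phi f) (t := Tuple st)) // ffunE.
by rewrite (hom_cochainE f (t := map_tuple phi (Tuple st))).
Qed.

Lemma res_injective (hT gT : finGroupType) (phi : {multiplicative hT -> gT}) i :
  (forall x, class x -> homog i x -> null_on phi x -> null bar_act x) ->
  injective (res phi : 'H^i(gT) -> 'H^i(hT)).
Proof.
move=> det; elim/quotW => z; elim/quotW => z'; rewrite !res_pi => /eqP.
rewrite -Quotient.idealrBE => zz'; apply/eqP; rewrite -Quotient.idealrBE.
have zE : cocycle_res phi z - cocycle_res phi z' = cocycle_res phi (z - z').
  by apply: val_inj; rewrite /= -cochain_resB.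
apply/coboundaryP; apply: det (hom_cocycle_class _) (@hom_cochain_homog _ _ _) _.
move: zz'; rewrite zE => /coboundaryP.
by apply: eq_null => c; rewrite -hom_cochain_res.
Qed.

Local Close Scope ring_scope.

Theorem theorem3 (p e q : nat) (p_prime : prime p) (e_gt0 : 0 < e)
    (q_eq : q = p ^ e) (q_mod4 : q = 1 %[mod 4])
    (F : finFieldType) (card_F : #|F| = q)
    (m n : nat) (n_ge1 : 1 <= n) (le_nm : n <= m)
    (i : nat) (i_lt : i < 2 * n - 1) :
  injective (res (GL_stab F (leq_trans (leq_pred n) le_nm)) :
               'H^i(GL F m) -> 'H^i(GL F n.-1)).
Proof.
apply: res_injective => x zx hx nx.
apply: (stable _ _ zx hx nx); first by rewrite card_F q_mod4.
by lia.
Qed.
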